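(* Let $p$ be an odd prime, $F$ a finite extension of $\mathbb{Q}_p$, and $E/F$ a cyclic extension of degree $d$ with $p\nmid d$; let $\theta$ be a generator of $\mathrm{Gal}(E/F)$, acting entrywise on $GL_n(E)$. Let $m\ge1$, $K_E(m)=I_n+\varpi_E^mM_n(\mathcal O_E)$ ($\varpi_E$ a uniformizer of $E$), and $K_E(m)_\theta=K_E(m)\cap GL_n(F)$. Fix Haar measures $dg$ on $GL_n(E)$ and $dh$ on $GL_n(F)$. Put $f^H=\mathrm{vol}(K_E(m)_\theta)^{-1}\mathbf 1_{K_E(m)_\theta}\in C_c^\infty(GL_n(F))$ and $\widetilde f^G=\mathrm{vol}(K_E(m))^{-1}\mathbf 1_{K_E(m)\rtimes\theta}\in C_c^\infty(\widetilde G(F))$. Then for every semisimple $\gamma\in GL_n(F)$ and every semisimple $\delta\in GL_n(E)$, $$I_\gamma(f^H,dh,dh_\gamma)=\begin{cases}I_{\delta\rtimes\theta}(\widetilde f^G,dg,dg_{\delta\rtimes\theta}) & \text{if }\gamma\text{ is a norm of }\delta,\\ 0&\text{if }\gamma\text{ is not a norm (of any element of }GL_n(E)).\end{cases}$$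
   Context: Notation: $G=\mathrm{Res}_{E/F}(GL_n/E)$, $G(F)=GL_n(E)$, $H=GL_n/F$, $H(F)=GL_n(F)\subset G(F)$. The twisted space $\widetilde G=G\rtimes\theta$ has $\widetilde G(F)=\{g\rtimes\theta: g\in GL_n(E)\}$, with $G(F)$ acting by $g(x\rtimes\theta)g^{-1}=gx\theta(g)^{-1}\rtimes\theta$. For $\delta\in G(F)$, $G_{\delta\rtimes\theta}$ is the $F$-group with $R$-points $\{g\in GL_n(E\otimes_FR):g^{-1}\delta\theta(g)=\delta\}$. Identify $G(\bar F)\cong GL_n(\bar F)^d$ with $\theta$ acting by cyclic shift; if $\delta$ is $\theta$-conjugate ($\delta\mapsto g^{-1}\delta\theta(g)$) in $G(\bar F)$ to a diagonal element $(t_1,\dots,t_d)$, a semisimple $\gamma\in GL_n(F)$ is a norm of $\delta$ if $\gamma$ is $GL_n(\bar F)$-conjugate to $t_1\cdots t_d$; $\gamma$ is ''not a norm'' if it is a norm of no element of $G(F)$. Normalized orbital integrals: for $\delta=\delta_1\rtimes\theta$ with $\delta_1$ semisimple, $D_{\widetilde G}(\delta)=|\det((\mathrm{Ad}(\delta_1)\circ d\theta-1)|\mathfrak g/\mathfrak g_\delta)|_F$ with $\mathfrak g=M_n(E)$, $d\theta$ the entrywise Galois action, $\mathfrak g_\delta$ the Lie algebra of $G_\delta(F)$; $I_\delta(\widetilde f,dg,dg_\delta)=D_{\widetilde G}(\delta)^{1/2}\int_{G_\delta(F)\backslash G(F)}\widetilde f(g^{-1}\delta g)\,dg/dg_\delta$.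 For semisimple $\gamma\in H(F)$, $D_H(\gamma)=|\det((\mathrm{Ad}(\gamma)-1)|\mathfrak h/\mathfrak h_\gamma)|_F$ ($\mathfrak h=M_n(F)$), and $I_\gamma(f^H,dh,dh_\gamma)=D_H(\gamma)^{1/2}\int_{H_\gamma(F)\backslash H(F)}f^H(h^{-1}\gamma h)\,dh/dh_\gamma$. Haar measures on the centralizers $H_\gamma(F)$ and $G_{\delta\rtimes\theta}(F)$ are chosen compatibly (they are inner forms of each other). *)

(* Defs.v *)
From HB Require Import structures.
From mathcomp Require Import all_boot all_order all_fingroup all_algebra.
From mathcomp Require Import all_solvable all_field.
From mathcomp Require Import all_classical all_reals all_analysis.
From mathcomp Require Import measurable_realfun.
Set Implicit Arguments.
Unset Strict Implicit.
Unset Printing Implicit Defensive.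
Import Order.TTheory GRing.Theory Num.Theory.
Local Open Scope classical_set_scope.
Local Open Scope ring_scope.

Record absval (R : realType) (K : fieldType) := Absval {
  absv :> K -> R;
  absv_ge0 : forall x, 0 <= absv x;
  absv_eq0 : forall x, absv x = 0 <-> x = 0;
  absvM : forall x y, absv (x * y) = absv x * absv y;
  absv_ultra : forall x y, absv (x + y) <= Num.max (absv x) (absv y) }.

(* |x|_p for rational x, and Q_p as the completion of Q for |.|_p. *)
Definition padic_abs (R : realType) (p : nat) (x : rat) : R :=
  if x == 0 then 0
  else p%:R ^+ logn p `|denq x|%N / p%:R ^+ logn p `|numq x|%N.

Definition is_Qp (p : nat) (R : realType) (K : fieldType) (v : absval R K) :=
  [/\ forall x : rat, v (ratr x) = padic_abs R p x,
      forall (x : K) (e : R), 0 < e -> exists q : rat, v (x - ratr q) < e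
    & forall u : nat -> K,
        (forall e : R, 0 < e -> exists N, forall i j, (N <= i)%N -> (N <= j)%N ->
            v (u i - u j) < e) ->
        exists l, forall e : R, 0 < e ->
            exists N, forall i, (N <= i)%N -> v (u i - l) < e].

(* The normalized absolute value |x|_L = |N_{L/K} x|_K; it is determined by its
   restriction to K when K is complete. On Q_p itself it is the usual |.|_p, so
   on a finite extension of Q_p it sends a uniformizer to 1/q. *)
Definition normalized_extension (R : realType) (K : fieldType)
    (v : absval R K) (L : fieldExtType K) (w : absval R L) :=
  forall a : K, w a%:A = v a ^+ \dim {:L}.

Definition uniformizer (R : realType) (K : fieldType) (v : absval R K) (w : K) :=
  forall x, v x < 1 <-> exists2 y, v y <= 1 & x = w * y.

(* [valued v] is K with the topology of v; ['M[valued v]_(m, n)] then has the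
   product topology of the library. *)
Definition valued (R : realType) (K : fieldType) (v : absval R K) : Type := K.

Section ValuedTopology.
Variables (R : realType) (K : fieldType) (v : absval R K).
Local Notation T := (valued v).

HB.instance Definition _ := GRing.Field.on T.
HB.instance Definition _ := isPointed.Build T 0.

Definition valued_ball (x : T) (e : R) : set T :=
  [set y | v ((x : K) - (y : K)) < e].

Let absv0 : v 0 = 0. Proof. exact/absv_eq0. Qed.

Let absvN1 : v (-1) = 1.
Proof.
have v1 : v 1 = 1.
  have /eqP := absvM v 1 1; rewrite mulr1 -{1}[v 1]mulr1 => /eqP /mulfI -> //.
  by apply/eqP => /absv_eq0/eqP; rewrite oner_eq0.
have /eqP : v (-1) * v (-1) = 1 by rewrite -absvM mulrNN mulr1 v1.
rewrite -expr2 sqrf_eq1 => /orP[/eqP //|/eqP h].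
by have := absv_ge0 v (-1); rewrite h ler0N1.
Qed.

Let ball_center (x : T) (e : R) : 0 < e -> valued_ball x e x.
Proof. by move=> e0; rewrite /valued_ball /= subrr absv0. Qed.

Let ball_sym (x y : T) (e : R) : valued_ball x e y -> valued_ball y e x.
Proof.
by rewrite /valued_ball /= -opprB -mulN1r absvM absvN1 mul1r.
Qed.

Let ball_triangle (x y z : T) (e1 e2 : R) :
  valued_ball x e1 y -> valued_ball y e2 z -> valued_ball x (e1 + e2) z.
Proof.
rewrite /valued_ball /= => h1 h2.
have -> : (x : K) - z = (x - y) + (y - z) by rewrite addrA subrK.
apply: (le_lt_trans (absv_ultra v _ _)); rewrite gt_max; apply/andP; split.
- by rewrite (lt_le_trans h1)// lerDl (le_trans (absv_ge0 v _) (ltW h2)).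
- by rewrite (lt_le_trans h2)// lerDr (le_trans (absv_ge0 v _) (ltW h1)).
Qed.

HB.instance Definition _ := hasNbhs.Build T (nbhs_ (entourage_ valued_ball)).
HB.instance Definition _ := Nbhs_isPseudoMetric.Build R T
  erefl ball_center ball_sym ball_triangle erefl.

End ValuedTopology.

Section GeneralLinear.
Variables (R : realType) (K : fieldType) (v : absval R K) (n : nat).

Definition GL : Type :=
  initial_topology (fun A : {A : 'M[valued v]_n | A \in unitmx} => sval A).
HB.instance Definition _ := Topological.on GL.

Definition mxGL (g : GL) : 'M[K]_n := sval g.

Definition mkGL (A : 'M[K]_n) (uA : A \in unitmx) : GL :=
  exist (fun A : 'M[valued v]_n => A \in unitmx) A uA.

Lemma mxGL_unit (g : GL) : mxGL g \in unitmx. Proof. exact: (svalP g). Qed.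

Lemma mxGL_inj : injective mxGL. Proof. by move=> g h; exact: val_inj. Qed.

Definition oneGL : GL := mkGL (unitmx1 K n).

Lemma mulGL_subproof (g h : GL) : mxGL g *m mxGL h \in unitmx.
Proof. by rewrite unitmx_mul !mxGL_unit. Qed.
Definition mulGL (g h : GL) : GL := mkGL (mulGL_subproof g h).

Lemma invGL_subproof (g : GL) : invmx (mxGL g) \in unitmx.
Proof. by rewrite unitmx_inv mxGL_unit. Qed.
Definition invGL (g : GL) : GL := mkGL (invGL_subproof g).

Let mulGLA : associative mulGL.
Proof. by move=> g h k; apply: mxGL_inj; rewrite /= mulmxA. Qed.
Let mul1GL : left_id oneGL mulGL.
Proof. by move=> g; apply: mxGL_inj; rewrite /= mul1mx. Qed.
Let mulGL1 : right_id oneGL mulGL.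
Proof. by move=> g; apply: mxGL_inj; rewrite /= mulmx1. Qed.
Let mulVGL : left_inverse oneGL invGL mulGL.
Proof. by move=> g; apply: mxGL_inj; rewrite /= mulVmx// mxGL_unit. Qed.
Let mulGLV : right_inverse oneGL invGL mulGL.
Proof. by move=> g; apply: mxGL_inj; rewrite /= mulmxV// mxGL_unit. Qed.

HB.instance Definition _ :=
  isGroup.Build GL mulGLA mul1GL mulGL1 mulVGL mulGLV.
HB.instance Definition _ := isPointed.Build GL oneGL.

End GeneralLinear.

Section MapGL.
Variables (R : realType) (K L : fieldType) (v : absval R K) (w : absval R L).
Variables (f : {rmorphism K -> L}) (n : nat).

Lemma mapGL_subproof (g : GL v n) : map_mx f (mxGL g) \in unitmx.
Proof. by rewrite map_unitmx mxGL_unit. Qed.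
Definition mapGL (g : GL v n) : GL w n := mkGL w (mapGL_subproof g).
End MapGL.
Arguments mapGL {R K L v} w f {n} g.

Notation borel T := (g_sigma_algebraType (@open T)).

Section Cosets.
Variables (R : realType) (K : fieldType) (v : absval R K) (n : nat).
Local Notation G := (GL v n).

Definition rcosetGL (S : set G) (g : G) : set G := [set (s * g)%g | s in S].

Definition coset_space (S : set G) : Type := {C : set G | C \in range (rcosetGL S)}.

Variable S : set G.
HB.instance Definition _ := Choice.on (coset_space S).

Lemma rcosetGL_range (g : G) : rcosetGL S g \in range (rcosetGL S).
Proof. by rewrite inE; exists g. Qed.
Definition coset_proj (g : G) : coset_space S :=
  exist (fun C => C \in range (rcosetGL S)) (rcosetGL S g) (rcosetGL_range g).

HB.instance Definition _ := isPointed.Build (coset_space S) (coset_proj 1%g).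

Lemma coset_rep_subproof (C : coset_space S) : exists g, coset_proj g = C.
Proof.
case: C => C hC; have := hC; rewrite inE => -[g _ gC].
by exists g; exact: val_inj.
Qed.
Definition coset_rep (C : coset_space S) : G := sval (cid (coset_rep_subproof C)).

Definition coset_open (U : set (coset_space S)) := open (coset_proj @^-1` U).
Let coset_openT : coset_open setT. Proof. exact: openT. Qed.
Let coset_openI : setI_closed coset_open.
Proof. by move=> A B oA oB; exact: openI. Qed.
Let coset_open_bigU (I : Type) (f : I -> set (coset_space S)) :
  (forall i, coset_open (f i)) -> coset_open (\bigcup_i f i).
Proof. by move=> fo; rewrite /coset_open preimage_bigcup; apply: bigcup_open => i _; exact: fo. Qed.
HB.instance Definition _ := isOpenTopological.Build (coset_space S)
  coset_openT coset_openI coset_open_bigU.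

End Cosets.

Section HaarMeasures.
Variables (R : realType) (K : fieldType) (v : absval R K) (n : nat).
Local Notation G := (GL v n).
Local Open Scope ereal_scope.

(* A Haar measure on a closed (unimodular) subgroup S is represented by its
   extension by zero to the Borel sets of GL_n(K). *)
Definition haar_measure (S : set G) (mu : {measure set (borel G) -> \bar R}) :=
  [/\ mu (~` S) = 0,
      0 < mu S,
      forall C : set G, compact C -> C `<=` S -> mu C < +oo
    & forall (s : G) (B : set (borel G)), S s -> measurable B ->
        mu [set (s * x)%g | x in B] = mu B].

(* nu is the quotient dg/ds on S\G of the Haar measures dg on G and ds on S. *)
Definition quotient_measure (S : set G)
    (dg ds : {measure set (borel G) -> \bar R})
    (nu : {measure set (borel (coset_space S)) -> \bar R}) :=
  forall phi : borel G -> \bar R,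
    measurable_fun setT phi -> (forall g, 0 <= phi g) ->
    \int[dg]_g phi g = \int[nu]_C \int[ds]_(s in S) phi (s * coset_rep C)%g.

End HaarMeasures.

Definition additive_haar_measure (R : realType) (K : fieldType) (v : absval R K)
    (r : nat) (mu : {measure set (borel 'rV[valued v]_r) -> \bar R}) :=
  [/\ (0 < mu setT)%E,
      forall C : set 'rV[valued v]_r, compact C -> (mu C < +oo)%E
    & forall (a : 'rV[valued v]_r) (B : set (borel 'rV[valued v]_r)),
        measurable B -> mu [set a + x | x in B] = mu B].

(* M_n(E) as a vector space over F. *)
Definition resM (F : fieldType) (E : fieldExtType F) (n : nat) : Type := 'M[E]_n.

Section RestrictionOfScalars.
Import VectorInternalTheory.
Variables (F : fieldType) (E : fieldExtType F) (n : nat).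
Local Notation V := (resM E n).

HB.instance Definition _ := GRing.Zmodule.on V.

Definition resM_scale (a : F) (X : V) : V := (a%:A : E) *: (X : 'M[E]_n).

Let scaleA a b X : resM_scale a (resM_scale b X) = resM_scale (a * b) X.
Proof. by rewrite /resM_scale scalerA -scalerAl mul1r scalerA. Qed.
Let scale1 : left_id 1 resM_scale.
Proof. by move=> X; rewrite /resM_scale !scale1r. Qed.
Let scaleDr : right_distributive resM_scale +%R.
Proof. by move=> a X Y; rewrite /resM_scale scalerDr. Qed.
Let scaleDl X : {morph resM_scale^~ X : a b / a + b}.
Proof. by move=> a b; rewrite /resM_scale !scalerDl. Qed.

HB.instance Definition _ :=
  GRing.Zmodule_isLmodule.Build F V scaleA scale1 scaleDr scaleDl.

Definition resM_to_ffun (X : V) : {ffun 'I_n * 'I_n -> E} :=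
  [ffun ij => (X : 'M[E]_n) ij.1 ij.2].

Let resM_vect_iso : Vector.axiom (dim {ffun 'I_n * 'I_n -> E}) V.
Proof.
exists (fun X => v2r (resM_to_ffun X)).
  move=> a X Y; rewrite -linearP; congr (v2r _).
  by apply/ffunP=> ij; rewrite !ffunE !mxE -scalerAl mul1r.
exists (fun u => \matrix_(i, j) (r2v u : {ffun 'I_n * 'I_n -> E}) (i, j)).
  by move=> X; apply/matrixP=> i j; rewrite mxE v2rK ffunE.
move=> u; rewrite -[RHS]r2vK; congr (v2r _).
by apply/ffunP=> -[i j]; rewrite ffunE mxE.
Qed.

HB.instance Definition _ := Lmodule_hasFinDim.Build F V resM_vect_iso.
End RestrictionOfScalars.

Section LinearAlgebra.
Variables (F : fieldType) (V : vectType F).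

(* Determinant of the endomorphism induced by f on V / ker f, computed on a
   complement of ker f. *)
Definition det_mod_ker (f : 'End(V)) : F :=
  let U := ((lker f)^C)%VS in
  \det (\matrix_(i < \dim U, j < \dim U)
          coord (vbasis U) j (daddv_pi U (lker f) (f (vbasis U)`_i))).

(* The norm N_A(x) = \det (y |-> x y) of the algebra A with basis b. *)
Definition det_lmul (mulV : V -> V -> V) (r : nat) (b : r.-tuple V) (x : V) : F :=
  \det (\matrix_(i < r, j < r) coord b j (mulV x b`_i)).
End LinearAlgebra.

Section FormMeasure.
Variables (R : realType) (F : fieldType) (vF : absval R F) (V : vectType F).
Variables (mulV : V -> V -> V) (K : fieldType) (v : absval R K) (n : nat).
Variables (emb : GL v n -> V) (r : nat) (b : r.-tuple V).
Variable (lam : {measure set (borel 'rV[valued vF]_r) -> \bar R}).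

(* b is a basis of an F-subalgebra A of V, and B is a set of matrices.
   This is the volume of B \cap A^* for |omega_b|, where omega_b is the left
   invariant top degree form on A^* equal to 1 on b_1 /\ ... /\ b_r at the
   identity, i.e. omega_b = N_A(x)^-1 dx_1 /\ ... /\ dx_r in the coordinates
   given by b, and lam is the chosen Haar measure |dx_1 ... dx_r| on F^r. *)
Definition form_measure (B : set (GL v n)) : \bar R :=
  let elt (x : 'rV[valued vF]_r) : V := \sum_(i < r) (x 0 i : F) *: b`_i in
  (\int[lam]_(x in [set x | (emb @` B) (elt x)])
     ((vF (det_lmul mulV b (elt x)))^-1)%:E)%E.
End FormMeasure.

Section TwistedSpace.
Variables (R : realType) (F : fieldType) (vF : absval R F).
Variables (E : splittingFieldType F) (vE : absval R E).
Variables (theta : {rmorphism E -> E}) (n : nat).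
Variables (Fbar : closedFieldType) (iota : {rmorphism E -> Fbar}).
Local Notation d := (\dim {:E}).
Local Notation GE := (GL vE n).
Local Notation GF := (GL vF n).

Definition thetaGL : GE -> GE := mapGL vE theta.
Definition inclGL : GF -> GE := mapGL vE (in_alg E).

Definition semisimpleE (delta : GE) := diagonalizable (map_mx iota (mxGL delta)).
Definition semisimpleF (gamma : GF) := semisimpleE (inclGL gamma).

(* A point g \rtimes theta of the twisted space is represented by g; the action
   of x on it is the conjugation x (g \rtimes theta) x^-1. *)
Definition twisted_conj (x g : GE) : GE := (x * g * (thetaGL x)^-1)%g.
Definition conjF (x g : GF) : GF := (x * g * x^-1)%g.

Definition twisted_centralizer (delta : GE) : set GE :=
  [set g | (g^-1 * delta * thetaGL g)%g = delta].
Definition centralizerF (gamma : GF) : set GF :=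
  [set h | (h^-1 * gamma * h)%g = gamma].

(* E \otimes_F Fbar = Fbar^d by x \otimes y |-> (iota (theta^i x) y)_(i < d), and
   theta becomes the shift (x_0, ..., x_(d-1)) |-> (x_1, ..., x_(d-1), x_0). *)
Definition split_comp (delta : GE) (i : nat) : 'M[Fbar]_n :=
  map_mx iota (mxGL (iter i thetaGL delta)).

Definition is_norm (gamma : GF) (delta : GE) :=
  exists g t : 'I_d -> 'M[Fbar]_n,
    [/\ forall i, g i \in unitmx,
        forall i, t i = invmx (g i) *m split_comp delta i *m g (ordS i),
        forall i, is_diag_mx (t i)
      & exists2 h : 'M[Fbar]_n, h \in unitmx &
          map_mx iota (mxGL (inclGL gamma)) = invmx h *m (\prod_(i < d) t i) *m h].

(* Ad(delta) o d theta - 1 on M_n(E), and Ad(gamma) - 1 on M_n(F); their kernels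
   are the Lie algebras of the (twisted) centralizers. *)
Definition ad_twisted (delta : GE) : 'End(resM E n) :=
  linfun (fun X : resM E n =>
    (mxGL delta *m map_mx theta (X : 'M[E]_n) *m invmx (mxGL delta) : resM E n)
      - X).
Definition adF (gamma : GF) : 'End('M[F]_n) :=
  linfun (fun X : 'M[F]_n => mxGL gamma *m X *m invmx (mxGL gamma) - X).

Definition D_twisted (delta : GE) : R := vF (det_mod_ker (ad_twisted delta)).
Definition D_F (gamma : GF) : R := vF (det_mod_ker (adF gamma)).

Definition orbital_twisted (f : GE -> R) (delta : GE)
    (nu : {measure set (borel (coset_space (twisted_centralizer delta))) -> \bar R})
    : \bar R :=
  ((Num.sqrt (D_twisted delta))%:E *
   \int[nu]_C (f (twisted_conj (coset_rep C)^-1%g delta))%:E)%E.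

Definition orbital_F (f : GF -> R) (gamma : GF)
    (nu : {measure set (borel (coset_space (centralizerF gamma))) -> \bar R})
    : \bar R :=
  ((Num.sqrt (D_F gamma))%:E *
   \int[nu]_C (f (conjF (coset_rep C)^-1%g gamma))%:E)%E.

(* The first projection Fbar^d -> Fbar identifies G_(delta theta) over Fbar with
   the centralizer in GL_n(Fbar) of N = delta theta(delta) ... theta^(d-1)(delta),
   so if u^-1 N u = gamma, then psi : X |-> u^-1 X u is an inner twist from
   G_(delta theta) to H_gamma. If P is the matrix of d psi in bases b and c of the
   Lie algebras, then psi^* omega_c = (\det P) omega_b, and \det P is in F. The
   measures on the two inner forms are compatible when they are |omega_c| and
   |psi^* omega_c|. *)
Definition compatible_measures (gamma : GF) (delta : GE)
    (dh_gamma : {measure set (borel GF) -> \bar R})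
    (dg_delta : {measure set (borel GE) -> \bar R}) :=
  exists (r : nat) (b : r.-tuple (resM E n)) (c : r.-tuple 'M[F]_n)
    (lam : {measure set (borel 'rV[valued vF]_r) -> \bar R})
    (u : 'M[Fbar]_n) (P : 'M[Fbar]_r) (a : F),
  [/\ [/\ basis_of (lker (ad_twisted delta)) b,
          basis_of (lker (adF gamma)) c
        & additive_haar_measure lam],
      u \in unitmx /\ map_mx iota (mxGL (inclGL gamma)) =
        invmx u *m (\prod_(i < d) split_comp delta i) *m u,
      forall j : 'I_r, invmx u *m map_mx iota (b`_j : 'M[E]_n) *m u =
        \sum_(i < r) P i j *: map_mx iota (map_mx (in_alg E) c`_i),
      \det P = iota a%:A
    & (forall B : set (borel GF), measurable B ->
         dh_gamma B = form_measure (fun X Y : 'M[F]_n => X *m Y)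
                        (fun h : GF => mxGL h) c lam B) /\
      (forall B : set (borel GE), measurable B ->
         dg_delta B = (vF a)%:E *
           form_measure (fun X Y : resM E n => (X : 'M[E]_n) *m Y : resM E n)
             (fun g : GE => mxGL g : resM E n) b lam B)%E].

Definition KE (w : E) (m : nat) : set GE :=
  [set g | exists2 X : 'M[E]_n, (forall i j, vE (X i j) <= 1) &
             mxGL g = 1%:M + w ^+ m *: X].
Definition KE_theta (w : E) (m : nat) : set GF := inclGL @^-1` KE w m.

End TwistedSpace.
Arguments KE {R F E} vE {n} w m _.
Arguments orbital_twisted {R F} vF {E vE} theta {n} f delta nu.
Arguments orbital_F {R F vF n} f gamma nu.

Definition unit_mass (R : realType) (K : fieldType) (v : absval R K) (n : nat)
    (mu : {measure set (borel (GL v n)) -> \bar R}) (A : set (GL v n))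
    : GL v n -> R :=
  fun g => (fine (mu A))^-1 * \1_A g.

(* Main.v *)
Require Import Defs.
From HB Require Import structures.
From mathcomp Require Import all_boot all_order all_fingroup all_algebra.
From mathcomp Require Import all_solvable all_field.
From mathcomp Require Import all_classical all_reals all_analysis.
From mathcomp Require Import measurable_realfun.
From mathcomp Require Import ring.
Set Implicit Arguments.
Unset Strict Implicit.
Unset Printing Implicit Defensive.
Import Order.TTheory GRing.Theory Num.Theory.
Local Open Scope classical_set_scope.
Local Open Scope ring_scope.

(* Let K be the congruence subgroup of level m and K_theta = K \cap GL_n(F). As p does not divide
   d, every element of K has a unique d-th root in K, and a matrix intertwining d-th powers of
   elements of K intertwines the elements. If a conjugate of gamma lies in K_theta, then
   gamma = y V^d y^-1 with V in K_theta; the norm of delta is conjugate to V^d, and by Hilbert 90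
   delta = x V theta(x)^-1. So H_gamma = y S y^-1 and G_delta = x S x^-1, where S is the
   centralizer of V in GL_n(F), and the supports of the two integrands are y A and x A K, where
   A = {a | a^-1 V a in K_theta}. The double cosets S\A/K_theta and S\AK/K correspond, and the one
   of a contributes to each side the inverse of the volume of S \cap a K a^-1. These volumes are
   lattice volumes that differ by the determinant of the conjugation relating the two Lie
   algebras, which is +-1 since conjugation preserves the trace form. The discriminants agree
   because Ad(V) o theta - 1 is an isometry on the kernel of the trace of theta, and
   1 + Ad(V) + ... + Ad(V)^(d-1) one on the image of Ad(V) - 1.
   If no conjugate of gamma lies in K_theta, both sides vanish; and y V^d y^-1 is a norm of V. *)

(** * Ultrametric norms on matrices *)

(** The measure theory rests on one fact, drawn from the axioms of [is_Qp]: an invertible Q scales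
    Haar measure on F^r by |det Q|. The factor is multiplicative; at the scalar p it comes from
    counting residues in a Z_p-lattice, and it then spreads to scalars, dilations and, by LUP
    decomposition, all matrices. Centralizers are measured only on the sets S \cap g K g^-1, where
    the invariant density is 1.

    The absolute values are normalized, so |.|_E is |.|_F^d on F: the ball of radius rho around 1 in
    GL_n(E) meets GL_n(F) in the ball of radius rho^(1/d).

    Finiteness of the orbital integrals never enters: both become the same countable series in the
    extended reals, with representatives taken from a dense sequence.

    The inner twist in the compatibility of measures is conjugation by some u over Fbar, unrelated
    to the x and y that bring delta and gamma to normal form. The two identifications differ by a
    conjugation over Fbar that preserves the Lie algebra of H_gamma, which is why the trace form
    argument is made over an extension. *)

Section AbsoluteValue.
Variables (R : realType) (K : fieldType) (v : absval R K).
Implicit Types x y : K.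

Lemma absv0 : v 0 = 0. Proof. exact/absv_eq0. Qed.

Lemma absv_neq0 x : (v x != 0) = (x != 0).
Proof. by congr negb; apply/eqP/eqP => /(absv_eq0 v). Qed.

Lemma absv_gt0 x : (0 < v x) = (x != 0).
Proof. by rewrite lt_def absv_ge0 andbT absv_neq0. Qed.

Lemma absv1 : v 1 = 1.
Proof.
have := absvM v 1 1; rewrite mulr1 -{1}[v 1]mulr1 => /mulfI -> //.
by rewrite absv_neq0 oner_neq0.
Qed.

Lemma absvX x k : v (x ^+ k) = v x ^+ k.
Proof. by elim: k => [|k IH]; rewrite ?expr0 ?absv1// !exprS absvM IH. Qed.

Lemma absvN x : v (- x) = v x.
Proof.
have vN1 : v (-1) = 1.
  have /eqP : v (-1) * v (-1) = 1 by rewrite -absvM mulrNN mulr1 absv1.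
  rewrite -expr2 sqrf_eq1 => /orP[/eqP //|/eqP h].
  by have := absv_ge0 v (-1); rewrite h ler0N1.
by rewrite -mulN1r absvM vN1 mul1r.
Qed.

Lemma absvB x y : v (x - y) <= Num.max (v x) (v y).
Proof. by rewrite -(absvN y) absv_ultra. Qed.

Lemma absvC x y : v (x - y) = v (y - x).
Proof. by rewrite -absvN opprB. Qed.

Lemma absvV x : v x^-1 = (v x)^-1.
Proof.
have [->|x0] := eqVneq x 0; first by rewrite invr0 absv0 invr0.
have vx0 : v x != 0 by rewrite absv_neq0.
by apply: (mulfI vx0); rewrite -absvM !divff ?absv1.
Qed.

Lemma absv_sum (I : Type) (r : seq I) (P : pred I) (F : I -> K) (e : R) :
  0 <= e -> (forall i, P i -> v (F i) <= e) -> v (\sum_(i <- r | P i) F i) <= e.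
Proof.
move=> e0 Fe; apply: (big_ind (fun x => v x <= e)) => //; first by rewrite absv0.
by move=> x y xe ye; rewrite (le_trans (absv_ultra v x y))// ge_max xe.
Qed.

Lemma absv_prod (I : Type) (r : seq I) (P : pred I) (F : I -> K) :
  v (\prod_(i <- r | P i) F i) = \prod_(i <- r | P i) v (F i).
Proof. by apply: (big_morph _ (absvM v) absv1). Qed.

Lemma absv_nat k : v k%:R <= 1.
Proof.
elim: k => [|k IH]; first by rewrite absv0.
by rewrite -natr1 (le_trans (absv_ultra v _ _))// ge_max IH absv1 lexx.
Qed.

Lemma absv_add_lt x y : v x < v y -> v (x + y) = v y.
Proof.
move=> xy; apply/eqP; rewrite eq_le; apply/andP; split.
  by rewrite (le_trans (absv_ultra v _ _))// ge_max (ltW xy) lexx.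
have : v y <= Num.max (v (x + y)) (v x).
  by rewrite -{1}(addKr x y) addrC; exact: absvB.
by rewrite le_max => /orP[//|/(lt_le_trans xy)]; rewrite ltxx.
Qed.

Lemma absv_sign (b : nat) : v ((-1) ^+ b) = 1.
Proof. by rewrite absvX absvN absv1 expr1n. Qed.

End AbsoluteValue.

Section MatrixNorm.
Variables (R : realType) (K : fieldType) (v : absval R K).

Definition mxn m n (A : 'M[K]_(m, n)) : R := \big[Num.max/0]_i \big[Num.max/0]_j v (A i j).

Lemma mxn_leP m n (A : 'M[K]_(m, n)) (e : R) : 0 <= e ->
  mxn A <= e <-> forall i j, v (A i j) <= e.
Proof.
move=> e0; split=> [Ae i j|Ae].
  apply: le_trans Ae; rewrite /mxn.
  have h1 := le_bigmax 0 (fun j => v (A i j)) j.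
  have h2 := le_bigmax 0 (fun i => \big[Num.max/0]_j v (A i j)) i.
  exact: le_trans h1 h2.
by apply: bigmax_le => // i _ /=; apply: bigmax_le.
Qed.

Lemma mxn_ge0 m n (A : 'M[K]_(m, n)) : 0 <= mxn A.
Proof.
apply: (big_ind (fun x => 0 <= x)) => [//|x y x0 _|i _]; first by rewrite le_max x0.
by apply: (big_ind (fun x => 0 <= x)) => [//|x y x0 _|j _]; rewrite ?absv_ge0 ?le_max ?x0.
Qed.

Lemma mxn_ent m n (A : 'M[K]_(m, n)) i j : v (A i j) <= mxn A.
Proof. by move: i j; apply/mxn_leP; rewrite ?mxn_ge0. Qed.

Lemma mxn_le m n (A : 'M[K]_(m, n)) (e : R) : 0 <= e ->
  (forall i j, v (A i j) <= e) -> mxn A <= e.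
Proof. by move=> e0 /mxn_leP; exact. Qed.

Lemma mxn0 m n : mxn (0 : 'M[K]_(m, n)) = 0.
Proof. by apply/le_anti; rewrite mxn_ge0 andbT; apply: mxn_le => // i j; rewrite mxE absv0. Qed.

Lemma mxn_eq0 m n (A : 'M[K]_(m, n)) : mxn A <= 0 -> A = 0.
Proof.
move=> A0; apply/matrixP => i j; rewrite mxE; apply/(absv_eq0 v)/le_anti.
by rewrite absv_ge0 andbT (le_trans (mxn_ent A i j)).
Qed.

Lemma mxnD m n (A B : 'M[K]_(m, n)) : mxn (A + B) <= Num.max (mxn A) (mxn B).
Proof.
apply: mxn_le => [|i j]; first by rewrite le_max mxn_ge0.
by rewrite mxE (le_trans (absv_ultra v _ _))// ge_max !le_max !mxn_ent !orbT.
Qed.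

Lemma mxnN m n (A : 'M[K]_(m, n)) : mxn (- A) = mxn A.
Proof. by rewrite /mxn; apply: eq_bigr => i _; apply: eq_bigr => j _; rewrite mxE absvN. Qed.

Lemma mxnB m n (A B : 'M[K]_(m, n)) : mxn (A - B) <= Num.max (mxn A) (mxn B).
Proof. by rewrite -(mxnN B) mxnD. Qed.

Lemma mxnC m n (A B : 'M[K]_(m, n)) : mxn (A - B) = mxn (B - A).
Proof. by rewrite -mxnN opprB. Qed.

Lemma mxnD_le m n (A B : 'M[K]_(m, n)) e : mxn A <= e -> mxn B <= e -> mxn (A + B) <= e.
Proof. by move=> Ae Be; rewrite (le_trans (mxnD A B))// ge_max Ae. Qed.

Lemma mxnB_le m n (A B : 'M[K]_(m, n)) e : mxn A <= e -> mxn B <= e -> mxn (A - B) <= e.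
Proof. by move=> Ae Be; rewrite (le_trans (mxnB A B))// ge_max Ae. Qed.

Lemma mxn_tri m n (B A C : 'M[K]_(m, n)) : mxn (A - C) <= Num.max (mxn (A - B)) (mxn (B - C)).
Proof. by rewrite -{1}(subrK B A) -addrA mxnD. Qed.

Lemma mxn_sum m n (I : Type) (r : seq I) (P : pred I) (F : I -> 'M[K]_(m, n)) (e : R) :
  0 <= e -> (forall i, P i -> mxn (F i) <= e) -> mxn (\sum_(i <- r | P i) F i) <= e.
Proof.
move=> e0 Fe; apply: (big_ind (fun x => mxn x <= e)) => //; first by rewrite mxn0.
by move=> x y; exact: mxnD_le.
Qed.

Lemma mxnM m n p (A : 'M[K]_(m, n)) (B : 'M[K]_(n, p)) : mxn (A *m B) <= mxn A * mxn B.
Proof.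
apply: mxn_le => [|i j]; first by rewrite mulr_ge0 ?mxn_ge0.
rewrite mxE absv_sum ?mulr_ge0 ?mxn_ge0// => k _.
by rewrite absvM ler_pM ?absv_ge0 ?mxn_ent.
Qed.

Lemma mxnZ m n a (A : 'M[K]_(m, n)) : mxn (a *: A) = v a * mxn A.
Proof.
have [->|a0] := eqVneq a 0; first by rewrite scale0r mxn0 absv0 mul0r.
have le b (B : 'M[K]_(m, n)) : mxn (b *: B) <= v b * mxn B.
  apply: mxn_le => [|i j]; first by rewrite mulr_ge0 ?mxn_ge0 ?absv_ge0.
  by rewrite mxE absvM ler_wpM2l ?absv_ge0 ?mxn_ent.
apply/le_anti; rewrite le /=.
have va : 0 < v a by rewrite absv_gt0.
rewrite -ler_pdivlMl// -absvV; apply: le_trans (le _ _).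
by rewrite scalerA mulVf// scale1r.
Qed.

Lemma mxn1_le1 n : mxn (1%:M : 'M[K]_n) <= 1.
Proof. by apply: mxn_le => // i j; rewrite mxE; case: eqP; rewrite ?absv0 ?absv1. Qed.

(** Leibniz expansion: each term is, up to sign, a product of n entries, and the ultrametric sum
    does not exceed the largest term. *)
Lemma absv_det_le n (A : 'M[K]_n) (C : R) : 0 <= C -> mxn A <= C -> v (\det A) <= C ^+ n.
Proof.
move=> C0 AC; apply: absv_sum => [|s _]; first exact: exprn_ge0.
rewrite absvM absv_sign mul1r absv_prod.
rewrite -[X in C ^+ X](card_ord n) -prodr_const; apply: ler_prod => i _.
by rewrite absv_ge0 (le_trans (mxn_ent _ _ _)).
Qed.

Lemma mxn_mul_le m n p (A : 'M[K]_(m, n)) (B : 'M[K]_(n, p)) a b :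
  mxn A <= a -> mxn B <= b -> mxn (A *m B) <= a * b.
Proof.
by move=> Aa Bb; rewrite (le_trans (mxnM A B))// ler_pM ?mxn_ge0.
Qed.

Lemma mxn_lt m n (A : 'M[K]_(m, n)) e : 0 < e -> (mxn A < e) <-> (forall i j, v (A i j) < e).
Proof.
move=> e0; split=> [Ae i j|Ae]; first exact: le_lt_trans (mxn_ent _ _ _) Ae.
by apply: bigmax_lt => // i _ /=; apply: bigmax_lt.
Qed.

(** Bernoulli's inequality makes the powers of a real greater than 1 unbounded. This is the
    recurring device for sharp inequalities: an estimate with a spurious constant, applied to all
    powers, loses the constant. *)
Lemma bounded_powers_le1 (x C : R) : 0 <= x -> (forall k, x ^+ k <= C) -> x <= 1.
Proof.
move=> x0 xC; rewrite leNgt; apply/negP => x1.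
have h k : 1 + (x - 1) *+ k <= x ^+ k.
  elim: k => [|k IH]; first by rewrite mulr0n addr0.
  rewrite exprS mulrSr addrA; have x10 : 0 < x - 1 by rewrite subr_gt0.
  have : x ^+ k + (x - 1) * x ^+ k = x * x ^+ k by rewrite mulrBl mul1r addrC subrK.
  move=> <-; apply: lerD => //; rewrite ler_peMr ?(ltW x10)//.
  by apply: le_trans IH; rewrite lerDl mulrn_wge0// ltW.
have x10 : 0 < x - 1 by rewrite subr_gt0.
have [k hk] : exists k : nat, C / (x - 1) < k%:R.
  exists (Num.bound (C / (x - 1))); rewrite archi_boundP// divr_ge0 ?(ltW x10)//.
  by rewrite (le_trans ler01)// (xC 0%N).
have := le_trans (h k) (xC k); apply/negP; rewrite -ltNge.
move: hk; rewrite ltr_pdivrMr// mulr_natl => /lt_le_trans; apply.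
by rewrite lerDr.
Qed.

Lemma absv_det_bounded_powers n (B : 'M[K]_n) (C : R) :
  (forall k, mxn (B ^+ k) <= C) -> v (\det B) <= 1.
Proof.
move=> BC; apply: (@bounded_powers_le1 _ (C ^+ n)) => [|k]; first exact: absv_ge0.
rewrite -absvX; have -> : \det B ^+ k = \det (B ^+ k).
  by elim: k => [|k IH]; rewrite ?expr0 ?det1// !exprS IH -det_mulmx.
by apply: absv_det_le; rewrite // (le_trans _ (BC 0%N))// mxn_ge0.
Qed.
End MatrixNorm.

(** * Topology of matrix spaces and of the general linear group *)

Section Topology.
Variables (R : realType) (K : fieldType) (v : absval R K).

Lemma nbhs_mxP m n (A : 'M[valued v]_(m, n)) (U : set 'M[valued v]_(m, n)) :
  nbhs A U <-> exists2 e : R, 0 < e & forall B : 'M[K]_(m, n), mxn v (B - A) < e -> U B.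
Proof.
split=> [/nbhs_ballP[e e0 eU]|[e e0 eU]].
  exists e => // B BA; apply: eU; split=> // i j.
  rewrite -ball_normE /= || rewrite /ball /= /valued_ball /=.
  by have /mxn_lt := BA; move=> /(_ e0 i j); rewrite !mxE absvC.
apply/nbhs_ballP; exists e => // B [_ BA]; apply: eU; apply/mxn_lt => // i j.
by rewrite !mxE absvC; exact: BA.
Qed.

Lemma open_mxP m n (U : set 'M[valued v]_(m, n)) :
  open U <-> forall A, U A -> exists2 e : R, 0 < e &
    forall B : 'M[K]_(m, n), mxn v (B - A) < e -> U B.
Proof.
rewrite openE; split=> [oU A /oU /nbhs_mxP//|h A UA].
by apply/nbhs_mxP; exact: h.
Qed.

Lemma closed_mx_ball m n (A : 'M[K]_(m, n)) (e : R) : 0 <= e ->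
  closed ([set B : 'M[K]_(m, n) | mxn v (B - A) <= e] : set 'M[valued v]_(m, n)).
Proof.
move=> e0; rewrite -openC; apply/open_mxP => B /= /negP; rewrite -ltNge => BA.
exists (mxn v (B - A)) => [|C CB /=]; first exact: le_lt_trans BA.
apply/negP; rewrite -ltNge; apply: lt_le_trans BA _.
rewrite leNgt; apply/negP => CA.
have : mxn v (B - A) <= Num.max (mxn v (C - A)) (mxn v (C - B)).
  by rewrite (mxnC v C B) maxC; exact: mxn_tri.
by rewrite leNgt gt_max CA CB.
Qed.

(** Tychonoff for finitely many factors: the image of an ultrafilter under each entry is an
    ultrafilter on the compact ball, so it converges, and the limits of the entries form the limit
    matrix. *)
Lemma compact_mx m n (e : R) :
  compact [set x : valued v | v x <= e] ->
  compact ([set A : 'M[K]_(m, n) | mxn v A <= e] : set 'M[valued v]_(m, n)).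
Proof.
have [e0|e0] := ltP e 0.
  move=> _; rewrite [X in compact X](_ : _ = set0); first exact: compact0.
  apply/seteqP; split=> A //=.
  by rewrite leNgt (lt_le_trans e0)// mxn_ge0.
rewrite !compact_ultra => cO F UF Fe.
have conv i j : exists x : valued v, v x <= e /\ (forall d : R, 0 < d ->
    F [set A : 'M[valued v]_(m, n) | v (A i j - x) < d]).
  pose f (A : 'M[valued v]_(m, n)) := A i j.
  have rf : range f = setT.
    by apply/seteqP; split=> // x _; exists (const_mx x) => //; rewrite /f mxE.
  have [|x [xe Fx]] := cO _ (ultra_image UF rf).
    exists [set A | mxn v A <= e] => //; apply/seteqP; split=> x /=.
      by move=> [A Ae <-]; exact: le_trans (mxn_ent v A i j) Ae.
    by move=> xe; exists (const_mx x); rewrite /f ?mxE//; apply/mxn_leP => // k l; rewrite mxE.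
  exists x; split=> // d d0.
  have /= := Fx [set y | v (y - x) < d].
  case=> [|B FB fB].
    by apply/nbhs_ballP; exists d => // y; rewrite /ball/= /valued_ball/= absvC.
  apply: filterS FB => A BA /=.
  have : [set f y | y in B] (f A) by exists A.
  by rewrite fB.
have /choice[L hL] := fun ij => conv ij.1 ij.2.
exists (\matrix_(i, j) L (i, j)); split.
  by apply/mxn_leP => // i j; rewrite mxE; have [] := hL (i, j).
move=> U /nbhs_mxP[d d0 dU].
have : F [set A : 'M[valued v]_(m, n) | forall ij : 'I_m * 'I_n, v (A ij.1 ij.2 - L ij) < d].
  by apply: filter_forall => ij; have [_] := hL ij; exact.
apply: filterS => A AL; apply: dU; apply/mxn_lt => // i j.
by rewrite !mxE; exact: (AL (i, j)).
Qed.

Variable n : nat.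

Lemma nbhs_GLP (g : GL v n) (U : set (GL v n)) :
  nbhs g U <-> exists2 e : R, 0 < e & forall h : GL v n, mxn v (mxGL h - mxGL g) < e -> U h.
Proof.
split=> [|[e e0 eU]].
  move=> [W [[V oV <-] Vg] VU]; have /open_mxP/(_ _ Vg)[e e0 eV] := oV.
  by exists e => // h hg; apply: VU; exact: eV.
exists [set h : GL v n | mxn v (mxGL h - mxGL g) < e] => //.
split=> //; last by rewrite /= subrr mxn0.
exists [set h : 'M[valued v]_n | mxn v ((h : 'M[K]_n) - mxGL g) < e] => //.
apply/open_mxP => A /= Ae; exists e => // B BA.
rewrite -(subrK A B) -addrA; apply: (le_lt_trans (mxnD _ _ _)).
by rewrite gt_max BA.
Qed.

Lemma open_GLP (U : set (GL v n)) :
  open U <-> forall g, U g -> exists2 e : R, 0 < e &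
     forall h : GL v n, mxn v (mxGL h - mxGL g) < e -> U h.
Proof.
rewrite openE; split=> [oU A /oU /nbhs_GLP//|h A UA].
by apply/nbhs_GLP; exact: h.
Qed.

(** [GL] carries the topology induced by the inclusion into all matrices, so a cluster point found
    among the matrices is one in [GL] once it lies in the image of U. *)
Lemma compact_GL (U : set (GL v n)) :
  compact ([set mxGL g | g in U] : set 'M[valued v]_n) -> compact U.
Proof.
move=> cU F FF FU.
have FmF : ProperFilter (fmap (fun g : GL v n => (mxGL g : 'M[valued v]_n)) F).
  exact: fmap_proper_filter.
have [|_ [[g Ug <-] cg]] := cU _ FmF.
  rewrite /fmap /=; apply: (filterS _ FU) => g Ug /=; by exists g.
exists g; split=> // A B FA /nbhs_GLP[e e0 eB].
have [||x [[h Ah <-] hB]] := cg [set mxGL g | g in A] [set h | mxn v (h - mxGL g) < e].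
- rewrite /fmap /=; apply: (filterS _ FA) => h Ah /=; by exists h.
- by apply/nbhs_mxP; exists e.
by exists h; split=> //; exact: eB.
Qed.

End Topology.

(** The facts about the field that the measure theory rests on: compact balls give lattices finite
    volume, a nonzero element of absolute value below 1 allows scaling, and a countable dense
    sequence makes the quotients by open subgroups countable. *)
Definition local_field (R : realType) (K : fieldType) (v : absval R K) :=
  [/\ compact [set x : valued v | v x <= 1],
      (exists2 x, 0 < v x & v x < 1)
    & exists u : nat -> K, forall x (e : R), 0 < e -> exists j, v (x - u j) < e].

(** * Local fields *)

Section LocalField.
Variables (R : realType) (K : fieldType) (v : absval R K).

Lemma mxn_attained m n (A : 'M[K]_(m, n)) : A != 0 ->
  exists i j, mxn v A = v (A i j).
Proof.
move=> A0; have [i0 [j0 Aij]] : exists i j, A i j != 0.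
  apply: contrapT => h; move/eqP: A0; apply; apply/matrixP => i j; rewrite mxE.
  by apply/eqP; apply: contrapT => /negP Aij; apply: h; exists i, j.
have [[i j] _ max_ij] := @Order.TotalTheory.arg_maxP _ R ('I_m * 'I_n)%type (i0, j0) xpredT
  (fun ij => v (A ij.1 ij.2)) isT.
exists i, j; apply/le_anti; rewrite mxn_ent andbT; apply: mxn_le => [|k l].
  exact: absv_ge0.
exact: (max_ij (k, l)).
Qed.

Lemma nbhs_valuedP (x : valued v) (U : set (valued v)) :
  nbhs x U <-> exists2 e : R, 0 < e & forall y : K, v (y - (x : K)) < e -> U y.
Proof.
split=> [/nbhs_ballP[e e0 eU]|[e e0 eU]].
  by exists e => // y yx; apply: eU; rewrite /ball/= /valued_ball/= absvC.
by apply/nbhs_ballP; exists e => // y; rewrite /ball/= /valued_ball/= absvC; exact: eU.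
Qed.

Lemma closed_valued_ball (e : R) : closed [set x : valued v | v x <= e].
Proof.
rewrite -openC openE => x /= /negP; rewrite -ltNge => ex.
apply/nbhs_valuedP; have [x0|x0] := eqVneq (v x) 0.
  exists 1 => // y _ /=; apply/negP; rewrite -ltNge (lt_le_trans ex)// x0.
  exact: absv_ge0.
exists (v x) => [|y yx /=]; first by rewrite lt_def x0 absv_ge0.
apply/negP; rewrite -ltNge -(subrK (x : K) y).
by rewrite (absv_add_lt yx).
Qed.

Hypothesis lf : local_field v.

Lemma lf_small (e : R) : 0 < e -> exists2 x, 0 < v x & v x < e.
Proof.
move=> e0; have [_ [x x0 x1] _] := lf.
have [k xk] : exists k, v x ^+ k < e.
  apply: contrapT => h; suff : (v x)^-1 <= 1 by rewrite leNgt invf_gt1// x1.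
  apply: (@bounded_powers_le1 _ _ e^-1) => [|k]; first by rewrite invr_ge0 ltW.
  rewrite exprVn lef_pV2 ?posrE ?exprn_gt0// leNgt; apply/negP => xk.
  by apply: h; exists k.
by exists (x ^+ k); rewrite absvX// exprn_gt0.
Qed.

Lemma lf_large (e : R) : exists2 x, 0 < v x & e < v x.
Proof.
have e1 : 0 < `|e| + 1 by rewrite ltr_wpDl.
have [|x x0 xe] := @lf_small (`|e| + 1)^-1; first by rewrite invr_gt0.
exists x^-1; rewrite absvV ?invr_gt0//.
rewrite -[ltLHS]invrK; have [e0|e0] := leP e 0.
  by rewrite invrK (le_lt_trans e0)// invr_gt0.
rewrite ltf_pV2 ?posrE ?invr_gt0//; apply: lt_trans xe _.
by rewrite ltf_pV2 ?posrE// (ger0_norm (ltW e0)) ltrDl.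
Qed.

Lemma lf_compact_ball (e : R) : compact [set x : valued v | v x <= e].
Proof.
have [a a0 ea] := lf_large e; have [cO _ _] := lf.
pose f (x : valued v) : valued v := a * (x : K).
have : compact (f @` [set x | v x <= 1]).
  apply: continuous_compact cO; apply: continuous_subspaceT => x U.
  move=> /nbhs_valuedP[d d0 dU]; apply/nbhs_valuedP.
  exists (d / v a) => [|y yx]; first by rewrite divr_gt0.
  by apply: dU; rewrite -mulrBr absvM mulrC -ltr_pdivlMr.
move=> /(subclosed_compact _); apply; first exact: closed_valued_ball.
move=> x /= xe; exists (a^-1 * (x : K)); last first.
  by rewrite /f mulrA mulfV ?mul1r// -(absv_gt0 v).
by rewrite /= absvM absvV mulrC ler_pdivrMr ?mul1r// (le_trans xe)// ltW.
Qed.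

Lemma lf_compact_mx m n (e : R) :
  compact ([set A : 'M[K]_(m, n) | mxn v A <= e] : set 'M[valued v]_(m, n)).
Proof. exact/compact_mx/lf_compact_ball. Qed.

(** The compact ball supplies a cluster point, and a Cauchy sequence converges to its cluster
    point. *)
Lemma lf_complete m n (X : nat -> 'M[K]_(m, n)) (e : R) :
  (forall i, mxn v (X i) <= e) ->
  (forall d : R, 0 < d -> exists N, forall i j, (N <= i)%N -> (N <= j)%N ->
     mxn v (X i - X j) < d) ->
  exists l, forall d : R, 0 < d -> exists N, forall i, (N <= i)%N -> mxn v (X i - l) < d.
Proof.
move=> Xe cX.
have [|l [_ lX]] := @lf_compact_mx m n e ((X : nat -> 'M[valued v]_(m, n)) @ \oo) _.
  by exists 0%N => // i _; exact: Xe.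
exists l => d d0; have [N hN] := cX _ d0; exists N => i Ni.
have [||A [[j Nj <-] /= jl]] := lX [set X j | j in [set j | (N <= j)%N]] [set A | mxn v (A - l) < d].
- by exists N => // j Nj; exists j.
- by apply/nbhs_mxP; exists d.
by apply: (le_lt_trans (mxn_tri v (X j) _ _)); rewrite gt_max jl hN.
Qed.

Lemma lf_dense_mx m n : exists u : nat -> 'M[K]_(m, n),
  forall A (e : R), 0 < e -> exists j, mxn v (A - u j) < e.
Proof.
have [_ _ [u du]] := lf.
exists (fun j => if unpickle j is Some k then \matrix_(a, b) u ((k : 'M[nat]_(m, n)) a b) else 0).
move=> A e e0.
have /choice[k hk] : forall ab : 'I_m * 'I_n, exists k, v (A ab.1 ab.2 - u k) < e.
  by move=> ab; exact: du.
exists (pickle (\matrix_(a, b) k (a, b))); rewrite pickleK.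
by apply/mxn_lt => // a b; rewrite !mxE; exact: (hk (a, b)).
Qed.

End LocalField.

(** * Finite extensions of local fields *)

Section Extension.
Variables (R : realType) (K : fieldType) (v : absval R K).
Variables (L : fieldExtType K) (w : absval R L).
Hypotheses (lf : local_field v) (vw : normalized_extension v w).
Local Notation D := (\dim {:L}).
Local Notation b := (vbasis {:L}).

Let D_gt0 : (0 < D)%N.
Proof. exact: adim_gt0. Qed.

Definition basis_comb (a : 'rV[K]_D) : L := \sum_i a 0 i *: b`_i.

Lemma absv_scale (a : K) (x : L) : w (a *: x) = v a ^+ D * w x.
Proof. by rewrite -mulr_algl absvM vw. Qed.

(** The normalized absolute value of L restricts to the D-th power of that of K, hence the exponent
    D here and in every later comparison of norms. *)
Lemma basis_comb_le : exists2 B : R, 0 < B & forall a, w (basis_comb a) <= B * mxn v a ^+ D.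
Proof.
pose B : R := 1 + \sum_(i < D) w b`_i.
have s0 : 0 <= \sum_(i < D) w b`_i by apply: sumr_ge0 => i _; exact: absv_ge0.
exists B => [|a]; first by rewrite ltr_wpDr.
apply: absv_sum => [|i _]; first by rewrite mulr_ge0 ?exprn_ge0 ?mxn_ge0// addr_ge0.
rewrite absv_scale mulrC; apply: ler_pM; rewrite ?absv_ge0 ?exprn_ge0 ?absv_ge0//.
  rewrite /B (bigD1 i)//= addrCA lerDl addr_ge0// sumr_ge0// => j _; exact: absv_ge0.
by rewrite lerXn2r ?nnegrE ?absv_ge0 ?mxn_ge0 ?mxn_ent.
Qed.

Lemma basis_combB (a a' : 'rV[K]_D) : basis_comb (a - a') = basis_comb a - basis_comb a'.
Proof. by rewrite /basis_comb -sumrB; apply: eq_bigr => i _; rewrite !mxE scalerBl. Qed.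

Lemma basis_combZ (c : K) (a : 'rV[K]_D) : basis_comb (c *: a) = c *: basis_comb a.
Proof. by rewrite /basis_comb scaler_sumr; apply: eq_bigr => i _; rewrite !mxE scalerA. Qed.

Definition basis_coord (x : L) : 'rV[K]_D := \row_i coord b i x.

Lemma basis_coordK x : basis_comb (basis_coord x) = x.
Proof.
rewrite [RHS](coord_vbasis (memvf x)).
by apply: eq_bigr => i _; rewrite mxE.
Qed.

Lemma basis_combK a : basis_coord (basis_comb a) = a.
Proof.
by apply/rowP => i; rewrite mxE /basis_comb coord_sum_free// (basis_free (vbasisP _)).
Qed.

Let comb_continuous : continuous (basis_comb : 'rV[valued v]_D -> valued w).
Proof.
have [B B0 hB] := basis_comb_le.
move=> a U /nbhs_valuedP[e e0 eU]; apply/nbhs_mxP.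
exists (Num.min 1 (e / B)) => [|a' aa']; first by rewrite lt_min ltr01 divr_gt0.
apply: eU; rewrite -basis_combB; apply: (le_lt_trans (hB _)).
move: aa'; rewrite lt_min => /andP[a1 ae].
rewrite -ltr_pdivlMl// mulrC; apply: le_lt_trans ae.
by rewrite ler_iXnr ?mxn_ge0 ?(ltW a1).
Qed.

(* On the compact unit sphere of K^D the continuous function |.|_L does not vanish. *)
Lemma norm_equivalence : exists2 C : R, 0 < C & forall x, mxn v (basis_coord x) ^+ D <= C * w x.
Proof.
pose S : set 'rV[valued v]_D := [set a : 'rV[K]_D | mxn v a <= 1] `&`
  ~` [set a : 'rV[K]_D | mxn v a < 1].
have cS : compact S.
  apply: (subclosed_compact _ (lf_compact_mx (m := 1) (n := D) lf (e := 1))) => [|a []//].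
  apply: closedI.
    have := @closed_mx_ball _ _ v _ _ (0 : 'rV[K]_D) 1 ler01.
    by under eq_set do rewrite subr0.
  rewrite closedC; apply/open_mxP => a /= a1; exists 1 => // a' aa'.
  by rewrite -(subrK a a'); apply: (le_lt_trans (mxnD _ _ _)); rewrite gt_max aa'.
have cT : compact ((basis_comb : 'rV[valued v]_D -> valued w) @` S).
  by apply: continuous_compact cS; exact: continuous_subspaceT comb_continuous.
have hW : hausdorff_space (valued w).
  move=> x y xy; apply/eqP; rewrite -subr_eq0; apply/eqP/(absv_eq0 w)/eqP.
  apply: contrapT => /negP h.
  have xy0 : 0 < w ((x : L) - y) by rewrite lt_def h absv_ge0.
  have [||z [/= zx zy]] := xy [set z | w ((z : L) - x) < w ((x : L) - y)]
     [set z | w ((z : L) - y) < w ((x : L) - y)].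
  - by apply/nbhs_valuedP; exists (w ((x : L) - y)).
  - by apply/nbhs_valuedP; exists (w ((x : L) - y)).
  have : w ((x : L) - y) <= Num.max (w ((z : L) - x)) (w ((z : L) - y)).
    by rewrite (absvC w z x) -{1}(subrK (z : L) x) -addrA absv_ultra.
  by rewrite leNgt gt_max zx zy.
have : nbhs (0 : valued w) (~` ((basis_comb : 'rV[valued v]_D -> valued w) @` S)).
  apply: open_nbhs_nbhs; split; first by rewrite openC; exact: compact_closed.
  move=> [a [a1 na1] a0]; apply: na1 => /=.
  have -> : a = 0 by rewrite -(basis_combK a) a0; apply/rowP => i; rewrite !mxE linear0.
  by rewrite mxn0 ltr01.
move=> /nbhs_valuedP[e e0 eT].
exists e^-1 => [|x]; first by rewrite invr_gt0.
have [->|x0] := eqVneq x 0.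
  have -> : basis_coord 0 = 0 by apply/rowP => i; rewrite !mxE linear0.
  by rewrite mxn0 expr0n eqn0Ngt D_gt0 absv0 mulr0.
have a0 : basis_coord x != 0.
  apply: contra x0 => /eqP a0; rewrite -(basis_coordK x) a0.
  by apply/eqP; rewrite /basis_comb big1// => i _; rewrite mxE scale0r.
have [i [j ac]] := mxn_attained v a0.
set c := basis_coord x i j in ac.
have c0 : 0 < v c.
  rewrite -ac lt_def mxn_ge0 andbT; apply: contra a0 => /eqP h.
  by apply/eqP/(mxn_eq0 (v := v)); rewrite h.
have cn0 : c != 0 by rewrite -(absv_gt0 v).
have S1 : mxn v (c^-1 *: basis_coord x) = 1 by rewrite mxnZ absvV ac mulVf// gt_eqF.
rewrite ler_pdivlMl// ac leNgt; apply/negP => lt_e.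
apply: (eT (c^-1 *: x)); last first.
  exists (c^-1 *: basis_coord x); last by rewrite basis_combZ basis_coordK.
  by split; rewrite /= S1 // ltxx.
by rewrite subr0 absv_scale absvV exprVn mulrC ltr_pdivrMr// exprn_gt0.
Qed.

Lemma absv_coord_le : exists2 C : R, 0 < C & forall x i, v (coord b i x) ^+ D <= C * w x.
Proof.
have [C C0 hC] := norm_equivalence; exists C => // x i.
apply: le_trans (hC x); rewrite lerXn2r ?nnegrE ?absv_ge0 ?mxn_ge0//.
by have := mxn_ent v (basis_coord x) 0 i; rewrite mxE.
Qed.

Lemma local_field_ext : local_field w.
Proof.
have [C C0 hC] := norm_equivalence; split.
(* If the coordinates of x in the unit ball have norm N > 1, then N <= N^D <= C |x| <= C; so max(1,
   C) bounds them all. *)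
- pose B := Num.max 1 C.
  have := lf_compact_mx (m := 1) (n := D) lf (e := B).
  move=> /(continuous_compact (continuous_subspaceT comb_continuous)).
  move=> /(subclosed_compact _); apply; first exact: closed_valued_ball.
  move=> x /= x1; exists (basis_coord x); last exact: basis_coordK.
  rewrite /= /B le_max; have [//|/ltW h1/=] := leP (mxn v (basis_coord x)) 1.
  apply: le_trans (_ : mxn v (basis_coord x) ^+ D <= _).
    by rewrite ler_eXnr.
  by rewrite (le_trans (hC x))// -[leRHS]mulr1 ler_wpM2l// ltW.
- have [_ [x x0 x1] _] := lf; exists (x%:A); rewrite vw ?exprn_gt0//.
  by rewrite exprn_ilt1 ?absv_ge0// -lt0n.
- have [u du] := lf_dense_mx lf 1 D; exists (fun j => basis_comb (u j)) => x e e0.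
  have [B B0 hB] := basis_comb_le.
  have [|j hj] := du (basis_coord x) (Num.min 1 (e / B)).
    by rewrite lt_min ltr01 divr_gt0.
  exists j; rewrite -{1}(basis_coordK x) -basis_combB; apply: (le_lt_trans (hB _)).
  move: hj; rewrite lt_min => /andP[a1 ae].
  rewrite -ltr_pdivlMl// mulrC; apply: le_lt_trans ae.
  by rewrite ler_iXnr ?mxn_ge0 ?(ltW a1).
Qed.

End Extension.

(** * Residues and compactness in Q_p *)

Section PadicNumbers.
Variables (R : realType) (p : nat) (p_prime : prime p).
Variables (K : fieldType) (v : absval R K) (vP : is_Qp p v).

Let p_gt0 : (0 < p)%N. Proof. exact: prime_gt0. Qed.

Let pR_gt1 : 1 < p%:R :> R. Proof. by rewrite ltr1n prime_gt1. Qed.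

Lemma Qp_absv_nat k : (0 < k)%N -> v k%:R = (p%:R ^+ logn p k)^-1.
Proof.
move=> k0; have [vQ _ _] := vP; rewrite -(ratr_nat K) vQ /padic_abs.
rewrite pnatr_eq0 eqn0Ngt k0 /=.
have -> : k%:R = (k%:Z)%:Q by [].
by rewrite numq_int denq_int /= logn1 expr0 div1r.
Qed.

Lemma Qp_absv_p : v p%:R = p%:R^-1.
Proof. by rewrite Qp_absv_nat// logn_prime// eqxx expr1. Qed.

Lemma Qp_absv_unit k : ~~ (p %| k)%N -> v k%:R = 1.
Proof.
move=> pk; have k0 : (0 < k)%N by rewrite lt0n; apply: contraNneq pk => ->.
by rewrite Qp_absv_nat// lognE (negPf pk) !andbF expr0 invr1.
Qed.

Lemma Qp_absv_int (z : int) : v z%:~R <= 1.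
Proof. by case: z => k; rewrite ?NegzE ?mulrNz ?absvN; exact: absv_nat. Qed.

Lemma Qp_rat_den (q : rat) : v (ratr q) <= 1 -> ~~ (p %| `|denq q|)%N.
Proof.
have [vQ _ _] := vP; rewrite vQ /padic_abs; have [->|q0] := eqVneq q 0.
  by move=> _; rewrite [denq 0](denq_int 0) /= Euclid_dvd1.
have pX k : 0 < p%:R ^+ k :> R by rewrite exprn_gt0// ltr0n.
rewrite ler_pdivrMr// mul1r ler_eXn2l// => h; apply/negP => pd.
have d0 : (0 < `|denq q|)%N by rewrite absz_gt0 denq_neq0.
have n0 : (0 < `|numq q|)%N by rewrite absz_gt0 numq_eq0.
have cop : coprime `|numq q| `|denq q| by exact: coprime_num_den.
have ln0 : logn p `|numq q| = 0%N.
  apply/eqP; rewrite -leqn0 leqNgt logn_gt0 mem_primes p_prime n0 /=.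
  apply/negP => pn; have : (p %| gcdn `|numq q| `|denq q|)%N by rewrite dvdn_gcd pn.
  by rewrite (eqP cop) Euclid_dvd1.
by move: h; rewrite ln0 leqn0 eqn0Ngt logn_gt0 mem_primes p_prime d0 pd.
Qed.

(** A rational q close to x has denominator prime to p. A Bezout relation inverts that denominator
    modulo p^k, which turns q into a residue. *)
Lemma Qp_approx (x : K) k : v x <= 1 -> exists2 i, (i < p ^ k)%N & v (x - i%:R) <= v p%:R ^+ k.
Proof.
move=> x1; have [vQ dQ _] := vP.
have vp0 : 0 < v p%:R by rewrite Qp_absv_p invr_gt0 ltr0n.
have vp1 : v p%:R <= 1 by exact: absv_nat.
have [q xq] := dQ x (v p%:R ^+ k) (exprn_gt0 _ vp0).
have q1 : v (ratr q) <= 1.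
  rewrite -(subKr x (ratr q)) (le_trans (absvB v _ _))// ge_max x1 (le_trans (ltW xq))//.
  by rewrite exprn_ile1 ?absv_ge0.
have := Qp_rat_den q1; rewrite -prime_coprime// => cop.
have : coprimez (denq q) (p ^ k)%N.
  rewrite coprimezE /= coprime_sym; exact: coprimeXl.
move=> /coprimezP[[a b] /= ab].
pose i := (numq q * a %% (p ^ k)%N)%Z.
have pk0 : (p ^ k)%N%:Z != 0 by rewrite eqz_nat -lt0n expn_gt0 p_gt0.
have i0 : 0 <= i by exact: modz_ge0.
exists `|i|%N.
  by rewrite -ltz_nat gez0_abs// ltz_pmod// lt_def pk0.
have -> : `|i|%N%:R = i%:~R :> K by rewrite -[in RHS](gez0_abs i0).
have dn0 : (denq q)%:~R != 0 :> K.
  rewrite -(absv_neq0 v) -(gez0_abs (denq_ge0 q)) Qp_absv_unit ?oner_neq0//.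
  by rewrite -prime_coprime.
have vd : v (denq q)%:~R = 1.
  by rewrite -(gez0_abs (denq_ge0 q)) Qp_absv_unit// -prime_coprime.
have : v (ratr q - i%:~R) <= v p%:R ^+ k.
  have [c hc] : exists c : int, numq q - i * denq q = c * (p ^ k)%N.
    exists (numq q * b + (numq q * a %/ (p ^ k)%N)%Z * denq q).
    have -> : i = numq q * a - (numq q * a %/ (p ^ k)%N)%Z * (p ^ k)%N.
      by rewrite {1}(divz_eq (numq q * a) (p ^ k)%N) addrC addKr.
    rewrite -[X in X - _ = _](mulr1 (numq q)) -ab; ring.
  have -> : ratr q - i%:~R = (numq q - i * denq q)%:~R / (denq q)%:~R :> K.
    by rewrite /ratr intrB intrM mulrBl (mulfK dn0).
  rewrite absvM absvV vd invr1 mulr1 hc rmorphM /= absvM.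
  rewrite -absvX -natrX ler_piMl ?absv_ge0//; exact: Qp_absv_int.
move=> qi; rewrite -(subrK (ratr q) x) -addrA.
by rewrite (le_trans (absv_ultra v _ _))// ge_max (ltW xq).
Qed.

Let ultra_bigcup (T : Type) (F : set_system T) (N : nat) (A : 'I_N -> set T) :
  UltraFilter F -> F (\bigcup_i A i) -> exists i, F (A i).
Proof.
move=> UF FA; apply: contrapT => h.
have : F (\bigcup_i A i `&` ~` (\bigcup_i A i)).
  apply: filterI => //; rewrite setC_bigcup.
  have : \near F, forall i, (~` A i) F.
    apply: filter_forall => i; have [Fi|//] := in_ultra_setVsetC (A i) UF.
    by exfalso; apply: h; exists i.
  by apply: filterS => x hx i _; exact: hx.
by rewrite setICr; exact: filter_not_empty.
Qed.

Let filter_meet (T : Type) (F : set_system T) (A B : set T) :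
  ProperFilter F -> F A -> F B -> exists2 x, A x & B x.
Proof.
by move=> PF FA FB; have [x [Ax Bx]] := filter_ex (filterI FA FB); exists x.
Qed.

(** For compactness of the unit ball, an ultrafilter contains, for each k, one of the finitely many
    residue classes modulo p^k. The chosen residues form a Cauchy sequence, since any two classes
    meet, and completeness gives the limit. *)
Lemma Qp_local_field : local_field v.
Proof.
have [vQ dQ cQ] := vP.
have vp0 : 0 < v p%:R by rewrite Qp_absv_p invr_gt0 ltr0n.
have vp1 : v p%:R < 1 by rewrite Qp_absv_p invf_lt1// (lt_trans ltr01).
split; last 1 first.
- exists (fun j => ratr (odflt 0 (unpickle j))) => x e e0.
  by have [q xq] := dQ x e e0; exists (pickle q); rewrite pickleK.
- rewrite compact_ultra => F UF FO.
  have /choice[c hc] : forall k, exists c : K, F [set x : valued v | v ((x : K) - c) <= v p%:R ^+ k].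
    move=> k.
    have /ultra_bigcup[i Fi] : F (\bigcup_(i : 'I_(p ^ k))
        [set x : valued v | v ((x : K) - (i : nat)%:R) <= v p%:R ^+ k]).
      apply: filterS FO => x /= /Qp_approx-/(_ k)[i ik xi].
      by exists (Ordinal ik).
    by exists (i : nat)%:R.
  have lt_e (e : R) : 0 < e -> exists N, forall k, (N <= k)%N -> v p%:R ^+ k < e.
    move=> e0; have [N hN] : exists N, v p%:R ^+ N < e.
      apply: contrapT => h; suff : (v p%:R)^-1 <= 1 by rewrite leNgt invf_gt1// vp1.
      apply: (@bounded_powers_le1 _ _ e^-1) => [|k]; first by rewrite invr_ge0 ltW.
      rewrite exprVn lef_pV2 ?posrE ?exprn_gt0// leNgt; apply/negP => xk.
      by apply: h; exists k.
    exists N => k Nk; apply: le_lt_trans hN; apply: ler_wiXn2l => //; exact: ltW.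
  have cc i j : v (c i - c j) <= Num.max (v p%:R ^+ i) (v p%:R ^+ j).
    have [x /= xi xj] := filter_meet _ (hc i) (hc j).
    rewrite -(subrK (x : K) (c i)) -addrA (le_trans (absv_ultra v _ _))//.
    by rewrite absvC ge_max !le_max xi xj orbT.
  have [|l hl] := cQ c.
    move=> e e0; have [N hN] := lt_e e e0; exists N => i j Ni Nj.
    by apply: le_lt_trans (cc i j) _; rewrite gt_max !hN.
  have Fl (e : R) : 0 < e -> F [set x : valued v | v ((x : K) - l) < e].
    move=> e0; have [N hN] := lt_e e e0; have [M hM] := hl e e0.
    pose k := maxn N M; apply: filterS (hc k) => x /= xk.
    rewrite -(subrK (c k) (x : K)) -addrA (le_lt_trans (absv_ultra v _ _))// gt_max.
    by rewrite (le_lt_trans xk) ?hN ?hM ?leq_maxl ?leq_maxr.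
  exists l; split.
    have [x /= xl x1] := filter_meet _ (Fl 1 ltr01) FO.
    rewrite -(subKr (x : K) l) (le_trans (absvB v _ _))// ge_max x1 absvC absvC.
    exact: ltW.
  by move=> U /nbhs_valuedP[e e0 eU]; apply: filterS (Fl e e0) => y; exact: eU.
- by exists p%:R.
Qed.

End PadicNumbers.

(** * Haar measure of lattices *)

Lemma measurable_open (T : ptopologicalType) (U : set T) :
  open U -> measurable (U : set (borel T)).
Proof. by move=> oU; apply: sub_sigma_algebra. Qed.

(** The indices that come first in their class: one index for each class of e met by the sequence u
    inside P. It provides representatives of countably many cosets. *)
Definition first_reps (T : Type) (P : set T) (e : T -> T -> Prop) (u : nat -> T) : set nat :=
  [set j | P (u j) /\ forall i, (i < j)%N -> P (u i) -> ~ e (u i) (u j)].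

Lemma first_repsP (T : Type) (P : set T) (e : T -> T -> Prop) (u : nat -> T) :
  (forall x y z, e x y -> e y z -> e x z) ->
  forall j, P (u j) -> (e (u j) (u j)) -> exists2 i, first_reps P e u i & e (u i) (u j).
Proof.
move=> etr j Pj ejj; have ex : exists i, `[< P (u i) /\ e (u i) (u j) >].
  by exists j; apply/asboolP.
case: (ex_minnP ex) => i /asboolP[Pi ei] imin; exists i => //; split=> // k ki Pk ek.
by have := imin k; rewrite leqNgt ki => /(_ _)/negP; apply => //; apply/asboolP; split=> //; exact: etr ei.
Qed.

Section Lattices.
Variables (R : realType) (F : fieldType) (v : absval R F) (lf : local_field v) (r : nat).
Implicit Types (S M : set 'rV[F]_r) (Q : 'M[F]_r).

Definition mulmx_set Q S : set 'rV[F]_r := [set x *m Q | x in S].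

(** A bounded open subgroup. Stability under the integers of F is not part of the definition, so
    that the Z_p-span of a Q_p-basis of F counts as a lattice. *)
Definition lattice S :=
  [/\ S 0, forall x y, S x -> S y -> S (x - y),
      exists2 e : R, 0 < e & forall x, mxn v x <= e -> S x
    & exists C : R, forall x, S x -> mxn v x <= C].

Definition integral_lattice : set 'rV[F]_r := [set x | mxn v x <= 1].

Lemma lattice_ball (e : R) : 0 < e -> lattice [set x | mxn v x <= e].
Proof.
move=> e0; split=> /=; [by rewrite mxn0 ltW| |by exists e|by exists e].
by move=> x y; exact: mxnB_le.
Qed.

Lemma latticeD S x y : lattice S -> S x -> S y -> S (x + y).
Proof.
by move=> [S0 SB _ _] Sx Sy; rewrite -[y]opprK; apply: (SB) => //; rewrite -[- y]add0r; exact: SB.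
Qed.

Lemma mulmx_set1 S : mulmx_set 1%:M S = S.
Proof.
by apply/seteqP; split=> x; [move=> [y Sy <-]; rewrite mulmx1|exists x; rewrite ?mulmx1].
Qed.

Lemma mulmx_setM Q Q' S : mulmx_set Q' (mulmx_set Q S) = mulmx_set (Q *m Q') S.
Proof.
apply/seteqP; split=> x.
  by move=> [_ [y Sy <-] <-]; exists y => //; rewrite mulmxA.
by move=> [y Sy <-]; exists (y *m Q); [exists y|rewrite mulmxA].
Qed.

Lemma lattice_mulmx S Q : Q \in unitmx -> lattice S -> lattice (mulmx_set Q S).
Proof.
move=> uQ [S0 SB [e e0 eS] [C SC]]; split.
- by exists 0 => //; rewrite mul0mx.
- by move=> _ _ [x Sx <-] [y Sy <-]; exists (x - y); [exact: SB|rewrite mulmxBl].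
- have q0 : 0 < mxn v (invmx Q) + 1 by rewrite ltr_wpDl ?mxn_ge0.
  exists (e / (mxn v (invmx Q) + 1)) => [|x xe]; first by rewrite divr_gt0.
  exists (x *m invmx Q); last by rewrite mulmxKV.
  apply: eS; apply: le_trans (mxnM v _ _) _.
  move: xe; rewrite ler_pdivlMr//; apply: le_trans.
  by rewrite ler_wpM2l ?mxn_ge0// lerDl.
- exists (C * mxn v Q) => _ [x Sx <-]; apply: le_trans (mxnM v _ _) _.
  by rewrite ler_wpM2r ?mxn_ge0// SC.
Qed.

Lemma lattice_open S : lattice S -> open (S : set 'rV[valued v]_r).
Proof.
move=> lS; have [S0 SB [e e0 eS] _] := lS; apply/open_mxP => x Sx.
exists e => // y yx; rewrite -(subrK x y); apply: (latticeD lS) => //.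
by apply: eS; exact: ltW.
Qed.

Lemma translate_open (U : set 'rV[valued v]_r) (a : 'rV[valued v]_r) :
  open U -> open [set a + x | x in U].
Proof.
move=> /open_mxP oU; apply/open_mxP => _ [x Ux <-]; have [e e0 eU] := oU x Ux.
exists e => // y yx; exists (y - a); last by rewrite addrC subrK.
by apply: eU; move: yx; rewrite opprD addrA.
Qed.

Variable lam : {measure set (borel 'rV[valued v]_r) -> \bar R}.
Hypothesis lamP : additive_haar_measure lam.

Lemma lattice_measurable S : lattice S -> measurable (S : set (borel 'rV[valued v]_r)).
Proof. by move=> /lattice_open/measurable_open. Qed.

Lemma lam_translate S (a : 'rV[F]_r) : open (S : set 'rV[valued v]_r) ->
  lam [set a + x | x in S] = lam S.
Proof. by have [_ _ inv] := lamP; move=> oS; apply: inv; exact: measurable_open. Qed.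

Lemma lattice_fin S : lattice S -> (lam S < +oo)%E.
Proof.
move=> lS; have [_ _ _ [C SC]] := lS; have [_ fin _] := lamP.
pose C' := Num.max C 1.
have C'0 : 0 < C' by rewrite lt_max ltr01 orbT.
have := fin _ (lf_compact_mx (m := 1) (n := r) lf (e := C')).
apply: le_lt_trans; apply: le_measure; rewrite ?inE.
- exact: lattice_measurable.
- exact: (lattice_measurable (lattice_ball C'0)).
- by move=> x /SC xC /=; rewrite le_max xC.
Qed.

(* S is a countable disjoint union of cosets of M, hence S Q is the union of the
   corresponding cosets of M Q. *)
Lemma coset_decomposition S M : lattice M -> (forall x y, S x -> M y -> S (x + y)) ->
  exists J : set nat, forall Q, Q \in unitmx ->
    lam (mulmx_set Q S) = (\sum_(0 <= j <oo | j \in J) lam (mulmx_set Q M))%E.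
Proof.
move=> lM SM; have [u du] := lf_dense_mx lf 1 r.
have [M0 MB [e e0 eM] _] := lM.
pose eqM (x y : 'rV[F]_r) := M (x - y).
have eq_tr x y z : eqM x y -> eqM y z -> eqM x z.
  by move=> xy yz; rewrite /eqM -(subrK y x) -addrA; exact: latticeD.
have eq_sym x y : eqM x y -> eqM y x.
  by rewrite /eqM => xy; rewrite -opprB -[- _]add0r; exact: MB.
exists (first_reps S eqM u) => Q uQ.
pose A j : set 'rV[valued v]_r := [set u j *m Q + x | x in mulmx_set Q M].
have oMQ := lattice_open (lattice_mulmx uQ lM).
have -> : mulmx_set Q S = \bigcup_(j in first_reps S eqM u) A j.
  apply/seteqP; split=> [_ [x Sx <-]|_ [j [Sj _] [_ [y My <-] <-]]]; last first.
    by exists (u j + y); [exact: SM|rewrite mulmxDl].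
  have [j xj] := du x e e0.
  have xuj : eqM (u j) x by apply: eM; rewrite mxnC ltW.
  have Sj : S (u j) by rewrite -(subrK x (u j)) addrC; exact: SM.
  have [|i Ji ij] := @first_repsP _ S eqM u eq_tr j Sj; first by rewrite /eqM subrr.
  exists i => //; exists ((x - u i) *m Q); last by rewrite -mulmxDl addrC subrK.
  by exists (x - u i) => //; apply: eq_sym; exact: eq_tr xuj.
rewrite measure_bigcup.
- by apply: eq_eseriesr => j _; exact: lam_translate.
- by move=> j _; apply: measurable_open; exact: translate_open.
- move=> i j [Si mi] [Sj mj] [_ [[_ [x Mx <-] <-] [_ [y My <-]]]].
  rewrite -!mulmxDl => /(can_inj (mulmxK uQ)) xy.
  have ij : eqM (u i) (u j).
    have -> : u i = u j + y - x by rewrite xy addrK.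
    by rewrite /eqM addrAC [u j + y]addrC addrK; exact: MB.
  case: (ltngtP i j) => // [ij'|ji]; first by case: (mj _ ij' Si).
  by case: (mi _ ji Sj); exact: eq_sym.
Qed.

(** Otherwise the whole space, a countable union of translates of S, would be null. *)
Lemma lattice_gt0 S : lattice S -> (0 < lam S)%E.
Proof.
move=> lS; rewrite lt0e measure_ge0 andbT; apply/eqP => S0.
have [J hJ] := @coset_decomposition setT S lS (fun _ _ _ _ => I).
have := hJ _ (unitmx1 _ _); rewrite !mulmx_set1 S0 eseries0// => T0.
by have [] := lamP; rewrite T0 ltxx.
Qed.

Lemma lattice_fine S : lattice S -> (fine (lam S))%:E = lam S.
Proof. by move=> lS; rewrite fineK// ge0_fin_numE ?lattice_fin. Qed.

Lemma lattice_fine_gt0 S : lattice S -> 0 < fine (lam S).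
Proof. by move=> lS; rewrite -lte_fin lattice_fine// lattice_gt0. Qed.

(** The module of the automorphism Q: the factor by which it scales Haar measure, read off on the
    unit ball. *)
Definition modulus Q : R := fine (lam (mulmx_set Q integral_lattice)) / fine (lam integral_lattice).

Let lO : lattice integral_lattice. Proof. exact: lattice_ball. Qed.

(** Both S and the unit ball are countable unions of cosets of one small ball M, with index sets
    that do not depend on Q. So both are scaled by the same factor as M. *)
Lemma modulusE Q S : Q \in unitmx -> lattice S ->
  lam (mulmx_set Q S) = ((modulus Q)%:E * lam S)%E.
Proof.
move=> uQ lS; have [S0 SB [e e0 eS] _] := lS.
pose M := [set x : 'rV[F]_r | mxn v x <= Num.min e 1].
have lM : lattice M by apply: lattice_ball; rewrite lt_min e0 ltr01.
have MS T : lattice T -> M `<=` T -> exists J : set nat, forall Q, Q \in unitmx ->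
    lam (mulmx_set Q T) = (\sum_(0 <= j <oo | j \in J) lam (mulmx_set Q M))%E.
  by move=> lT MT; apply: coset_decomposition => // x y Tx /MT; exact: latticeD.
pose c := fine (lam (mulmx_set Q M)) / fine (lam M).
have MQ : lam (mulmx_set Q M) = (c%:E * lam (mulmx_set 1%:M M))%E.
  rewrite mulmx_set1 -(lattice_fine lM) -EFinM mulfVK ?lattice_fine//.
    exact: lattice_mulmx.
  by rewrite gt_eqF// lattice_fine_gt0.
have TQ T : lattice T -> M `<=` T -> lam (mulmx_set Q T) = (c%:E * lam T)%E.
  move=> lT MT; have [J hJ] := MS T lT MT.
  rewrite hJ// -[in RHS](mulmx_set1 T) (hJ _ (unitmx1 _ _)) MQ nneseriesZl//.
rewrite TQ//; last by move=> x; rewrite /M /= le_min => /andP[xe _]; exact: eS.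
congr (_%:E * _)%E; rewrite /modulus TQ//; last by move=> x; rewrite /M /= le_min => /andP[].
by rewrite -(lattice_fine lO) /= mulfK// gt_eqF// lattice_fine_gt0.
Qed.

Lemma modulus_gt0 Q : Q \in unitmx -> 0 < modulus Q.
Proof.
by move=> uQ; rewrite divr_gt0 ?lattice_fine_gt0//; exact: lattice_mulmx.
Qed.

Lemma modulusM Q Q' : Q \in unitmx -> Q' \in unitmx ->
  modulus (Q *m Q') = modulus Q * modulus Q'.
Proof.
move=> uQ uQ'; rewrite {1}/modulus -mulmx_setM modulusE//; last exact: lattice_mulmx.
rewrite modulusE// -(lattice_fine lO) -!EFinM /=.
by rewrite mulrA mulfK 1?mulrC// gt_eqF// lattice_fine_gt0.
Qed.

Lemma modulus1 : modulus 1%:M = 1.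
Proof. by rewrite /modulus mulmx_set1 divff// gt_eqF// lattice_fine_gt0. Qed.

Lemma modulusV Q : Q \in unitmx -> modulus (invmx Q) = (modulus Q)^-1.
Proof.
move=> uQ; apply: (mulfI (lt0r_neq0 (modulus_gt0 uQ))).
by rewrite -modulusM ?unitmx_inv// mulmxV// modulus1 mulfV// gt_eqF// modulus_gt0.
Qed.

Lemma modulus_le1 Q : Q \in unitmx -> mxn v Q <= 1 -> modulus Q <= 1.
Proof.
move=> uQ Q1; rewrite ler_pdivrMr ?lattice_fine_gt0// mul1r -lee_fin !lattice_fine//; last first.
  exact: lattice_mulmx.
apply: le_measure; rewrite ?inE; [|exact: lattice_measurable|].
  by apply: lattice_measurable; exact: lattice_mulmx.
by move=> _ [x x1 <-]; rewrite /integral_lattice /= -[leRHS]mul1r mxn_mul_le.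
Qed.

Lemma mxn_adj_le1 Q : mxn v Q <= 1 -> mxn v (\adj Q) <= 1.
Proof.
move=> Q1; apply: mxn_le => // i j; rewrite mxE /cofactor absvM absv_sign mul1r.
rewrite -[leRHS](expr1n _ r.-1); apply: absv_det_le => //.
by apply: mxn_le => // k l; rewrite !mxE (le_trans (mxn_ent _ _ _ _)).
Qed.

(** The inverse of Q, its adjugate divided by a unit, is integral too; Q and its inverse both have
    modulus at most 1. *)
Lemma modulus_integral Q : mxn v Q <= 1 -> v (\det Q) = 1 -> modulus Q = 1.
Proof.
move=> Q1 d1; have d0 : \det Q != 0 by rewrite -(absv_gt0 v) d1.
have uQ : Q \in unitmx by rewrite unitmxE unitfE.
apply/le_anti; rewrite modulus_le1//= -(invr1 R) -[leRHS]invrK -modulusV//.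
rewrite lef_pV2 ?posrE ?modulus_gt0 ?unitmx_inv// modulus_le1 ?unitmx_inv//.
by rewrite /invmx uQ mxnZ absvV d1 invr1 mul1r mxn_adj_le1.
Qed.

End Lattices.

(** * The modulus of a linear map is the absolute value of its determinant *)

Section ModulusDeterminant.
Variables (R : realType) (F : fieldType) (v : absval R F) (lf : local_field v) (r : nat).
Variable lam : {measure set (borel 'rV[valued v]_r) -> \bar R}.
Hypothesis lamP : additive_haar_measure lam.
Local Notation modulus := (modulus lam).

Let scalar_unit (a : F) : a != 0 -> a%:M \in @unitmx F r.
Proof. by move=> a0; rewrite unitmxE det_scalar unitfE expf_neq0. Qed.

Lemma modulus_prod (I : Type) (s : seq I) (P : pred I) (Q : I -> 'M[F]_r) :
  (forall i, P i -> Q i \in unitmx) ->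
  modulus (\big[mulmx/1%:M]_(i <- s | P i) Q i) = \prod_(i <- s | P i) modulus (Q i)
  /\ \big[mulmx/1%:M]_(i <- s | P i) Q i \in unitmx.
Proof.
move=> uQ; elim: s => [|i s [IH uIH]]; first by rewrite !big_nil modulus1// unitmx1.
rewrite !big_cons; case: ifP => // Pi; split; last by rewrite unitmx_mul uQ.
by rewrite modulusM ?uQ// IH.
Qed.

Let power_bound_le (s t b : R) : 0 < s -> 0 < t -> 0 < b ->
  (forall k, s ^+ k * b <= t ^+ k) -> s <= t.
Proof.
move=> s0 t0 b0 h; have : s / t <= 1.
  apply: (@bounded_powers_le1 _ _ b^-1) => [|k]; first by rewrite divr_ge0 ?ltW.
  have tk : 0 < t ^+ k by exact: exprn_gt0.
  by rewrite expr_div_n ler_pdivrMr// mulrC ler_pdivlMr.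
by rewrite ler_pdivrMr// mul1r.
Qed.

(* g a := modulus (a I) / |a|^r is multiplicative and trivial at x; dividing a power of a
   by a power of x shows that the powers of g a are bounded. *)
Lemma modulus_scalar (x : F) : 0 < v x < 1 -> modulus x%:M = v x ^+ r ->
  forall a : F, a != 0 -> modulus a%:M = v a ^+ r.
Proof.
move=> /andP[x0 x1] mx.
have xn0 : x != 0 by rewrite -(absv_gt0 v).
have modX (y : F) k : y != 0 -> modulus (y ^+ k)%:M = modulus y%:M ^+ k.
  move=> y0; elim: k => [|k IH]; first by rewrite !expr0 modulus1.
  by rewrite !exprS scalar_mxM modulusM ?IH ?scalar_unit// expf_neq0.
have int_le1 (y : F) : y != 0 -> v y <= 1 -> modulus y%:M <= 1.
  move=> y0 y1; apply: modulus_le1 => //; first exact: scalar_unit.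
  apply: mxn_le => // i j; rewrite mxE; case: eqP => _; rewrite ?mulr1n//.
  by rewrite mulr0n absv0.
pose b := v x ^+ r; have b0 : 0 < b by rewrite exprn_gt0.
have small (a : F) : a != 0 -> v a <= 1 ->
    v a ^+ r * b <= modulus a%:M /\ modulus a%:M * b <= v a ^+ r.
  move=> a0 a1.
  have ex : exists k, v x ^+ k.+1 < v a.
    have va0 : 0 < v a by rewrite absv_gt0.
    apply: contrapT => h; suff : (v x)^-1 <= 1 by rewrite leNgt invf_gt1// x1.
    apply: (@bounded_powers_le1 _ _ (v x / v a)) => [|k]; first by rewrite invr_ge0 ltW.
    rewrite ler_pdivlMr// exprVn mulrC ler_pdivrMr ?exprn_gt0// -exprS.
    by rewrite leNgt; apply/negP => xk; apply: h; exists k.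
  case: (ex_minnP ex) => k ka kmin.
  have ak : v a <= v x ^+ k.
    case: k ka kmin => [|k] ka kmin; first by rewrite expr0.
    by rewrite leNgt; apply/negP => /kmin; rewrite ltnn.
  pose y := x ^+ k; have y0 : y != 0 by rewrite expf_neq0.
  have vy : v y = v x ^+ k by rewrite absvX.
  have my : modulus y%:M = v y ^+ r by rewrite modX// mx vy -!exprM mulnC.
  have : modulus (a / y)%:M <= 1.
    apply: int_le1; first by rewrite mulf_neq0// invr_neq0.
    by rewrite absvM absvV vy ler_pdivrMr ?exprn_gt0// mul1r.
  have : modulus (x * y / a)%:M <= 1.
    apply: int_le1; first by rewrite !mulf_neq0// invr_neq0.
    rewrite absvM absvV absvM vy -exprS ler_pdivrMr ?mul1r ?absv_gt0//.
    exact: ltW.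
  have ma : 0 < modulus a%:M by apply: modulus_gt0; rewrite ?scalar_unit.
  have myV z : z != 0 -> modulus (z^-1)%:M = (modulus z%:M)^-1.
    by move=> z0; rewrite -invmx_scalar modulusV// scalar_unit.
  rewrite !scalar_mxM !modulusM ?unitmx_mul ?scalar_unit ?invr_neq0// !myV// mx my.
  rewrite ler_pdivrMr// mul1r => h1.
  rewrite ler_pdivrMr ?exprn_gt0 ?absv_gt0// mul1r => h2.
  split; first apply: le_trans h1.
    rewrite mulrC ler_wpM2l ?(ltW b0)// lerXn2r ?nnegrE ?absv_ge0//.
    by rewrite vy.
  apply: le_trans (_ : v y ^+ r * b <= _); first by rewrite ler_wpM2r// ltW.
  rewrite mulrC -exprMn lerXn2r ?nnegrE ?mulr_ge0 ?absv_ge0//.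
  by rewrite vy -exprS ltW.
have le1 (a : F) : a != 0 -> v a <= 1 -> modulus a%:M = v a ^+ r.
  move=> a0 a1; have va : 0 < v a ^+ r by rewrite exprn_gt0 ?absv_gt0.
  have ma : 0 < modulus a%:M by apply: modulus_gt0; rewrite ?scalar_unit.
  have h k := @small (a ^+ k) (expf_neq0 _ a0).
  have {}h k : v a ^+ r ^+ k * b <= modulus a%:M ^+ k /\ modulus a%:M ^+ k * b <= v a ^+ r ^+ k.
    have [] := h k; first by rewrite absvX exprn_ile1 ?absv_ge0.
    by rewrite modX// absvX -!exprM mulnC.
  by apply/le_anti/andP; split; apply: (power_bound_le _ _ b0) => // k; have [] := h k.
move=> a a0; have [a1|a1] := leP (v a) 1; first exact: le1.
apply: invr_inj; rewrite -modulusV ?scalar_unit// invmx_scalar -exprVn -absvV.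
by apply: le1; rewrite ?invr_neq0// absvV invf_le1 ?(ltW a1)// (lt_trans ltr01).
Qed.

Variable x : F.
Hypotheses (x01 : 0 < v x < 1) (modulus_x : modulus x%:M = v x ^+ r).

Definition dilation (i : 'I_r) (a : F) : 'M[F]_r :=
  diag_mx (\row_j if j == i then a else 1).

Lemma det_dilation i a : \det (dilation i a) = a.
Proof.
rewrite det_diag (bigD1 i)//= mxE eqxx big1 ?mulr1// => j /negPf ji.
by rewrite mxE ji.
Qed.

Lemma dilation_unit i a : a != 0 -> dilation i a \in unitmx.
Proof. by move=> a0; rewrite unitmxE det_dilation unitfE. Qed.

Lemma prod_dilation (d : 'rV[F]_r) :
  \big[mulmx/1%:M]_(j < r) dilation j (d 0 j) = diag_mx d.
Proof.
have aux (s : seq 'I_r) : uniq s ->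
    \big[mulmx/1%:M]_(j <- s) dilation j (d 0 j) = diag_mx (\row_j if j \in s then d 0 j else 1).
  elim: s => [_|j s IH /= /andP[js us]].
    by rewrite big_nil -diag_const_mx; congr diag_mx; apply/rowP => k; rewrite !mxE.
  rewrite big_cons IH// mulmx_diag; congr diag_mx; apply/rowP => k; rewrite !mxE in_cons.
  by have [->|kj] /= := eqVneq k j; rewrite ?(negPf js) ?mulr1 ?mul1r.
rewrite aux ?index_enum_uniq//; congr diag_mx; apply/rowP => k.
by rewrite !mxE mem_index_enum.
Qed.

(** Dilations by a along different axes are conjugate by transpositions and hence have the same
    modulus; their product over all axes is the scalar a, of modulus |a|^r. *)
Lemma modulus_dilation i a : a != 0 -> modulus (dilation i a) = v a.
Proof.
move=> a0.
have same j : modulus (dilation j a) = modulus (dilation i a).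
  pose P : 'M[F]_r := perm_mx (tperm i j).
  have uP : P \in unitmx by exact: unitmx_perm.
  have -> : dilation j a = P *m dilation i a *m invmx P.
    apply: (canRL (mulmxK uP)); apply/matrixP => k l.
    have PV : P = perm_mx (tperm i j)^-1 by rewrite tpermV.
    rewrite {1}PV -col_permE /P -row_permE !mxE.
    have -> : (tperm i j k == l) = (k == tperm i j l).
      by rewrite -(can_eq (tpermK i j)) tpermK.
    congr ((if _ then _ else _) *+ _).
    by rewrite -[X in _ = (_ == X)](tpermR i j) (inj_eq perm_inj).
  by rewrite !modulusM ?unitmx_mul ?unitmx_inv ?dilation_unit ?uP// modulusV// mulrC mulKf// gt_eqF// modulus_gt0.
have [eqm uP] := @modulus_prod _ (index_enum 'I_r) xpredT (fun j => dilation j a) (fun j _ => dilation_unit j a0).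
have prodE : \big[mulmx/1%:M]_(j < r) dilation j a = a%:M.
  rewrite -[RHS]diag_const_mx -[RHS]prod_dilation; apply: eq_bigr => j _; by rewrite mxE.
move: eqm; rewrite prodE (modulus_scalar x01 modulus_x)//.
rewrite (eq_bigr (fun=> modulus (dilation i a))) => [|j _]; last exact: same.
rewrite prodr_const card_ord => /esym/eqP; rewrite eqrXn2 ?absv_ge0//.
- by move/eqP.
- exact: leq_trans (ltn_ord i).
- by rewrite ltW// modulus_gt0// dilation_unit.
Qed.

Lemma modulus_diag (d : 'rV[F]_r) : diag_mx d \in unitmx ->
  modulus (diag_mx d) = v (\det (diag_mx d)).
Proof.
rewrite unitmxE det_diag unitfE prodf_seq_neq0 => /allP d0.
have {}d0 i : d 0 i != 0 by apply: d0; rewrite mem_index_enum.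
have [eqm _] := @modulus_prod _ (index_enum 'I_r) xpredT (fun j => dilation j (d 0 j)) (fun j _ => dilation_unit j (d0 j)).
rewrite -prod_dilation eqm absv_prod; apply: eq_bigr => j _; exact: modulus_dilation.
Qed.

(* Conjugation by a diagonal matrix makes W integral. *)
Lemma modulus_unitriangular (h : 'I_r -> nat) (W : 'M[F]_r) :
  (forall i, W i i = 1) -> (forall i j, i != j -> (h j <= h i)%N -> W i j = 0) ->
  \det W = 1 -> modulus W = 1.
Proof.
move=> W1 W0 dW.
have uW : W \in unitmx by rewrite unitmxE dW unitr1.
(* y is so small that a single factor y absorbs the largest entry of W. *)
have [|y y0 ysmall] := lf_small lf (e := Num.min 1 (mxn v W + 1)^-1).
  by rewrite lt_min ltr01 invr_gt0 ltr_wpDl// mxn_ge0.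
move: ysmall; rewrite lt_min => /andP[y1 yW].
have yn0 : y != 0 by rewrite -(absv_gt0 v).
pose t : 'M[F]_r := diag_mx (\row_i y ^+ h i).
have ut : t \in unitmx.
  rewrite unitmxE det_diag unitfE; apply/prodf_neq0 => i _.
  by rewrite mxE expf_neq0.
pose V : 'M[F]_r := \matrix_(i, j) ((y ^+ h i)^-1 * W i j * y ^+ h j).
have VE : t *m V = W *m t.
  apply/matrixP => i j; rewrite mul_diag_mx mul_mx_diag !mxE.
  by rewrite -mulrA mulVKf// expf_neq0.
have {}VE : W = t *m V *m invmx t by rewrite VE mulmxK.
have dV : \det V = 1.
  have dt : \det t != 0 by move: ut; rewrite unitmxE unitfE.
  by move: dW; rewrite VE !det_mulmx det_inv mulrAC mulfV// mul1r.
have V1 : modulus V = 1.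
  apply: modulus_integral => //; last by rewrite dV absv1.
  apply: mxn_le => // i j; rewrite mxE; have [<-|ij] := eqVneq i j.
    by rewrite W1 mulr1 mulVf ?absv1// expf_neq0.
  have [hij|hij] := leqP (h j) (h i); first by rewrite W0// mulr0 mul0r absv0.
  have -> : (y ^+ h i)^-1 * W i j * y ^+ h j = W i j * (y * y ^+ (h j - (h i).+1)).
    rewrite -(subnKC hij) addKn exprD exprSr [_^-1 * _]mulrC -!mulrA.
    by rewrite mulKf// expf_neq0.
  have W10 : 0 < mxn v W + 1 by rewrite ltr_wpDl ?mxn_ge0.
  have Wy : v (W i j) * v y <= 1.
    apply: le_trans (_ : (mxn v W + 1) * (mxn v W + 1)^-1 <= _); last by rewrite mulfV// gt_eqF.
    rewrite ler_pM ?absv_ge0 ?(ltW yW)//.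
    by rewrite (le_trans (mxn_ent v W i j))// lerDl.
  rewrite mulrA absvM -[leRHS]mul1r ler_pM ?absv_ge0 ?absvM//.
  by rewrite absvX exprn_ile1 ?absv_ge0 ?ltW.
have uV : V \in unitmx by rewrite unitmxE dV unitr1.
by rewrite VE !modulusM ?unitmx_mul ?ut ?unitmx_inv// V1 mulr1 modulusV// mulfV// gt_eqF// modulus_gt0.
Qed.

End ModulusDeterminant.

(** LUP decomposition: P Q = L D W with P a permutation matrix, L and W unitriangular, and D
    diagonal. Every factor but D has modulus 1 and determinant of absolute value 1. *)
Lemma modulus_det (R : realType) (F : fieldType) (v : absval R F) (lf : local_field v) (r : nat)
    (lam : {measure set (borel 'rV[valued v]_r) -> \bar R}) (x : F) :
  additive_haar_measure lam -> 0 < v x < 1 -> modulus lam x%:M = v x ^+ r ->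
  forall Q : 'M[F]_r, Q \in unitmx -> modulus lam Q = v (\det Q).
Proof.
case: r lam => [|r] lam lamP x01 mx Q uQ.
  have -> : Q = 1%:M by apply/matrixP => -[].
  by rewrite modulus1// det1 absv1.
have := cormen_lup_correct Q; have := cormen_lup_perm Q; have := cormen_lup_detL Q.
have := @cormen_lup_lower _ _ Q; have := @cormen_lup_upper _ _ Q.
case: (cormen_lup Q) => [[P L] U] /= Uup Llow dL /is_perm_mxP[s Ps] PQ.
have uP : P \in unitmx by rewrite Ps unitmx_perm.
have uL : L \in unitmx by rewrite unitmxE dL unitr1.
have uU : U \in unitmx.
  have : P *m Q \in unitmx by rewrite unitmx_mul uP.
  by rewrite [P *m Q]PQ unitmx_mul uL.
have dU : \det U = \prod_i U i i.
  rewrite -det_tr det_trig; first by apply: eq_bigr => i _; rewrite mxE.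
  by apply/is_trig_mxP => i j ij; rewrite mxE Uup.
have U0 i : U i i != 0.
  have : \det U != 0 by move: uU; rewrite unitmxE unitfE.
  by rewrite dU => /prodf_neq0 /(_ i isT).
have mP : modulus lam P = 1.
  apply: modulus_integral => //; rewrite Ps; last by rewrite det_perm absv_sign.
  by apply: mxn_le => // i j; rewrite !mxE; case: eqP; rewrite ?absv1 ?absv0.
have mL : modulus lam L = 1.
  (* L is lower triangular, so the height decreases with the index; for the upper triangular W it is
     the index itself. *)
  apply: (modulus_unitriangular lf lamP (h := fun i => r - i)%N) => // [i|i j ij].
    by rewrite Llow// eqxx.
  rewrite leq_sub2lE -1?ltnS ?ltn_ord// => ji.
  by rewrite Llow ?(negPf ij).
pose D := diag_mx (\row_i U i i).
have dD : \det D = \det U by rewrite det_diag dU; apply: eq_bigr => i _; rewrite mxE.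
have uD : D \in unitmx by rewrite unitmxE dD -unitmxE.
pose W := invmx D *m U.
have UE : U = D *m W by rewrite mulKVmx.
have WE i j : W i j = U i j / U i i.
  by apply: (mulfI (U0 i)); rewrite [in RHS]mulrC divfK// {2}UE mul_diag_mx !mxE.
have mW : modulus lam W = 1.
  apply: (modulus_unitriangular lf lamP (h := fun i => i)) => // [i|i j ij ji|].
  - by rewrite WE divff.
  - by rewrite WE Uup ?mul0r// ltn_neqAle ji eq_sym ij.
  - by rewrite det_mulmx det_inv dD mulVf// -unitfE -unitmxE.
have : modulus lam (P *m Q) = modulus lam (L *m U) by rewrite [P *m Q]PQ.
have uW : W \in unitmx by rewrite unitmx_mul unitmx_inv uD.
rewrite !modulusM// mP mul1r mL mul1r => ->; rewrite UE modulusM// mW mulr1.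
rewrite (modulus_diag lf lamP x01 mx uD) dD -[LHS]mul1r -(absv1 v) -dL -absvM -det_mulmx.
rewrite -[L *m U]PQ det_mulmx absvM Ps det_perm absv_sign mul1r//.
Qed.

Section ModulusLocalField.
Variables (R : realType) (p : nat) (p_prime : prime p).
Variables (Qp : fieldType) (vp : absval R Qp) (vpP : is_Qp p vp).
Variables (F : fieldExtType Qp) (v : absval R F) (vP : normalized_extension vp v).
Local Notation D := (\dim {:F}).
Local Notation b := (vbasis {:F}).

Let lfp : local_field vp. Proof. exact: (Qp_local_field p_prime vpP). Qed.

Lemma lf_F : local_field v. Proof. exact: local_field_ext lfp vP. Qed.

Lemma absv_ext_nat k : v k%:R = vp k%:R ^+ D.
Proof. by rewrite -vP scaler_nat. Qed.

Lemma absv_p_lt1 : 0 < v p%:R < 1.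
Proof.
have p0 : (0 : R) < p%:R by rewrite ltr0n prime_gt0.
rewrite absv_ext_nat (Qp_absv_p p_prime vpP) exprn_gt0 ?invr_gt0//=.
by rewrite exprn_ilt1 ?invr_ge0 ?(ltW p0) ?invf_lt1 ?ltr1n ?prime_gt1// -lt0n adim_gt0.
Qed.

Variable r : nat.
Variable lam : {measure set (borel 'rV[valued v]_r) -> \bar R}.
Hypothesis lamP : additive_haar_measure lam.

(** The Z_p-span of a Q_p-basis of F^r. Unlike the unit ball of F, it has explicit representatives
    modulo p, which makes its index over p times itself computable. *)
Definition padic_lattice : set 'rV[F]_r :=
  [set x | forall i (j : 'I_D), vp (coord b j (x 0 i)) <= 1].

Lemma padic_latticeP : lattice v padic_lattice.
Proof.
have [C C0 hC] := absv_coord_le lfp vP.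
have [B B0 hB] := basis_comb_le vP.
split.
- by move=> i j; rewrite mxE linear0 absv0.
- move=> x y Sx Sy i j; rewrite !mxE linearB/= (le_trans (absvB vp _ _))//.
  by rewrite ge_max Sx Sy.
- exists C^-1 => [|x xC i j]; first by rewrite invr_gt0.
  have := hC (x 0 i) j; have : C * v (x 0 i) <= 1.
    by rewrite mulrC -ler_pdivlMr ?div1r// (le_trans (mxn_ent v x 0 i)).
  move=> h1 h2; have := le_trans h2 h1.
  by rewrite expr_le1// ?absv_ge0// adim_gt0.
- exists B => x Sx; apply: mxn_le => [|i j]; first exact: ltW.
  rewrite (ord1 i) -(basis_coordK (x 0 j)) (le_trans (hB _))//.
  rewrite ler_piMr ?(ltW B0)// exprn_ile1 ?mxn_ge0//.
  by apply: mxn_le => // k l; rewrite mxE; exact: Sx.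
Qed.

Definition digits (k : 'M['I_p]_(r, D)) : 'rV[F]_r :=
  \row_i \sum_j (k i j : nat)%:R *: b`_j.

Lemma coord_digits k i j : coord b j (digits k 0 i) = (k i j : nat)%:R.
Proof. by rewrite mxE coord_sum_free// (basis_free (vbasisP _)). Qed.

Lemma padic_lattice_digits : padic_lattice =
  \bigcup_(k in [set: 'M['I_p]_(r, D)])
     [set digits k + x | x in mulmx_set p%:R%:M padic_lattice].
Proof.
have p0 : p%:R != 0 :> Qp.
  by rewrite -(absv_gt0 vp) (Qp_absv_p p_prime vpP) invr_gt0 ltr0n prime_gt0.
have coordp (x : F) j : coord b j (p%:R * x) = p%:R * coord b j x.
  by rewrite mulr_natl -scaler_nat linearZ.
have pE : (p%:R : F)^-1 = (p%:R^-1)%:A.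
  have pF : p%:R != 0 :> F by rewrite -(absv_gt0 v); case/andP: absv_p_lt1.
  have pA : (p%:R : F) = p%:R *: (1 : F) by rewrite scaler_nat.
  by apply: (mulfI pF); rewrite mulfV// -scalerAr mulr1 [X in _ *: X]pA scalerA mulVf// scale1r.
apply/seteqP; split=> [x Sx|_ [k _ [_ [y Sy <-] <-]] i j]; last first.
  rewrite mxE linearD/= coord_digits mul_mx_scalar mxE coordp.
  rewrite (le_trans (absv_ultra vp _ _))// ge_max absv_nat absvM.
  by rewrite mulr_ile1 ?absv_ge0 ?absv_nat.
have /choice[k hk] : forall ij : 'I_r * 'I_D, exists k : 'I_p,
    vp (coord b ij.2 (x 0 ij.1) - (k : nat)%:R) <= vp p%:R.
  move=> ij; have [i ip xi] := Qp_approx p_prime vpP 1 (Sx ij.1 ij.2).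
  rewrite expn1 in ip; by exists (Ordinal ip); rewrite expr1 in xi.
pose K : 'M['I_p]_(r, D) := \matrix_(i, j) k (i, j).
exists K => //; exists (x - digits K); last by rewrite addrC subrK.
exists ((p%:R)^-1 *: (x - digits K)); last first.
  rewrite mul_mx_scalar scalerA mulfV ?scale1r//.
  by rewrite -(absv_gt0 v); case/andP: absv_p_lt1.
move=> i j; rewrite !mxE pE -scalerAl mul1r linearZ/= absvM absvV.
rewrite linearB /= -[X in _ - X]/(coord b j (\sum_l (K i l : nat)%:R *: b`_l)).
rewrite coord_sum_free ?(basis_free (vbasisP _))// mxE mulrC.
by rewrite ler_pdivrMr ?mul1r ?absv_gt0//; exact: (hk (i, j)).
Qed.

(** The lattice is the disjoint union of p^(r D) translates of its multiple by p, so the modulus of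
    p is p^(-r D), which is |p|^r for the normalized absolute value. *)
Lemma modulus_p : modulus lam p%:R%:M = v p%:R ^+ r.
Proof.
have pF : p%:R != 0 :> F by rewrite -(absv_gt0 v); case/andP: absv_p_lt1.
have up : (p%:R%:M : 'M[F]_r) \in unitmx by rewrite unitmxE det_scalar unitfE expf_neq0.
have lL := padic_latticeP.
pose N := #|{: 'M['I_p]_(r, D)}|.
pose A (i : nat) : set (borel 'rV[valued v]_r) :=
  \bigcup_(k in [set k : 'M['I_p]_(r, D) | enum_rank k = i :> nat])
     [set digits k + x | x in mulmx_set p%:R%:M padic_lattice].
have AE (i : 'I_N) : A i = [set digits (enum_val i) + x | x in mulmx_set p%:R%:M padic_lattice].
  apply/seteqP; split=> x.
    by move=> [k /= /ord_inj <-]; rewrite enum_rankK.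
  by exists (enum_val i) => //=; rewrite enum_valK.
have oM : open (mulmx_set p%:R%:M padic_lattice : set 'rV[valued v]_r).
  exact/lattice_open/lattice_mulmx.
have lamA : lam padic_lattice = (\sum_(i \in `I_N) lam (A i))%E.
  rewrite -measure_fin_bigcup//.
  - congr (lam _); rewrite {1}padic_lattice_digits; apply/seteqP; split=> x.
      move=> [k _ kx]; exists (enum_rank k : nat) => /=; first exact: ltn_ord.
      by exists k.
    by move=> [i _ [k _ kx]]; exists k.
  - move=> i j /= iN jN [x [[k /= ki [_ [y Sy <-] yx]] [l /= lj [_ [z Sz <-] zx]]]].
    rewrite -ki -lj; congr (nat_of_ord (enum_rank _)).
    apply/matrixP => s t; apply/val_inj/eqP; apply: contrapT => /negP kl.
    (* A common point of two translates would make two distinct digits congruent modulo p, whereas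
       integers below p that differ have a unit as difference. *)
    have : vp ((k s t : nat)%:R - (l s t : nat)%:R) < 1.
      rewrite -!coord_digits -linearB/=.
      have -> : digits k 0 s - digits l 0 s = p%:R * (z 0 s - y 0 s).
        have : (digits k + y *m p%:R%:M) 0 s = (digits l + z *m p%:R%:M) 0 s by rewrite yx zx.
        rewrite !mul_mx_scalar mxE [(p%:R *: y) 0 s]mxE [RHS]mxE [(p%:R *: z) 0 s]mxE => /eqP.
        rewrite mulrBr -subr_eq0 => /eqP h; apply/eqP; rewrite -subr_eq0 -h; apply/eqP; ring.
      rewrite mulr_natl -scaler_nat linearZ/= absvM (Qp_absv_p p_prime vpP).
      rewrite ltr_pdivrMl ?ltr0n ?prime_gt0// mulr1.
      apply: le_lt_trans (_ : 1 < _); last by rewrite ltr1n prime_gt1.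
      by rewrite linearB/= (le_trans (absvB vp _ _))// ge_max Sy Sz.
    wlog lt_kl : k l {ki lj yx zx} kl / (l s t < k s t)%N.
      move=> h; case: (ltngtP (l s t) (k s t)) => [lt|lt|eq]; first exact: h.
        by rewrite absvC; apply: h => //; rewrite eq_sym.
      by move: kl; rewrite /= eq eqxx.
    rewrite -natrB ?(ltnW lt_kl)// (Qp_absv_unit vpP) ?ltxx//.
    rewrite gtnNdvd ?subn_gt0//; exact: leq_ltn_trans (leq_subr _ _) (ltn_ord _).
  - move=> i /= iN; rewrite (AE (Ordinal iN)).
    by apply: measurable_open; exact: translate_open.
have p0 : (0 : R) < p%:R by rewrite ltr0n prime_gt0.
move: lamA; rewrite -fsbig_ord (eq_bigr (fun=> ((modulus lam p%:R%:M)%:E * lam padic_lattice)%E)); last first.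
  by move=> i _; rewrite AE lam_translate// modulusE//; exact: lf_F.
rewrite -(lattice_fine lf_F lamP lL) -EFinM sumEFin => -[].
rewrite sumr_const card_ord -[X in _ = X]mulr_natl => /eqP.
set L := fine _; have L0 : L != 0 by rewrite gt_eqF//; exact: (lattice_fine_gt0 lf_F lamP lL).
rewrite mulrA -{1}[L]mul1r (inj_eq (mulIf L0)) => /eqP.
rewrite /N card_mx card_ord => h.
have : (p ^ (r * D))%:R != 0 :> R by rewrite pnatr_eq0 -lt0n expn_gt0 prime_gt0.
move=> pn0; apply: (mulfI pn0); rewrite -h absv_ext_nat (Qp_absv_p p_prime vpP).
by rewrite -exprM mulnC exprVn natrX mulfV// expf_neq0// gt_eqF.
Qed.

Theorem lattice_det S (Q : 'M[F]_r) : lattice v S -> Q \in unitmx ->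
  lam (mulmx_set Q S) = ((v (\det Q))%:E * lam S)%E.
Proof.
move=> lS uQ; rewrite modulusE//; last exact: lf_F.
by rewrite (modulus_det lf_F lamP absv_p_lt1 modulus_p).
Qed.

End ModulusLocalField.

(** * Roots of matrices close to 1 *)

Section UnipotentRoots.
Variables (R : realType) (E : fieldType) (v : absval R E) (lf : local_field v) (n : nat).
Implicit Types A B M X : 'M[E]_n.

Definition close1 (rho : R) A := mxn v (A - 1%:M) <= rho.

(** The device behind the estimates near 1: a term rho |A| with rho < 1 may be dropped from an
    ultrametric bound of |A|. *)
Lemma mxn_contract m k (A : 'M[E]_(m, k)) (rho c : R) : 0 <= c -> rho < 1 ->
  mxn v A <= Num.max c (rho * mxn v A) -> mxn v A <= c.
Proof.
move=> c0 rho1; rewrite le_max => /orP[//|h]; apply: le_trans c0.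
have : (1 - rho) * mxn v A <= 0 by rewrite mulrBl mul1r subr_le0.
by rewrite pmulr_rle0// subr_gt0.
Qed.

Variable rho : R.
Hypotheses (rho_gt0 : 0 < rho) (rho1 : rho < 1).
Let rho0 : 0 <= rho. Proof. exact: ltW. Qed.
Local Notation near1 := (close1 rho).

Lemma near1_le1 A : near1 A -> mxn v A <= 1.
Proof.
move=> A1; rewrite -(subrK 1%:M A) mxnD_le ?mxn1_le1//.
exact: le_trans A1 (ltW rho1).
Qed.

Lemma mulmx_sub1 A B (s : R) : mxn v A <= 1 -> mxn v (A - 1%:M) <= s ->
  mxn v (B - 1%:M) <= s -> mxn v (A *m B - 1%:M) <= s.
Proof.
move=> A1 As Bs; have -> : A *m B - 1%:M = A *m (B - 1%:M) + (A - 1%:M).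
  by rewrite mulmxBr mulmx1 addrA subrK.
by apply: mxnD_le => //; rewrite -[leRHS]mul1r mxn_mul_le.
Qed.

Lemma near1M A B : near1 A -> near1 B -> near1 (A *m B).
Proof. by move=> A1 B1; apply: mulmx_sub1 => //; exact: near1_le1. Qed.

Lemma expmx_sub1 A k (s : R) : 0 <= s -> mxn v A <= 1 -> mxn v (A - 1%:M) <= s ->
  mxn v (A ^+ k - 1%:M) <= s.
Proof.
move=> s0 A1 As; elim: k => [|k IH]; first by rewrite expr0 subrr mxn0.
by rewrite exprS; exact: mulmx_sub1.
Qed.

Lemma near1X A k : near1 A -> near1 (A ^+ k).
Proof. by move=> A1; apply: expmx_sub1 => //; exact: near1_le1. Qed.

(** A matrix k with k A = 0 satisfies k = - k (A - 1), whence |k| <= rho |k|. *)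
Lemma near1_unit A : near1 A -> A \in unitmx.
Proof.
move=> A1; rewrite -row_free_unit -kermx_eq0; apply/eqP/(mxn_eq0 (v := v)).
apply: (@mxn_contract _ _ _ rho) => //; rewrite le_max; apply/orP; right.
have kA : kermx A = - (kermx A *m (A - 1%:M)).
  by rewrite mulmxBr mulmx1 mulmx_ker sub0r opprK.
by rewrite {1}kA mxnN mulrC mxn_mul_le.
Qed.

Lemma near1V A : near1 A -> near1 (invmx A).
Proof.
move=> A1; have uA := near1_unit A1.
have VE : invmx A - 1%:M = - (invmx A *m (A - 1%:M)).
  by rewrite mulmxBr mulVmx// mulmx1 opprB.
have V1 : mxn v (invmx A) <= 1.
  apply: (@mxn_contract _ _ _ rho) => //.
  rewrite -{1}(subrK 1%:M (invmx A)) (le_trans (mxnD v _ _))// ge_max !le_max mxn1_le1 andbT.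
  by rewrite VE mxnN mulrC mxn_mul_le ?orbT.
by rewrite /close1 VE mxnN -[leRHS]mul1r mxn_mul_le.
Qed.

Variables (p d : nat).
Hypotheses (p_prime : prime p) (vp1 : v p%:R < 1) (pd : ~~ (p %| d)%N).

(** If |k| were below 1, then 1, an integral combination of k and p by Bezout, would have absolute
    value below 1. *)
Lemma absv_prime_to_p k : ~~ (p %| k)%N -> v k%:R = 1.
Proof.
rewrite -prime_coprime// => cop; have k0 : (0 < k)%N.
  by case: k cop => //; rewrite /coprime gcdn0 => /eqP p1; move: p_prime; rewrite p1.
have [a _ /dvdnP[b hb]] := Bezoutl p k0.
rewrite coprime_sym in cop; rewrite (eqP cop) in hb.
apply/le_anti; rewrite absv_nat/= leNgt; apply/negP => vk1.
have : v 1 < 1.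
  have -> : 1 = b%:R * k%:R - a%:R * p%:R :> E.
    by rewrite -!natrM -hb natrD addrK.
  apply: le_lt_trans (absvB v _ _) _; rewrite gt_max !absvM.
  by rewrite !(le_lt_trans (ler_piMl _ _)) ?absv_ge0 ?absv_nat.
by rewrite absv1 ltxx.
Qed.

Let tau := Num.max rho (v p%:R).
Let tau0 : 0 <= tau. Proof. by rewrite le_max rho0. Qed.
Let tau1 : tau < 1. Proof. by rewrite gt_max rho1. Qed.

(** B^p - 1 = (B - 1)(1 + B + ... + B^(p-1)), and the second factor is p up to an error of norm at
    most rho. So raising to the p-th power contracts the distance to 1 by tau. *)
Let expmx_p A k : near1 A -> mxn v (A ^+ (p ^ k) - 1%:M) <= tau ^+ k.
Proof.
move=> A1; elim: k => [|k IH].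
  by rewrite expn0 expr0 expr1 (le_trans A1)// ltW.
set B := A ^+ (p ^ k); have B1 : near1 B by exact: near1X.
rewrite expnSr exprM -/B subrX1 exprSr; apply: mxn_mul_le => //.
have -> : \sum_(i < p) B ^+ i = \sum_(i < p) (B ^+ i - 1%:M) + p%:R *: 1%:M.
  rewrite big_split /= sumrN sumr_const card_ord scaler_nat.
  by rewrite -addrA addNr addr0.
apply: mxnD_le.
  apply: mxn_sum => // i _; rewrite le_max; apply/orP; left; exact: near1X.
rewrite mxnZ le_max; apply/orP; right; rewrite -[leRHS]mulr1.
by rewrite ler_wpM2l ?absv_ge0 ?mxn1_le1.
Qed.

(** Since A^(p^k) is within tau^k of 1, the power A^e depends continuously on e for the p-adic
    topology. *)
Let expmx_mod A k e f : near1 A -> e = f %[mod p ^ k] -> mxn v (A ^+ e - A ^+ f) <= tau ^+ k.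
Proof.
wlog fe : e f / (f <= e)%N.
  move=> h A1 ef; case: (leqP f e) => [|/ltnW] fe; first exact: h.
  by rewrite mxnC; apply: h.
move=> A1 /eqP; rewrite eqn_mod_dvd// => /dvdnP[j hj].
rewrite -(subnK fe) hj [(j * _)%N]mulnC exprD exprM.
have -> : A ^+ (p ^ k) ^+ j * A ^+ f - A ^+ f = (A ^+ (p ^ k) ^+ j - 1%:M) *m A ^+ f.
  by rewrite mulmxBl mul1mx.
rewrite -[leRHS]mulr1 mxn_mul_le ?near1_le1 ?near1X//.
by apply: expmx_sub1; rewrite ?exprn_ge0 ?near1_le1 ?near1X ?expmx_p.
Qed.

(* [a k] is an inverse of d modulo p^k, so A^(a k) converges to the d-th root of A. *)
Let a k := (d ^ (totient (p ^ k)).-1)%N.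

Let aP k : (d * a k = 1 %[mod p ^ k])%N.
Proof.
rewrite /a -expnS prednK ?totient_gt0 ?expn_gt0 ?prime_gt0//.
by apply: Euler_exp_totient; rewrite coprime_sym coprimeXl// prime_coprime.
Qed.

Let aS k l : (k <= l)%N -> a l = a k %[mod p ^ k].
Proof.
move=> kl; have : d * a l = d * a k %[mod p ^ k].
  rewrite aP; have := aP l => /(congr1 (fun x => x %% p ^ k)%N).
  by rewrite !modn_dvdm// dvdn_exp2l.
move=> /(congr1 (fun x => (a k * x) %% p ^ k)%N); rewrite !modnMmr !mulnA.
have h := aP k; rewrite mulnC in h.
by rewrite -(modnMml (a k * d)) h modnMml mul1n -(modnMml (a k * d)) h modnMml mul1n.
Qed.

Let tau_lt (c e : R) : 0 < e -> exists k, c * tau ^+ k < e.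
Proof.
move=> e0; have [c0|c0] := leP c 0.
  by exists 0%N; rewrite expr0 mulr1 (le_lt_trans c0).
have [t0|t0] := eqVneq tau 0; first by exists 1%N; rewrite t0 expr1 mulr0.
have {}t0 : 0 < tau by rewrite lt_def t0 tau0.
apply: contrapT => h; suff : tau^-1 <= 1 by rewrite leNgt invf_gt1// tau1.
apply: (@bounded_powers_le1 _ _ (c / e)) => [|k]; first by rewrite invr_ge0 ltW.
rewrite exprVn ler_pdivlMr// mulrC ler_pdivrMr ?exprn_gt0//.
by rewrite leNgt; apply/negP => xk; apply: h; exists k.
Qed.

Let eq0_of_tau m l (X : 'M[E]_(m, l)) (c : R) : (forall k, mxn v X <= c * tau ^+ k) -> X = 0.
Proof.
move=> h; apply: (mxn_eq0 (v := v)); rewrite leNgt; apply/negP => X0.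
by have [k] := tau_lt c X0; rewrite ltNge h.
Qed.

Let expmx_sub A B k : mxn v A <= 1 -> mxn v B <= 1 -> mxn v (A ^+ k - B ^+ k) <= mxn v (A - B).
Proof.
move=> A1 B1; elim: k => [|k IH]; first by rewrite !expr0 subrr mxn0 mxn_ge0.
rewrite !exprS; have -> : A * A ^+ k - B * B ^+ k = A *m (A ^+ k - B ^+ k) + (A - B) *m B ^+ k.
  by rewrite mulmxBr mulmxBl addrA subrK.
have Bk : mxn v (B ^+ k) <= 1.
  elim: k {IH} => [|k IH]; first by rewrite expr0 mxn1_le1.
  by rewrite exprS -[leRHS]mulr1 mxn_mul_le.
by apply: mxnD_le; [rewrite -[leRHS]mul1r|rewrite -[leRHS]mulr1]; exact: mxn_mul_le.
Qed.

Let near1_root_pow M k : near1 M -> mxn v (M ^+ d ^+ a k - M) <= tau ^+ k.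
Proof. by move=> M1; rewrite -exprM -{2}[M]expr1; apply: expmx_mod => //; exact: aP. Qed.

Lemma near1_root A : near1 A -> exists2 M, near1 M & M ^+ d = A.
Proof.
move=> A1.
have [||M hM] := @lf_complete _ _ _ lf _ _ (fun k => A ^+ a k) 1.
- by move=> k; exact/near1_le1/near1X.
- move=> e e0; have [N] := tau_lt 1 e0; rewrite mul1r => hN; exists N => i j Ni Nj.
  by apply: le_lt_trans hN; apply: expmx_mod => //; rewrite !(aS Ni, aS Nj).
have aM k : mxn v (A ^+ a k - M) <= tau ^+ k.
  rewrite leNgt; apply/negP => h.
  have [N hN] := hM _ (le_lt_trans (exprn_ge0 k tau0) h).
  have := mxn_tri v (A ^+ a (maxn N k)) (A ^+ a k) M; rewrite le_max.
  rewrite leNgt (le_lt_trans _ h)/=; last first.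
    by apply: expmx_mod => //; rewrite (aS (leq_maxr N k)).
  by rewrite leNgt hN ?leq_maxl.
have M1 : near1 M.
  have [k] := tau_lt 1 rho_gt0; rewrite mul1r => /ltW hk.
  rewrite /close1 -(subrK (A ^+ a k) M) -addrA mxnD_le//; last exact: near1X.
  by rewrite mxnC (le_trans (aM k)).
exists M => //; apply/eqP; rewrite -subr_eq0; apply/eqP.
apply: (@eq0_of_tau _ _ _ 1) => k; rewrite mul1r.
rewrite -(subrK (A ^+ a k ^+ d) (M ^+ d)) -addrA mxnD_le//.
  rewrite (le_trans (expmx_sub d _ _)) ?near1_le1 ?near1X//.
  by rewrite mxnC.
by rewrite -exprM -{2}[A]expr1; apply: expmx_mod => //; rewrite mulnC; exact: aP.
Qed.

(** M and M' are the limits of the powers of M^d and of M'^d with the same exponents [a k], and X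
    intertwines these powers. X may be singular: the lemma is also applied to elements of Lie
    algebras. *)
Lemma near1_root_intertwine M M' (X : 'M[E]_n) : near1 M -> near1 M' ->
  X *m M ^+ d = M' ^+ d *m X -> X *m M = M' *m X.
Proof.
move=> M1 M1' XM; apply/eqP; rewrite -subr_eq0; apply/eqP.
apply: (@eq0_of_tau _ _ _ (mxn v X)) => k.
have XMk j : X *m M ^+ d ^+ j = M' ^+ d ^+ j *m X.
  elim: j => [|j IH]; first by rewrite !expr0 mulmx1 mul1mx.
  rewrite exprS mulmxA XM -mulmxA IH mulmxA; congr (_ *m _).
  by rewrite -[_ *m _]/(_ * _) -exprS.
have -> : X *m M - M' *m X = (M' ^+ d ^+ a k - M') *m X - X *m (M ^+ d ^+ a k - M).
  by rewrite mulmxBl mulmxBr XMk opprB [RHS]addrC addrA subrK.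
apply: mxnB_le; last exact: mxn_mul_le (lexx _) (near1_root_pow k M1).
by rewrite mulrC; exact: mxn_mul_le (near1_root_pow k M1') (lexx _).
Qed.

Lemma near1_root_inj M M' : near1 M -> near1 M' -> M ^+ d = M' ^+ d -> M = M'.
Proof.
move=> M1 M1' MM; have := @near1_root_intertwine _ _ 1%:M M1 M1'.
by rewrite !mul1mx !mulmx1; exact.
Qed.

End UnipotentRoots.

(** * Norms and Hilbert 90 *)

Section CyclicNorm.
Variables (E : fieldType) (th : {rmorphism E -> E}) (n : nat).
Implicit Types A M X : 'M[E]_n.

(** The matrix part of (A th)^k in the semidirect product with the powers of th. *)
Fixpoint norm_prod k A : 'M[E]_n :=
  if k is k'.+1 then A *m map_mx th (norm_prod k' A) else 1%:M.

Lemma iter_map_mx k m l (X : 'M[E]_(m, l)) : map_mx (iter k th) X = iter k (map_mx th) X.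
Proof.
elim: k => [|k IH] /=; first by apply/matrixP => i j; rewrite mxE.
by rewrite -IH; apply/matrixP => i j; rewrite !mxE.
Qed.

Lemma norm_prodSr k A : norm_prod k.+1 A = norm_prod k A *m iter k (map_mx th) A.
Proof.
elim: k => [|k IH]; first by rewrite /= map_mx1 mulmx1 mul1mx.
by rewrite -[LHS]/(A *m map_mx th (norm_prod k.+1 A)) {1}IH map_mxM mulmxA.
Qed.

Lemma norm_prodE k A : norm_prod k A = \prod_(i < k) iter i (map_mx th) A.
Proof.
elim: k => [|k IH]; first by rewrite big_ord0.
by rewrite norm_prodSr IH big_ord_recr.
Qed.

Lemma norm_prod_fixed k A : map_mx th A = A -> norm_prod k A = A ^+ k.
Proof. by move=> Ath; elim: k => [//|k IH]; rewrite /= IH rmorphXn /= Ath exprS. Qed.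

Lemma norm_prod_conj k x A : x \in unitmx ->
  norm_prod k (invmx x *m A *m map_mx th x) = invmx x *m norm_prod k A *m iter k (map_mx th) x.
Proof.
move=> ux; elim: k => [|k IH]; first by rewrite /= mulmx1 mulVmx.
have uthx k' : iter k' (map_mx th) x \in unitmx.
  by elim: k' => //= k' IHk; rewrite map_unitmx.
rewrite !norm_prodSr IH.
have -> : iter k (map_mx th) (invmx x *m A *m map_mx th x) =
    invmx (iter k (map_mx th) x) *m iter k (map_mx th) A *m iter k.+1 (map_mx th) x.
  elim: k {IH} => [//|k IH]; rewrite [LHS]/= IH !map_mxM; congr (_ *m _ *m _).
  by rewrite map_invmx.
by rewrite !mulmxA mulmxK.
Qed.

(** In the semidirect product the hypothesis says that M' commutes with X th, so that (M' X th)^k =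
    M'^k (X th)^k. *)
Lemma norm_prod_divl M' X k : X *m map_mx th M' = M' *m X ->
  norm_prod k (M' *m X) = M' ^+ k *m norm_prod k X.
Proof.
move=> XM; elim: k => [|k IH]; first by rewrite /= mulmx1.
have XMk j : X *m map_mx th (M' ^+ j) = M' ^+ j *m X.
  elim: j => [|j IHj]; first by rewrite !expr0 map_mx1 mulmx1 mul1mx.
  by rewrite exprS map_mxM mulmxA XM -mulmxA IHj mulmxA.
rewrite [LHS]/= IH map_mxM mulmxA -(mulmxA M') XMk exprS /=.
by rewrite -!mulmxA.
Qed.

Lemma norm_prod_commute k A : A *m map_mx th (norm_prod k A) = norm_prod k A *m iter k (map_mx th) A.
Proof. by rewrite -norm_prodSr. Qed.

Variable d : nat.
Hypothesis th_d : forall x, iter d th x = x.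

Let th_d_mx m l (X : 'M[E]_(m, l)) : iter d (map_mx th) X = X.
Proof. by rewrite -iter_map_mx; apply/matrixP => i j; rewrite mxE th_d. Qed.

Lemma norm_prod_conj_d x A : x \in unitmx ->
  norm_prod d (invmx x *m A *m map_mx th x) = invmx x *m norm_prod d A *m x.
Proof. by move=> ux; rewrite norm_prod_conj// th_d_mx. Qed.

Lemma norm_prod_d_commute A : A *m map_mx th (norm_prod d A) = norm_prod d A *m A.
Proof. by rewrite norm_prod_commute th_d_mx. Qed.

(* If X theta commutes with its d-th root M of the norm of X, then the cocycle M^-1 X,
   when trivialized by x, exhibits X as twisted conjugate to the fixed matrix x^-1 M x. *)
Lemma twisted_jordan M X : M \in unitmx -> X *m map_mx th M = M *m X -> norm_prod d X = M ^+ d ->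
  norm_prod d (invmx M *m X) = 1%:M /\
  forall x, x \in unitmx -> invmx M *m X *m map_mx th x = x ->
    map_mx th (invmx x *m M *m x) = invmx x *m M *m x /\
    X = x *m (invmx x *m M *m x) *m invmx (map_mx th x).
Proof.
move=> uM XM Xd; have utM : map_mx th M \in unitmx by rewrite map_unitmx.
have XM' : X *m map_mx th (invmx M) = invmx M *m X.
  apply: (can_inj (mulKmx uM)); rewrite mulKVmx// mulmxA -XM -mulmxA map_invmx mulmxV//.
  by rewrite mulmx1.
split=> [|x ux xX].
  rewrite norm_prod_divl// Xd.
  have VX k : invmx M ^+ k *m M ^+ k = 1%:M.
    elim: k => [|k IH]; first by rewrite mulmx1.
    by rewrite exprSr exprS mulmxA -[_ * invmx M]/(_ *m _) mulmxKV.
  exact: VX.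
have utx : map_mx th x \in unitmx by rewrite map_unitmx.
have XE : X *m map_mx th x = M *m x by rewrite -[in RHS]xX !mulmxA mulmxV// mul1mx.
split.
  rewrite !map_mxM map_invmx; apply: (can_inj (mulKmx utx)).
  rewrite -mulmxA mulKVmx//.
  have uC : invmx M *m X \in unitmx by move: ux; rewrite -{1}xX unitmx_mul => /andP[].
  apply: (can_inj (mulKmx uC)); rewrite [RHS]mulmxA xX !mulmxA mulmxV// mul1mx -XE.
  by rewrite -[invmx M *m X *m map_mx th M]mulmxA XM mulmxA mulVmx// mul1mx.
by rewrite !mulmxA mulmxV// mul1mx -XE mulmxK.
Qed.

Section Near1.
Variables (R : realType) (v : absval R E) (rho : R).
Hypotheses (rho1 : rho < 1) (v_th : forall x, v (th x) = v x) (vd : v d%:R = 1).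

Lemma mxn_map m l (X : 'M[E]_(m, l)) : mxn v (map_mx th X) = mxn v X.
Proof.
by rewrite /mxn; apply: eq_bigr => i _; apply: eq_bigr => j _; rewrite mxE v_th.
Qed.

Lemma close1_map X : close1 v rho X -> close1 v rho (map_mx th X).
Proof.
rewrite /close1; have -> : map_mx th X - 1%:M = map_mx th (X - 1%:M) by rewrite map_mxB map_mx1.
by rewrite mxn_map.
Qed.

Lemma close1_norm_prod k X : close1 v rho X -> close1 v rho (norm_prod k X).
Proof.
move=> X1; elim: k => [|k IH] /=; last by apply: near1M => //; exact: close1_map.
by rewrite /close1 subrr mxn0 (le_trans (mxn_ge0 v (X - 1%:M))).
Qed.

(* x is the average of the partial products of the cocycle. *)
Lemma hilbert90_near1 A : close1 v rho A -> norm_prod d A = 1%:M ->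
  exists2 x, close1 v rho x & A *m map_mx th x = x.
Proof.
move=> A1 Ad; have d0 : d%:R != 0 :> E by rewrite -(absv_gt0 v) vd.
exists (d%:R^-1 *: \sum_(i < d) norm_prod i A).
  rewrite /close1; have -> : d%:R^-1 *: \sum_(i < d) norm_prod i A - 1%:M =
      d%:R^-1 *: \sum_(i < d) (norm_prod i A - 1%:M).
    rewrite sumrB sumr_const card_ord scalerBr; congr (_ - _).
    by rewrite -scaler_nat scalerA mulVf// scale1r.
  rewrite mxnZ absvV vd invr1 mul1r mxn_sum// => [|i _]; last exact: close1_norm_prod.
  by rewrite (le_trans (mxn_ge0 v (A - 1%:M))).
rewrite map_mxZ fmorphV rmorph_nat -scalemxAr; congr (_ *: _).
rewrite raddf_sum mulmx_sumr.
have -> : \sum_(i < d) A *m map_mx th (norm_prod i A) = \sum_(i < d) norm_prod i.+1 A by [].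
case: d Ad => [|d'] Ad; first by rewrite !big_ord0.
by rewrite big_ord_recr/= -/(norm_prod d'.+1 A) Ad addrC [RHS]big_ord_recl.
Qed.
End Near1.

Hypothesis th_indep : forall c : nat -> E, c 0%N != 0 ->
  exists a, \sum_(i < d) c i * iter i th a != 0.

(** The fixed columns are produced one at a time. Let the row l kill those already found, and let w
    be a standard column with l w nonzero. The sum of the th^i(a) N_i(A) w over i < d is fixed for
    every a, and independence of characters gives an a for which l does not kill it. *)
Let hilbert90_rect A k : norm_prod d A = 1%:M -> (k <= n)%N ->
  exists2 X : 'M[E]_(n, k), \rank X = k & A *m map_mx th X = X.
Proof.
move=> Ad; elim: k => [_|k IH kn].
  by exists 0; rewrite ?mxrank0// map_mx0 mulmx0.
have [X rX XA] := IH (ltnW kn).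
have kX : kermx X != 0.
  by rewrite -mxrank_eq0 mxrank_ker rX subn_eq0 -ltnNge.
have [l lX l0] : exists2 l : 'rV[E]_n, l *m X = 0 & l != 0.
  exists (nz_row (kermx X)); last by rewrite nz_row_eq0.
  by apply/sub_kermxP; exact: nz_row_sub.
have [j lj] : exists j, l 0 j != 0 by apply/rV0Pn.
pose w : 'cV[E]_n := delta_mx j 0.
pose c i := (l *m norm_prod i A *m w) 0 0.
have c0 : c 0%N != 0 by rewrite /c /= mulmx1 -colE mxE.
have [a ha] := th_indep c0.
pose g i : 'cV[E]_n := iter i th a *: (norm_prod i A *m w).
pose f := \sum_(i < d) g i.
have lf0 : l *m f != 0.
  apply: contra ha => /eqP lfz; have : (l *m f) 0 0 = 0 by rewrite lfz mxE.
  rewrite /f mulmx_sumr summxE => lf00; rewrite -[X in _ == X]lf00.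
  apply/eqP; apply: eq_bigr => i _.
  by rewrite -scalemxAr mxE mulmxA mulrC.
have wth : map_mx th w = w by rewrite map_delta_mx.
have fA : A *m map_mx th f = f.
  rewrite raddf_sum mulmx_sumr.
  have -> : \sum_(i < d) A *m map_mx th (g i) = \sum_(i < d) g i.+1.
    by apply: eq_bigr => i _; rewrite /g map_mxZ -scalemxAr map_mxM wth mulmxA.
  have gd : g d = g 0%N by rewrite /g Ad th_d.
  rewrite /f; case: (d) gd => [|d'] gd; first by rewrite !big_ord0.
  by rewrite big_ord_recr/= gd addrC [RHS]big_ord_recl.
rewrite -(addn1 k); exists (row_mx X f); last by rewrite map_row_mx mul_mx_row XA fA.
apply/eqP; rewrite eqn_leq rank_leq_col /=.
suff : (\rank X < \rank (row_mx X f))%N by rewrite rX; apply: leq_trans; rewrite addn1.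
rewrite -mxrank_tr -[X in (_ < X)%N]mxrank_tr tr_row_mx; apply: rank_ltmx.
rewrite ltmxE; apply/andP; split.
  by have := submx_refl (col_mx X^T f^T); rewrite col_mx_sub => /andP[].
rewrite col_mx_sub negb_and; apply/orP; right; apply: contra lf0 => /submxP[D fD].
by rewrite -[f]trmxK fD trmx_mul trmxK mulmxA lX mul0mx.
Qed.

Lemma hilbert90 A : norm_prod d A = 1%:M -> exists2 x, x \in unitmx & A *m map_mx th x = x.
Proof.
move=> Ad; have [x rx xA] := hilbert90_rect Ad (leqnn n).
by exists x; rewrite // -row_free_unit /row_free rx.
Qed.

End CyclicNorm.

(** * Linear algebra over extensions *)

Section SimilarityDescent.
Variables (F L : fieldType) (f : {rmorphism F -> L}) (n : nat).
Hypothesis char0 : forall k, k.+1%:R != 0 :> L.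

Let natr_inj_L : injective (fun k : nat => k%:R : L).
Proof.
move=> i j /= ij; wlog le_ij : i j ij / (i <= j)%N.
  by move=> h; case/orP: (leq_total i j) => [|ji]; [exact: h|apply/esym/h].
have : (j - i)%:R = 0 :> L by rewrite natrB// ij subrr.
by case E : (j - i)%N => [|k] => [_|/eqP]; [apply/eqP; rewrite eqn_leq le_ij -subn_eq0 E|rewrite (negPf (char0 k))].
Qed.

Lemma poly_nat_nonroot (q : {poly L}) : q != 0 -> exists k : nat, q.[k%:R] != 0.
Proof.
move=> q0; apply: contrapT => h.
have := @max_poly_roots _ q [seq k%:R | k <- iota 0 (size q)] q0.
rewrite size_map size_iota ltnn (map_inj_uniq natr_inj_L) iota_uniq.
have -> : all (root q) [seq k%:R | k <- iota 0 (size q)]; last by move=> /(_ isT isT).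
apply/allP => _ /mapP[k _ ->]; rewrite /root; apply/negPn/negP => qk.
by apply: h; exists k.
Qed.

(** The coefficients are replaced one at a time: the determinant is a nonzero polynomial in the one
    at hand, and in characteristic 0 some natural number is not a root. *)
Let det_specialize (N : nat) (X : 'I_N -> 'M[F]_n) (c : 'I_N -> L) :
  \det (\sum_i c i *: map_mx f (X i)) != 0 ->
  exists a : 'I_N -> nat, \det (\sum_i (a i)%:R *: X i) != 0.
Proof.
move=> c0.
have step k : (k <= N)%N -> exists c : 'I_N -> L,
    \det (\sum_i c i *: map_mx f (X i)) != 0 /\
    forall i : 'I_N, (i < k)%N -> exists a : nat, c i = a%:R.
  elim: k => [_|k IH kN]; first by exists c.
  have [c1 [c1_0 c1P]] := IH (ltnW kN); pose k' := Ordinal kN.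
  pose Y := \sum_(i | i != k') c1 i *: map_mx f (X i).
  pose q := \det (map_mx polyC Y + 'X *: map_mx polyC (map_mx f (X k'))).
  have qE t : q.[t] = \det (Y + t *: map_mx f (X k')).
    rewrite -horner_evalE -det_map_mx; congr (\det _); apply/matrixP => i j.
    by rewrite !mxE /= !horner_evalE hornerD hornerM hornerX !hornerC.
  have [|a qa] := @poly_nat_nonroot q.
    apply: contraNneq c1_0 => q0.
    by rewrite (bigD1 k')//= addrC -/Y -qE q0 horner0.
  exists (fun i => if i == k' then a%:R else c1 i); split.
    rewrite (bigD1 k')//= eqxx addrC.
    rewrite (eq_bigr (fun i => c1 i *: map_mx f (X i))) => [|i /negPf ->]//.
    by rewrite -/Y -qE.
  move=> i; rewrite ltnS leq_eqVlt => /orP[/eqP ik|ik].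
    by exists a; have -> : i = k' by [apply: val_inj]; rewrite eqxx.
  have [a' ha'] := c1P i ik; exists a'; case: eqP => // ik'.
  by move: ik; rewrite ik' ltnn.
have [c1 [c1_0 c1P]] := step N (leqnn N).
have /choice[a ha] : forall i : 'I_N, exists a : nat, c1 i = a%:R by move=> i; exact: c1P.
exists a; rewrite -(fmorph_eq0 f) -det_map_mx raddf_sum/=; apply: contra c1_0.
rewrite (eq_bigr (fun i => c1 i *: map_mx f (X i)))// => i _.
by rewrite map_mxZ rmorph_nat ha.
Qed.

(** The intertwiners of A and B are the kernel of a matrix over F, so u is an L-combination of
    intertwiners over F; specializing its coefficients keeps the determinant nonzero. *)
Lemma similar_descent (A B : 'M[F]_n) (u : 'M[L]_n) : u \in unitmx ->
  u *m map_mx f A = map_mx f B *m u -> exists2 x, x \in unitmx & x *m A = B *m x.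
Proof.
move=> uu uAB; pose K := lin_mx (mulmxr A) - lin_mx (mulmx B).
have KE (X : 'M[F]_n) : mxvec X *m K = mxvec (X *m A - B *m X).
  by rewrite mulmxBr !mul_vec_lin /= -linearB.
have uK : mxvec u *m map_mx f K = 0.
  rewrite map_mxB (map_lin_mx (gf := mulmxr (map_mx f A))); last by move=> X; rewrite map_mxM.
  rewrite (map_lin_mx (gf := mulmx (map_mx f B))); last by move=> X; rewrite map_mxM.
  by rewrite mulmxBr !mul_vec_lin /= -linearB uAB subrr linear0.
have /submxP[D uD] : (mxvec u <= map_mx f (kermx K))%MS by rewrite map_kermx; apply/sub_kermxP.
pose X i := vec_mx (row i (kermx K)).
have XE i : X i *m A = B *m X i.
  apply/eqP; rewrite -subr_eq0 -(can_eq mxvecK) -KE vec_mxK linear0.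
  by apply/eqP/sub_kermxP; exact: row_sub.
have uE : u = \sum_i D 0 i *: map_mx f (X i).
  apply: (can_inj mxvecK); rewrite uD mulmx_sum_row linear_sum; apply: eq_bigr => i _.
  by rewrite linearZ /= map_vec_mx vec_mxK map_row.
have [|a ha] := @det_specialize _ X (fun i => D 0 i).
  by rewrite -uE -unitfE -unitmxE.
exists (\sum_i (a i)%:R *: X i); first by rewrite unitmxE unitfE.
rewrite mulmx_suml mulmx_sumr; apply: eq_bigr => i _.
by rewrite -scalemxAl XE scalemxAr.
Qed.

End SimilarityDescent.

(** [linfun] accepts any function; it agrees with it once linearity, which [adF] and [ad_twisted] do
    not carry, is proved. *)
Lemma linfun_linear (K : fieldType) (aT rT : vectType K) (f : aT -> rT) :
  linear f -> linfun f =1 f.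
Proof.
move=> lf; pose fL := GRing.isLinear.Build K aT rT *:%R f lf.
pose g : {linear aT -> rT} := HB.pack f fL.
exact: (lfunE g).
Qed.

(** * Determinants modulo the kernel *)

Section DetModKer.
Variables (K : fieldType) (V : vectType K).

Definition comb r (u : 'I_r -> V) (z : 'rV[K]_r) : V := \sum_i z 0 i *: u i.

Lemma combD r (u : 'I_r -> V) z z' : comb u (z + z') = comb u z + comb u z'.
Proof. by rewrite /comb -big_split; apply: eq_bigr => i _; rewrite mxE scalerDl. Qed.

Lemma combB r (u : 'I_r -> V) z z' : comb u (z - z') = comb u z - comb u z'.
Proof. by rewrite /comb -sumrB; apply: eq_bigr => i _; rewrite !mxE scalerBl. Qed.

Lemma comb_delta r (u : 'I_r -> V) i : comb u (delta_mx 0 i) = u i.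
Proof.
rewrite /comb (bigD1 i)//= mxE !eqxx scale1r big1 ?addr0// => j /negPf ji.
by rewrite mxE eqxx ji scale0r.
Qed.

Lemma combM r s (u : 'I_r -> V) (u' : 'I_s -> V) (A : 'M[K]_(r, s)) z :
  (forall i, u i = \sum_j A i j *: u' j) -> comb u z = comb u' (z *m A).
Proof.
move=> uA; rewrite /comb (eq_bigr (fun i => \sum_j (z 0 i * A i j) *: u' j)) => [|i _]; last first.
  by rewrite uA scaler_sumr; apply: eq_bigr => j _; rewrite scalerA.
by rewrite exchange_big; apply: eq_bigr => j _; rewrite mxE scaler_suml.
Qed.

(** The sizes of two bases of one space are equal only as a consequence of S and T being mutually
    inverse, hence the rectangular matrices. *)
Lemma det_conj_rect r s (S : 'M[K]_(r, s)) (T : 'M[K]_(s, r)) (A : 'M[K]_r) :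
  S *m T = 1%:M -> T *m S = 1%:M -> \det (T *m A *m S) = \det A.
Proof.
move=> ST TS; have rs : r = s.
  by apply/eqP; rewrite eqn_leq (mulmx1_min ST) (mulmx1_min TS).
subst s; rewrite !det_mulmx mulrC mulrA -det_mulmx ST det1 mul1r//.
Qed.

(** This frees the determinant from the complement chosen in [det_mod_ker]: any family that is a
    basis modulo the kernel and spans a stable subspace will do. Congruence modulo the kernel is
    tested by applying f. *)
Lemma det_mod_kerE (f : 'End(V)) r (u : 'I_r -> V) (A : 'M[K]_r) :
  (forall z, f (comb u z) = 0 -> z = 0) ->
  (forall x, exists z, f (x - comb u z) = 0) ->
  (forall z, f (comb u z) = comb u (z *m A)) ->
  det_mod_ker f = \det A.
Proof.
move=> u0 usp fA; rewrite /det_mod_ker.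
set U := ((lker f)^C)%VS; set b := vbasis U; set N := \matrix_(i, j) _.
have bU (i : 'I_(\dim U)) : b`_i \in U by rewrite vbasis_mem// mem_nth ?size_tuple.
pose bf (i : 'I_(\dim U)) : V := b`_i.
have bfU z : comb bf z \in U by apply: memv_suml => i _; apply: memvZ; exact: bU.
have bf0 z : f (comb bf z) = 0 -> z = 0.
  move=> fz; have : comb bf z \in (lker f :&: U)%VS by rewrite memv_cap bfU andbT memv_ker fz.
  rewrite capv_compl memv0 => /eqP zz; apply/rowP => i; rewrite mxE.
  by have /freeP := basis_free (vbasisP U); apply.
have proj x : f (x - comb bf (\row_j coord b j (daddv_pi U (lker f) x))) = 0.
  have -> : comb bf (\row_j coord b j (daddv_pi U (lker f) x)) = daddv_pi U (lker f) x.
    rewrite [RHS](coord_vbasis (memv_pi U (lker f) x)).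
    by apply: eq_bigr => j _; rewrite mxE.
  apply/eqP; rewrite -memv_ker.
  have dis : (U :&: lker f = 0)%VS by rewrite capvC capv_compl.
  have : x \in (U + lker f)%VS by rewrite addvC addv_complf memvf.
  move=> /(daddv_pi_add dis) xE; rewrite -{1}xE addrC addKr; exact: memv_pi.
have eqf x y : f (x - y) = 0 -> f x = f y by rewrite linearB => /eqP; rewrite subr_eq0 => /eqP.
have f_comb q (g g' : 'I_q -> V) z : (forall i, f (g i) = f (g' i)) -> f (comb g z) = f (comb g' z).
  by move=> gg; rewrite !linear_sum; apply: eq_bigr => i _; rewrite !linearZ /= gg.
pose S : 'M[K]_(r, \dim U) := \matrix_(i, j) coord b j (daddv_pi U (lker f) (u i)).
have hS z : f (comb u z) = f (comb bf (z *m S)).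
  rewrite -(combM (u := fun i => comb bf (row i S))) => [|i]; last by apply: eq_bigr => j _; rewrite !mxE.
  apply: f_comb => i; apply: eqf; rewrite -(proj (u i)); congr (f (_ - comb _ _)).
  by apply/rowP => j; rewrite !mxE.
have hN z : f (f (comb bf z)) = f (comb bf (z *m N)).
  rewrite -(combM (u := fun i => comb bf (row i N))) => [|i]; last by apply: eq_bigr => j _; rewrite !mxE.
  have -> : f (comb bf z) = comb (fun i => f (bf i)) z.
    by rewrite linear_sum; apply: eq_bigr => i _; rewrite linearZ.
  apply: f_comb => i; apply: eqf; rewrite -(proj (f (bf i))); congr (f (_ - comb _ _)).
  by apply/rowP => j; rewrite !mxE.
have /choice[t ht] := fun i => usp (bf i).
pose T := \matrix_i t i.
have hT z : f (comb bf z) = f (comb u (z *m T)).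
  rewrite -(combM (u := fun i => comb u (row i T))) => [|i]; last by apply: eq_bigr => j _; rewrite !mxE.
  by apply: f_comb => i; apply: eqf; rewrite rowK.
have u_inj z z' : f (comb u z) = f (comb u z') -> z = z'.
  by move=> fz; apply/eqP; rewrite -subr_eq0; apply/eqP/u0; rewrite combB linearB/= fz subrr.
have bf_inj z z' : f (comb bf z) = f (comb bf z') -> z = z'.
  by move=> fz; apply/eqP; rewrite -subr_eq0; apply/eqP/bf0; rewrite combB linearB/= fz subrr.
have ST : S *m T = 1%:M.
  by apply/row_matrixP => i; rewrite !rowE mulmx1 mulmxA; apply: u_inj; rewrite -hT -hS.
have TS : T *m S = 1%:M.
  by apply/row_matrixP => i; rewrite !rowE mulmx1 mulmxA; apply: bf_inj; rewrite -hS -hT.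
rewrite -(det_conj_rect A ST TS); congr (\det _).
apply/row_matrixP => i; rewrite !rowE !mulmxA; apply: bf_inj.
by rewrite -hN -hS -fA -hT.
Qed.

End DetModKer.

Lemma comb_basis (K : fieldType) (V : vectType K) (U : {vspace V}) r (b : r.-tuple V) (X : V) :
  basis_of U b -> X \in U -> X = comb (fun i : 'I_r => b`_i) (\row_i coord b i X).
Proof.
by move=> bU XU; rewrite {1}(coord_basis bU XU) /comb; apply: eq_bigr => i _; rewrite mxE.
Qed.

Lemma comb_mem (K : fieldType) (V : vectType K) (U : {vspace V}) r (b : r.-tuple V) z :
  basis_of U b -> comb (fun i : 'I_r => b`_i) z \in U.
Proof.
move=> bU; apply: memv_suml => i _; apply/memvZ/(basis_mem bU)/mem_nth.
by rewrite size_tuple.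
Qed.

Lemma comb_free (K : fieldType) (V : vectType K) (U : {vspace V}) r (b : r.-tuple V) z :
  basis_of U b -> comb (fun i : 'I_r => b`_i) z = 0 -> z = 0.
Proof.
move=> bU cz; apply/rowP => i; rewrite mxE.
by have /freeP := basis_free bU; apply; exact: cz.
Qed.

(** In an eigenbasis of g, the commutator with g multiplies the entry (i, j) by the difference of
    two eigenvalues, and such a factor kills an entry as soon as its square does. *)
Lemma diagonalizable_commutator2 (L : fieldType) n (g X : 'M[L]_n) : diagonalizable g ->
  g *m (g *m X - X *m g) = (g *m X - X *m g) *m g -> g *m X = X *m g.
Proof.
move=> [P uP /(diagonalizable_forLR uP)[D gE]].
have {gE}-> : g = invmx P *m diag_mx D *m P by rewrite gE mxpoly.conjumx ?unitmx_inv// invmxK.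
set gD := diag_mx D.
have [Y XE] : exists Y, X = invmx P *m Y *m P.
  by exists (P *m X *m invmx P); rewrite !mulmxA mulVmx// mul1mx mulmxKV.
have conjM A B : (invmx P *m A *m P) *m (invmx P *m B *m P) = invmx P *m (A *m B) *m P.
  by rewrite !mulmxA mulmxK// || rewrite -!mulmxA (mulmxA P) mulmxV// mul1mx.
have conjB A B : (invmx P *m A *m P) - (invmx P *m B *m P) = invmx P *m (A - B) *m P.
  by rewrite mulmxBr mulmxBl.
have conj_inj A B : invmx P *m A *m P = invmx P *m B *m P -> A = B.
  move=> h; apply: (can_inj (mulKmx (_ : invmx P \in unitmx))); first by rewrite unitmx_inv.
  by apply: (can_inj (mulmxK uP)).
rewrite XE !(conjM, conjB) => /conj_inj h; congr (_ *m _ *m _).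
apply/matrixP => i j; have := congr1 (fun A : 'M[L]_n => A i j) h.
rewrite !mul_diag_mx !mul_mx_diag !mxE => /eqP.
rewrite -subr_eq0 (_ : _ - _ = (D 0 i * Y i j - Y i j * D 0 j) * (D 0 i - D 0 j)); last by ring.
rewrite mulf_eq0 subr_eq0 => /orP[/eqP //|]; rewrite subr_eq0 => /eqP ->.
by rewrite mulrC.
Qed.

(** * The trace form on a centralizer *)

Section TraceForm.
Variables (F L : fieldType) (f : {rmorphism F -> L}) (n r : nat).
Variables (g : 'M[F]_n) (c : 'I_r -> 'M[F]_n).
Hypotheses (c_free : forall z, comb c z = 0 -> z = 0)
  (c_comm : forall i, g *m c i = c i *m g)
  (c_span : forall X, g *m X = X *m g -> exists z, X = comb c z)
  (g_ss : forall X, g *m (g *m X - X *m g) = (g *m X - X *m g) *m g -> g *m X = X *m g).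

Let ad : 'End('M[F]_n) := linfun (fun X => g *m X - X *m g).
Let adE X : ad X = g *m X - X *m g.
Proof.
apply: linfun_linear => a Y Z.
by rewrite mulmxDr mulmxDl -scalemxAr -scalemxAl scalerBr opprD addrACA.
Qed.

(** By [g_ss] the kernel and the image of ad meet in 0, and the dimensions add up. *)
Let ker_img X : exists Y Z, X = Y + ad Z /\ g *m Y = Y *m g.
Proof.
have dis : (lker ad :&: limg ad = 0)%VS.
  apply/eqP; rewrite -subv0; apply/subvP => Y' /memv_capP[kY /memv_imgP[Y _ Y'E]].
  move: kY; rewrite Y'E memv_ker !adE subr_eq0 => /eqP /g_ss gY.
  by rewrite gY subrr mem0v.
have full : (lker ad + limg ad)%VS = fullv.
  apply/eqP; rewrite eqEdim subvf dimv_disjoint_sum//.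
  by have := limg_ker_dim ad fullv; rewrite capfv => <-; rewrite leqnn.
have : X \in (lker ad + limg ad)%VS by rewrite full memvf.
move=> /memv_addP[Y kY [_ /memv_imgP[Z _ ->] XE]]; exists Y, Z; split=> //.
by move: kY; rewrite memv_ker adE subr_eq0 => /eqP.
Qed.

Definition trace_gram : 'M[F]_r := \matrix_(i, j) \tr (c i *m c j).

(** The image of ad is orthogonal to the centralizer for the trace form and complementary to it. So
    an element of the centralizer orthogonal to the centralizer is orthogonal to all matrices, hence
    0. *)
Lemma trace_gram_unit : trace_gram \in unitmx.
Proof.
rewrite -row_free_unit -kermx_eq0; apply/eqP/row_matrixP => k; rewrite row0.
set x := row k _; have xG : x *m trace_gram = 0.
  by rewrite /x -row_mul mulmx_ker row0.
have gx : g *m comb c x = comb c x *m g.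
  rewrite /comb mulmx_sumr mulmx_suml; apply: eq_bigr => i _.
  by rewrite -scalemxAr c_comm scalemxAl.
have tr_c j : \tr (comb c x *m c j) = 0.
  have := congr1 (fun A : 'rV[F]_r => A 0 j) xG; rewrite [RHS]mxE => <-; rewrite mxE.
  rewrite mulmx_suml raddf_sum; apply: eq_bigr => i _.
  by rewrite /= -scalemxAl mxtraceZ !mxE.
have tr0 Y : \tr (comb c x *m Y) = 0.
  have [Y1 [Z [-> /c_span[z ->]]]] := ker_img Y.
  rewrite mulmxDr mxtraceD adE mulmxBr raddfB /= !mulmxA (mxtrace_mulC _ g) mulmxA gx subrr addr0.
  rewrite mulmx_sumr raddf_sum big1// => i _.
  by rewrite /= -scalemxAr mxtraceZ tr_c mulr0.
apply: c_free; apply/matrixP => i j; rewrite [RHS]mxE -(tr0 (delta_mx j i)).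
rewrite /mxtrace (bigD1 i)//= big1 => [|k' /negPf ki].
  rewrite addr0 mxE (bigD1 j)//= big1 => [|l /negPf lj]; first by rewrite addr0 mxE !eqxx mulr1.
  by rewrite mxE lj mulr0.
by rewrite mxE big1// => l _; rewrite mxE ki andbF mulr0.
Qed.

(** Invariance reads Q G Q^T = G with G invertible. The conjugating matrix may live over an
    extension L, because the inner twist relating the two Lie algebras is defined over Fbar only. *)
Lemma centralizer_conj_det (z : 'M[L]_n) (Q : 'M[L]_r) : z \in unitmx ->
  (forall i, invmx z *m map_mx f (c i) *m z = \sum_j Q i j *: map_mx f (c j)) ->
  \det Q ^+ 2 = 1.
Proof.
move=> uz hQ; pose G := map_mx f trace_gram.
have GE i j : G i j = \tr (map_mx f (c i) *m map_mx f (c j)).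
  by rewrite !mxE -map_mxM trace_map_mx.
have GQ : Q *m G *m Q^T = G.
  apply/matrixP => i j; rewrite GE.
  have -> : \tr (map_mx f (c i) *m map_mx f (c j)) =
      \tr ((invmx z *m map_mx f (c i) *m z) *m (invmx z *m map_mx f (c j) *m z)).
    by rewrite !mulmxA (mulmxK uz) [RHS]mxtrace_mulC !mulmxA mulmxV// mul1mx.
  rewrite !hQ mulmx_suml raddf_sum mxE.
  under eq_bigr do rewrite mxE mulr_suml.
  rewrite exchange_big; apply: eq_bigr => k _ /=.
  rewrite -scalemxAl mxtraceZ mulmx_sumr raddf_sum mulr_sumr.
  by apply: eq_bigr => l _; rewrite /= -scalemxAr mxtraceZ !mxE -GE !mxE; ring.
have dG : \det G != 0.
  by rewrite det_map_mx fmorph_eq0 -unitfE -unitmxE trace_gram_unit.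
apply: (mulfI dG); rewrite mulr1 -[in RHS]GQ !det_mulmx det_tr; ring.
Qed.

End TraceForm.

Lemma le_sum1 (R : realType) (I : finType) (G : I -> R) i :
  (forall j, 0 <= G j) -> G i <= \sum_j G j.
Proof. by move=> G0; rewrite (bigD1 i)//= lerDl sumr_ge0. Qed.

(** * Isometries of subspaces of M_n(E) *)

Section Isometry.
Variables (R : realType) (F : fieldType) (vF : absval R F) (lfF : local_field vF).
Variables (E : fieldExtType F) (vE : absval R E) (vEP : normalized_extension vF vE).
Variable n : nat.
Local Notation D := (\dim {:E}).
Local Notation W := (resM E n).

Let D_gt0 : (0 < D)%N. Proof. exact: adim_gt0. Qed.

Lemma resM_scaleE (a : F) (X : W) : a *: X = (a%:A : E) *: (X : 'M[E]_n) :> 'M[E]_n.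
Proof. by []. Qed.

Lemma functional_bound (l : {scalar W}) :
  exists2 C : R, 0 < C & forall X : W, vF (l X) ^+ D <= C * mxn vE (X : 'M[E]_n).
Proof.
have [C C0 hC] := absv_coord_le lfF vEP.
pose e i j k : W := (vbasis {:E})`_k *: delta_mx i j : 'M[E]_n.
pose B := 1 + \sum_(i < n) \sum_(j < n) \sum_(k < D) vF (l (e i j k)) ^+ D.
have B0 : 0 < B by rewrite ltr_wpDr// !sumr_ge0// => i _; rewrite !sumr_ge0// => j _; rewrite sumr_ge0// => k _; rewrite exprn_ge0 ?absv_ge0.
exists (C * B) => [|X]; first exact: mulr_gt0.
have lE : l X = \sum_(i < n) \sum_(j < n) \sum_(k < D) coord (vbasis {:E}) k ((X : 'M[E]_n) i j) * l (e i j k).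
  have XE : X = \sum_(i < n) \sum_(j < n) \sum_(k < D) coord (vbasis {:E}) k ((X : 'M[E]_n) i j) *: e i j k.
    rewrite [LHS](matrix_sum_delta (X : 'M[E]_n)); apply: eq_bigr => i _; apply: eq_bigr => j _.
    rewrite {1}(coord_vbasis (memvf ((X : 'M[E]_n) i j))) scaler_suml; apply: eq_bigr => k _.
    by rewrite resM_scaleE scalerA mulr_algl.
  rewrite {1}XE linear_sum; apply: eq_bigr => i _; rewrite linear_sum; apply: eq_bigr => j _.
  by rewrite linear_sum; apply: eq_bigr => k _; rewrite linearZ.
have hb i j k : vF (coord (vbasis {:E}) k ((X : 'M[E]_n) i j) * l (e i j k)) ^+ D <= C * B * mxn vE (X : 'M[E]_n).
  rewrite absvM exprMn mulrAC ler_pM ?exprn_ge0 ?absv_ge0//.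
    by rewrite (le_trans (hC _ _))// ler_wpM2l ?mxn_ent// ltW.
  have h0 i' j' k' : 0 <= vF (l (e i' j' k')) ^+ D by rewrite exprn_ge0 ?absv_ge0.
  rewrite /B -[leLHS]add0r lerD//.
  apply: le_trans (le_sum1 i _) => [|i']; last by rewrite sumr_ge0// => *; rewrite sumr_ge0.
  apply: le_trans (le_sum1 j _) => [|j']; last by rewrite sumr_ge0.
  exact: (le_sum1 k).
pose S := C * B * mxn vE (X : 'M[E]_n).
have S0 : 0 <= S by rewrite !mulr_ge0 ?mxn_ge0 ?ltW.
have sumP (I : finType) (G : I -> F) : (forall i, vF (G i) ^+ D <= S) -> vF (\sum_i G i) ^+ D <= S.
  move=> hG; apply: (big_ind (fun x => vF x ^+ D <= S)) => //.
    by rewrite absv0 expr0n eqn0Ngt D_gt0.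
  move=> x y xS yS; have [xy|yx] := leP (vF x) (vF y).
    apply: le_trans yS; rewrite lerXn2r ?nnegrE ?absv_ge0//.
    by rewrite (le_trans (absv_ultra vF x y))// ge_max xy lexx.
  apply: le_trans xS; rewrite lerXn2r ?nnegrE ?absv_ge0//.
  by rewrite (le_trans (absv_ultra vF x y))// ge_max (ltW yx) lexx.
by rewrite lE -/S; apply: (sumP) => i; apply: (sumP) => j; apply: (sumP) => k; exact: hb.
Qed.

Variables (s : nat) (w : 'I_s -> W).
Hypothesis w_free : forall z, comb w z = 0 -> z = 0.

Lemma comb_le : exists2 C : R, 0 < C & forall z, mxn vE (comb w z : 'M[E]_n) <= C * mxn vF z ^+ D.
Proof.
pose B := 1 + \sum_(i < s) mxn vE (w i : 'M[E]_n).
have B0 : 0 < B by rewrite ltr_wpDr// sumr_ge0// => i _; exact: mxn_ge0.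
exists B => // z; have := @mxn_sum R E vE n n _ (index_enum 'I_s) xpredT (fun i => (z 0 i *: w i : W) : 'M[E]_n).
apply; first by rewrite mulr_ge0 ?exprn_ge0 ?mxn_ge0// ltW.
move=> i _; rewrite resM_scaleE mxnZ vEP mulrC ler_pM ?mxn_ge0 ?exprn_ge0 ?absv_ge0//.
  by rewrite /B (bigD1 i)//= addrCA lerDl addr_ge0// sumr_ge0// => j _; exact: mxn_ge0.
by rewrite lerXn2r ?nnegrE ?absv_ge0 ?mxn_ge0 ?mxn_ent.
Qed.

Lemma comb_ge : exists2 C : R, 0 < C & forall z, mxn vF z ^+ D <= C * mxn vE (comb w z : 'M[E]_n).
Proof.
pose t : s.-tuple W := [tuple w i | i < s].
have tE (i : 'I_s) : t`_i = w i by rewrite -tnth_nth tnth_mktuple.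
have ft : free t.
  apply/freeP => k hk i; have : \row_j k j = 0.
    by apply: w_free; rewrite -[RHS]hk /comb; apply: eq_bigr => j _; rewrite mxE tE.
  by move=> /rowP/(_ i); rewrite !mxE.
have /choice[C hC] : forall i : 'I_s, exists C : R,
    0 < C /\ forall X : W, vF (coord t i X) ^+ D <= C * mxn vE (X : 'M[E]_n).
  by move=> i; have [C C0 hC] := functional_bound (coord t i); exists C.
have C0 i : 0 < C i by have [] := hC i.
have B0 : 0 < 1 + \sum_i C i by rewrite ltr_wpDr// sumr_ge0// => i _; exact: ltW.
exists (1 + \sum_i C i) => // z.
have [->|z0] := eqVneq z 0.
  by rewrite mxn0 expr0n eqn0Ngt D_gt0 mulr_ge0 ?mxn_ge0 ?ltW.
have [i [j ->]] := mxn_attained vF z0; rewrite (ord1 i).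
have -> : z 0 j = coord t j (comb w z).
  rewrite /comb; under eq_bigr do rewrite -tE; by rewrite coord_sum_free.
rewrite (le_trans ((hC j).2 _))// ler_wpM2r ?mxn_ge0//.
rewrite -[leLHS]add0r lerD//; apply: le_sum1 => k; exact: ltW.
Qed.

(** The powers of B are isometries for the norm of M_n(E), so their coordinate matrices stay bounded
    and |det B| is at most 1; the inverse of B gives equality. *)
Lemma isometry_det (B : 'M[F]_s) :
  (forall z, mxn vE (comb w (z *m B) : 'M[E]_n) = mxn vE (comb w z : 'M[E]_n)) ->
  vF (\det B) = 1.
Proof.
move=> iso.
have uB : B \in unitmx.
  rewrite -row_free_unit -kermx_eq0; apply/eqP/row_matrixP => i; rewrite row0.
  apply/w_free/(mxn_eq0 (v := vE)); rewrite -iso -row_mul mulmx_ker row0.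
  by have -> : comb w 0 = 0; [rewrite /comb big1// => j _; rewrite mxE scale0r|rewrite mxn0].
have [C1 C10 hC1] := comb_le; have [C2 C20 hC2] := comb_ge.
have le1 (A : 'M[F]_s) : (forall z, mxn vE (comb w (z *m A) : 'M[E]_n) = mxn vE (comb w z : 'M[E]_n)) ->
    vF (\det A) <= 1.
  move=> isoA; apply: (@absv_det_bounded_powers _ _ _ _ _ (Num.max 1 (C2 * C1))) => k.
  have isoAk z : mxn vE (comb w (z *m A ^+ k) : 'M[E]_n) = mxn vE (comb w z : 'M[E]_n).
    elim: k z => [|k IH] z; first by rewrite expr0 mulmx1.
    by rewrite exprSr mulmxA isoA IH.
  apply: mxn_le => [|i j]; first by rewrite le_max ler01.
  have row_le : mxn vF (row i (A ^+ k)) <= Num.max 1 (C2 * C1).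
    rewrite le_max; have [//|/ltW h1/=] := leP (mxn vF (row i (A ^+ k))) 1.
    apply: le_trans (_ : mxn vF (row i (A ^+ k)) ^+ D <= _); first by rewrite ler_eXnr.
    rewrite rowE (le_trans (hC2 _))// isoAk ler_wpM2l ?(ltW C20)//.
    rewrite (le_trans (hC1 _))// ler_piMr ?(ltW C10)// exprn_ile1 ?mxn_ge0//.
    by apply: mxn_le => // a b; rewrite mxE; case: (_ && _); rewrite ?absv1 ?absv0.
  by apply: le_trans row_le; have := mxn_ent vF (row i (A ^+ k)) 0 j; rewrite mxE.
apply/le_anti; rewrite le1//= -[leLHS]invr1 -[leRHS]invrK -absvV -det_inv lef_pV2 ?posrE//.
  by apply: le1 => z; rewrite -[in RHS](mulmxKV uB z) iso.
by rewrite absv_gt0 -unitfE -unitmxE unitmx_inv.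
Qed.

End Isometry.

(** * Discriminants *)

Lemma invmx_mul (K : fieldType) n (A B : 'M[K]_n) : A \in unitmx -> B \in unitmx ->
  invmx (A *m B) = invmx B *m invmx A.
Proof.
move=> uA uB; have uAB : A *m B \in unitmx by rewrite unitmx_mul uA.
by apply: (can_inj (mulKmx uAB)); rewrite mulmxV// !mulmxA mulmxK// mulmxV.
Qed.

Section TwistedDiscriminant.
Variables (R : realType) (F : fieldType) (vF : absval R F) (lfF : local_field vF).
Variables (E : splittingFieldType F) (vE : absval R E) (vEP : normalized_extension vF vE).
Variables (th : {rmorphism E -> E}) (d n : nat).
Local Notation emb := (map_mx (in_alg E)).
Local Notation tmx := (map_mx th).
Hypotheses (th_alg : forall a : F, th a%:A = a%:A) (th_d : forall x, iter d th x = x)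
  (th_fix : forall x, th x = x -> exists a : F, x = a%:A)
  (v_th : forall x, vE (th x) = vE x) (vd : vE d%:R = 1).
Variable rho : R.
Hypotheses (rho_gt0 : 0 < rho) (rho1 : rho < 1).
Hypothesis root_intertwine : forall M M' X : 'M[E]_n, close1 vE rho M -> close1 vE rho M' ->
  X *m M ^+ d = M' ^+ d *m X -> X *m M = M' *m X.

Lemma tmx_emb m l (X : 'M[F]_(m, l)) : tmx (emb X) = emb X.
Proof. by apply/matrixP => i j; rewrite !mxE /= th_alg. Qed.

Lemma tmx_fixed m l (X : 'M[E]_(m, l)) : tmx X = X -> exists Y : 'M[F]_(m, l), X = emb Y.
Proof.
move=> tX; have /choice[Y hY] : forall ij : 'I_m * 'I_l, exists a : F, X ij.1 ij.2 = a%:A.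
  by move=> ij; apply: th_fix; rewrite -{2}tX mxE.
by exists (\matrix_(i, j) Y (i, j)); apply/matrixP => i j; rewrite !mxE (hY (i, j)).
Qed.

Lemma emb_inj m l : injective (fun X : 'M[F]_(m, l) => emb X).
Proof. exact: map_mx_inj. Qed.

Lemma embX (X : 'M[F]_n) k : emb (X ^+ k) = (emb X) ^+ k.
Proof. by rewrite rmorphXn. Qed.

(* Z intertwines V theta and V' theta, hence their d-th powers V^d and V'^d, hence V and V'. *)
Lemma twisted_intertwine (V V' : 'M[F]_n) (Z : 'M[E]_n) :
  close1 vE rho (emb V) -> close1 vE rho (emb V') ->
  emb V *m tmx Z = Z *m emb V' -> tmx Z = Z /\ emb V *m Z = Z *m emb V'.
Proof.
move=> V1 V1' VZ.
have VZk k : emb V ^+ k *m iter k tmx Z = Z *m emb V' ^+ k.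
  elim: k => [|k IH]; first by rewrite !expr0 mul1mx mulmx1.
  have -> : iter k.+1 tmx Z = tmx (iter k tmx Z) by [].
  have tV j (U : 'M[F]_n) : tmx (emb U ^+ j) = emb U ^+ j by rewrite -embX tmx_emb.
  rewrite exprS -[_ * _]/(_ *m _) -mulmxA -[X in X *m tmx _](tV k V) -map_mxM IH.
  by rewrite map_mxM tV mulmxA VZ -mulmxA exprS.
have VZd : Z *m emb V' ^+ d = emb V ^+ d *m Z.
  rewrite -VZk; congr (_ *m _); rewrite -iter_map_mx.
  by apply/matrixP => i j; rewrite mxE th_d.
have ZV := root_intertwine V1' V1 VZd; split=> //.
have uV : emb V \in unitmx := near1_unit rho1 V1.
by apply: (can_inj (mulKmx uV)); rewrite VZ ZV.
Qed.

Section Comparison.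
Variables (V : 'M[F]_n) (V1 : close1 vE rho (emb V)).
Hypothesis Vd_ss : forall X : 'M[F]_n,
  V ^+ d *m (V ^+ d *m X - X *m V ^+ d) = (V ^+ d *m X - X *m V ^+ d) *m V ^+ d ->
  V ^+ d *m X = X *m V ^+ d.

Let uVE : emb V \in unitmx. Proof. exact: (near1_unit rho1 V1). Qed.
Let uV : V \in unitmx. Proof. by move: uVE; rewrite map_unitmx. Qed.
Let uVk k : V ^+ k \in unitmx.
Proof. by elim: k => [|k IH]; rewrite ?expr0 ?unitmx1// exprS unitmx_mul uV. Qed.

Let d_neq0 : d%:R != 0 :> F.
Proof.
have : d%:R != 0 :> E by rewrite -(absv_gt0 vE) vd.
by apply: contra => /eqP d0; rewrite -(rmorph_nat (in_alg E)) /= d0 scale0r.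
Qed.

Let root_commute (X : 'M[F]_n) : V ^+ d *m X = X *m V ^+ d -> V *m X = X *m V.
Proof.
move=> VX; apply: emb_inj; rewrite !map_mxM; apply/esym/root_intertwine => //.
by rewrite -embX -!map_mxM VX.
Qed.

(* G i is the i-th power of X |-> V theta(X) V^-1. *)
Let G k (Z : 'M[E]_n) := emb (V ^+ k) *m iter k tmx Z *m emb (invmx (V ^+ k)).

Let mxn_tmx k (Z : 'M[E]_n) : mxn vE (iter k tmx Z) = mxn vE Z.
Proof. by elim: k => //= k IH; rewrite (mxn_map v_th). Qed.

(** V^k is within rho of 1, so conjugation by it changes th^k(Z) by a relative error of rho at most:
    to that precision G is the Galois action. *)
Let G_close k Z : mxn vE (G k Z - iter k tmx Z) <= rho * mxn vE Z.
Proof.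
have Vk1 : close1 vE rho (emb (V ^+ k)) by rewrite embX; exact: near1X.
have Vk1' : close1 vE rho (emb (invmx (V ^+ k))) by rewrite map_invmx; exact: (near1V rho1).
have -> : G k Z - iter k tmx Z = (emb (V ^+ k) - 1%:M) *m iter k tmx Z *m emb (invmx (V ^+ k))
    + iter k tmx Z *m (emb (invmx (V ^+ k)) - 1%:M).
  by rewrite mulmxBl mul1mx mulmxBl mulmxBr mulmx1 addrA subrK.
apply: mxnD_le; last by rewrite mulrC mxn_mul_le ?mxn_tmx.
by rewrite -[leRHS]mulr1 mxn_mul_le ?(near1_le1 rho1)// mxn_mul_le ?mxn_tmx.
Qed.

Let G_le k Z : mxn vE (G k Z) <= mxn vE Z.
Proof.
rewrite -(subrK (iter k tmx Z) (G k Z)) mxnD_le ?mxn_tmx//.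
by rewrite (le_trans (G_close k Z))// ler_piMl ?mxn_ge0// ltW.
Qed.

Let GS k Z : G k.+1 Z = G k (G 1 Z).
Proof.
have tM (A B : 'M[E]_n) : iter k tmx (A *m B) = iter k tmx A *m iter k tmx B.
  by elim: k => //= k' IH; rewrite IH map_mxM.
have te (A : 'M[F]_n) : iter k tmx (emb A) = emb A.
  by elim: k {tM} => //= k' ->; rewrite tmx_emb.
rewrite /G expr1 iterSr !tM !te exprSr invmx_mul// !map_mxM !mulmxA//.
Qed.

Let GB k Z Z' : G k (Z - Z') = G k Z - G k Z'.
Proof.
have tB : iter k tmx (Z - Z') = iter k tmx Z - iter k tmx Z'.
  by elim: k => //= k' ->; rewrite map_mxB.
by rewrite /G tB mulmxBr mulmxBl.
Qed.

Let small_add (Y Z : 'M[E]_n) : mxn vE Y <= rho * mxn vE Z -> mxn vE (Z + Y) = mxn vE Z.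
Proof.
move=> YZ; have YZ' : mxn vE Y <= mxn vE Z.
  by rewrite (le_trans YZ)// ler_piMl ?mxn_ge0// ltW.
apply/le_anti; rewrite mxnD_le//=.
apply: (@mxn_contract _ _ _ _ _ _ rho); rewrite ?mxn_ge0//.
by rewrite -{1}(addrK Y Z) (le_trans (mxnB _ _ _))// ge_max !le_max lexx YZ orbT.
Qed.

Let tr (Z : 'M[E]_n) := \sum_(i < d) iter i tmx Z.

Let trD (X Y : 'M[E]_n) : tr (X + Y) = tr X + tr Y.
Proof.
rewrite /tr -big_split; apply: eq_bigr => k _.
by elim: (k : nat) => //= k' ->; rewrite map_mxD.
Qed.

Let trB (X Y : 'M[E]_n) : tr (X - Y) = tr X - tr Y.
Proof.
rewrite /tr -sumrB; apply: eq_bigr => k _.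
by elim: (k : nat) => //= k' ->; rewrite map_mxB.
Qed.

Let mxn_dZ (Z : 'M[E]_n) : mxn vE (Z *+ d) = mxn vE Z.
Proof. by rewrite -scaler_nat mxnZ vd mul1r. Qed.

Let mulrn_d_inj (X Y : 'M[E]_n) : X *+ d = Y *+ d -> X = Y.
Proof.
move=> XY; apply/eqP; rewrite -subr_eq0; apply/eqP/(mxn_eq0 (v := vE)).
by rewrite -mxn_dZ mulrnBl XY subrr mxn0.
Qed.

Let sumG_close Z : mxn vE (\sum_(i < d) G i Z - tr Z) <= rho * mxn vE Z.
Proof.
rewrite -sumrB; apply: mxn_sum => [|i _]; first by rewrite mulr_ge0 ?mxn_ge0// ltW.
exact: G_close.
Qed.

Let tmx_iter_fixed (Z : 'M[E]_n) i : tmx Z = Z -> iter i tmx Z = Z.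
Proof. by move=> tZ; elim: i => //= i ->. Qed.

Let tr_fixed (Z : 'M[E]_n) : tmx Z = Z -> tr Z = Z *+ d.
Proof.
by move=> tZ; rewrite /tr (eq_bigr (fun=> Z)) ?sumr_const ?card_ord// => i _; exact: tmx_iter_fixed.
Qed.

(** On matrices over F the sum is d Z up to a relative error of rho, and |d| = 1. *)
Let sumG_isometry (Z : 'M[E]_n) : tmx Z = Z -> mxn vE (\sum_(i < d) G i Z) = mxn vE Z.
Proof.
move=> tZ; rewrite -(subrK (tr Z) (\sum_(i < d) G i Z)) addrC tr_fixed//.
by rewrite small_add mxn_dZ// -tr_fixed// sumG_close.
Qed.

(** Telescoping gives d Z as the sum of the G_i Z minus the double sum of the G_j Y over j < i < d.
    The first sum is within rho |Z| of tr Z = 0, so |Z| <= |Y|. *)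
Let G1_isometry Z : tr Z = 0 -> mxn vE (G 1 Z - Z) = mxn vE Z.
Proof.
move=> trZ; apply/le_anti; rewrite mxnB_le ?G_le//=.
set Y := G 1 Z - Z.
have GY i : G i Z = Z + \sum_(j < i) G j Y.
  elim: i => [|i IH].
    by rewrite big_ord0 addr0 /G expr0 invmx1 map_mx1 mul1mx mulmx1.
  by rewrite big_ord_recr/= addrA -IH GB -GS addrC subrK.
have dZ : Z *+ d = \sum_(i < d) G i Z - \sum_(i < d) \sum_(j < i) G j Y.
  by rewrite -sumrB -[in LHS](card_ord d) -sumr_const; apply: eq_bigr => i _; rewrite GY addrK.
apply: (@mxn_contract _ _ _ _ _ _ rho); rewrite ?mxn_ge0//.
rewrite -{1}(mxn_dZ Z) dZ (le_trans (mxnB _ _ _))// maxC ge_max !le_max; apply/andP; split.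
  apply/orP; left; apply: mxn_sum => [|i _]; first exact: mxn_ge0.
  by apply: mxn_sum => [|j _]; [exact: mxn_ge0|exact: G_le].
by apply/orP; right; have := sumG_close Z; rewrite trZ subr0.
Qed.

Let f k (X : 'M[F]_n) := V ^+ k *m X *m invmx (V ^+ k).

Let emb_f k X : emb (f k X) = G k (emb X).
Proof. by rewrite /f /G !map_mxM tmx_iter_fixed// tmx_emb. Qed.

Let ad : 'End('M[F]_n) := linfun (fun X => f 1 X - X).

Let adE X : ad X = f 1 X - X.
Proof.
apply: linfun_linear => a Y Z.
by rewrite /f mulmxDr mulmxDl -scalemxAr -scalemxAl scalerBr opprD addrACA.
Qed.

Let ad_ker X : ad X = 0 -> V *m X = X *m V.
Proof.
rewrite adE /f expr1 => /eqP; rewrite subr_eq0 => /eqP h.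
by rewrite -{2}h mulmxKV.
Qed.

Let f_comm k X : V ^+ k *m X = X *m V ^+ k -> f k X = X.
Proof. by rewrite /f => ->; rewrite mulmxK. Qed.

Let commX k X : V *m X = X *m V -> V ^+ k *m X = X *m V ^+ k.
Proof.
move=> h; elim: k => [|k IH]; first by rewrite mulmx1 mul1mx.
by rewrite exprSr -[_ * _]/(_ *m _) -mulmxA h mulmxA IH -mulmxA.
Qed.

Let fS k X : f k.+1 X = f k (f 1 X).
Proof. by rewrite /f expr1 exprSr invmx_mul// !mulmxA. Qed.

Let fB k X Y : f k (X - Y) = f k X - f k Y.
Proof. by rewrite /f mulmxBr mulmxBl. Qed.

(* If ad Y commutes with V, then V^k Y V^-k = Y + k ad Y, and the hypothesis on V^d gives d ad Y = 0. *)
Let ad_ss Y : V *m ad Y = ad Y *m V -> ad Y = 0.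
Proof.
move=> h; have fdY k : f k Y = Y + ad Y *+ k.
  elim: k => [|k IH]; first by rewrite mulr0n addr0 /f expr0 invmx1 mul1mx mulmx1.
  have -> : f k.+1 Y = f k Y + f k (ad Y) by rewrite fS adE fB addrC subrK.
  by rewrite IH (f_comm (commX k h)) mulrSr addrA.
have hd : V ^+ d *m Y - Y *m V ^+ d = (ad Y *+ d) *m V ^+ d.
  have : f d Y *m V ^+ d = V ^+ d *m Y by rewrite /f mulmxKV.
  by move=> <-; rewrite fdY mulmxDl addrC addKr.
have /Vd_ss h2 : V ^+ d *m (V ^+ d *m Y - Y *m V ^+ d) = (V ^+ d *m Y - Y *m V ^+ d) *m V ^+ d.
  rewrite hd -scaler_nat -!scalemxAl -!scalemxAr; congr (_ *: _).
  by rewrite mulmxA (commX d h).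
have : ad Y *+ d = 0 by have := fdY d; rewrite f_comm// => /eqP; rewrite eq_sym -subr_eq0 addrC addKr => /eqP.
by rewrite -scaler_nat => /eqP; rewrite scaler_eq0 (negPf d_neq0) => /eqP.
Qed.

Let ker_img X : exists Y Z, X = Y + ad Z /\ V *m Y = Y *m V.
Proof.
have dis : (lker ad :&: limg ad = 0)%VS.
  apply/eqP; rewrite -subv0; apply/subvP => Y' /memv_capP[kY /memv_imgP[Y _ Y'E]].
  by move: kY; rewrite Y'E memv_ker => /eqP /ad_ker /ad_ss ->; rewrite mem0v.
have full : (lker ad + limg ad)%VS = fullv.
  apply/eqP; rewrite eqEdim subvf dimv_disjoint_sum//.
  by have := limg_ker_dim ad fullv; rewrite capfv => <-; rewrite leqnn.
have : X \in (lker ad + limg ad)%VS by rewrite full memvf.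
move=> /memv_addP[Y kY [_ /memv_imgP[Z _ ->] XE]]; exists Y, Z; split=> //.
by apply: ad_ker; apply/eqP; rewrite -memv_ker.
Qed.

Let U := limg ad.
Let u (i : 'I_(\dim U)) : 'M[F]_n := (vbasis U)`_i.

Let comb_U z : comb u z \in U.
Proof. exact: (comb_mem z (vbasisP U)). Qed.

Let U_comb X : exists z, ad X = comb u z.
Proof. by eexists; exact: (comb_basis (vbasisP U) (memv_img ad (memvf X))). Qed.

Let u_free z : comb u z = 0 -> z = 0.
Proof. exact: (comb_free (vbasisP U)). Qed.

Let u_ker z : V *m comb u z = comb u z *m V -> z = 0.
Proof.
move=> h; apply: u_free; have := comb_U z.
by move=> /memv_imgP[Y _ uY]; rewrite uY in h *; exact: ad_ss.
Qed.

(** The matrix of Ad(V) - 1 on its image: both discriminants are compared with its determinant. *)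
Let A : 'M[F]_(\dim U) := \matrix_(i, j) coord (vbasis U) j (ad (u i)).

Let ad_comb z : ad (comb u z) = comb u (z *m A).
Proof.
rewrite -(combM (u := fun i => ad (u i))) => [|i].
  by rewrite /comb linear_sum; apply: eq_bigr => i _; rewrite linearZ.
rewrite {1}(coord_vbasis (memv_img ad (memvf (u i)))).
by apply: eq_bigr => j _; rewrite mxE.
Qed.

Let f_comb k z : f k (comb u z) = comb u (z *m (A + 1%:M) ^+ k).
Proof.
elim: k z => [|k IH] z; first by rewrite /f !expr0 invmx1 mul1mx !mulmx1.
rewrite fS -[f 1 _](subrK (comb u z)) -adE ad_comb -combD -{2}(mulmx1 z) -mulmxDr IH.
by rewrite exprS mulmxA.
Qed.

(** A + 1 is the matrix of Ad(V), so that Ad(V)^d - 1 acts on the image by A H. *)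
Let H := \sum_(i < d) (A + 1%:M) ^+ i.

Let AH : (A + 1%:M) ^+ d = A *m H + 1%:M.
Proof. by rewrite -[LHS](subrK 1%:M) subrX1 addrK. Qed.

Let w (i : 'I_(\dim U)) : resM E n := emb (u i).

Let emb_comb z : emb (comb u z) = comb w z.
Proof.
by rewrite /comb raddf_sum; apply: eq_bigr => i _; rewrite /= map_mxZ.
Qed.

Let absv_det_H : vF (\det H) = 1.
Proof.
apply: (isometry_det lfF vEP (w := w)) => [z|z].
  by rewrite -emb_comb => h; apply: u_free; apply: emb_inj; rewrite h map_mx0.
rewrite -!emb_comb.
have -> : comb u (z *m H) = \sum_(i < d) f i (comb u z).
  rewrite /H mulmx_sumr; under [in RHS]eq_bigr do rewrite f_comb.
  apply: (big_ind2 (fun x y => comb u x = y)) => //.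
    by rewrite /comb big1// => i _; rewrite mxE scale0r.
  by move=> x _ y _ <- <-; rewrite combD.
rewrite raddf_sum -[in RHS]sumG_isometry ?tmx_emb//; congr (mxn _ _).
by apply: eq_bigr => i _; rewrite /= emb_f.
Qed.

(** V^d and V have the same commutant, so the image of ad V, moved by y, is a complement of the
    kernel for gamma. On it Ad(gamma) - 1 has matrix A H, and |det H| = 1. *)
Lemma det_mod_ker_adF (y : 'M[F]_n) (gamma : GL vF n) : y \in unitmx ->
  mxGL gamma = y *m V ^+ d *m invmx y -> vF (det_mod_ker (adF gamma)) = vF (\det A).
Proof.
move=> uy gE; have adFE X : adF gamma X = mxGL gamma *m X *m invmx (mxGL gamma) - X.
  apply: linfun_linear => a Y Z.
  by rewrite mulmxDr mulmxDl -scalemxAr -scalemxAl scalerBr opprD addrACA.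
have adFy X : adF gamma (y *m X *m invmx y) = y *m (f d X - X) *m invmx y.
  rewrite adFE gE /f !invmx_mul ?unitmx_mul ?uy ?uVk ?unitmx_inv// invmxK.
  by rewrite !mulmxA !mulmxKV// mulmxBr mulmxBl !mulmxA.
pose u' i := y *m u i *m invmx y.
have u'E z : comb u' z = y *m comb u z *m invmx y.
  rewrite /comb mulmx_sumr mulmx_suml; apply: eq_bigr => i _.
  by rewrite -scalemxAr -scalemxAl.
have y_inj X : y *m X *m invmx y = 0 -> X = 0.
  move=> h; rewrite -[X](mulKmx uy) -[y *m X](mulmxK (_ : invmx y \in unitmx)) ?unitmx_inv// h.
  by rewrite mul0mx mulmx0.
rewrite (@det_mod_kerE _ _ _ _ u' (A *m H)).
- by rewrite det_mulmx absvM absv_det_H mulr1.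
- move=> z; rewrite u'E adFy => /y_inj /eqP; rewrite subr_eq0 => /eqP h.
  by apply/u_ker/root_commute; rewrite -{2}h /f mulmxKV.
- move=> X; have [Y [Z [XE VY]]] := ker_img (invmx y *m X *m y).
  have [z zE] := U_comb Z; exists z.
  have -> : X - comb u' z = y *m Y *m invmx y.
    have -> : Y = invmx y *m X *m y - comb u z by rewrite XE zE addrK.
    by rewrite u'E mulmxBr mulmxBl !mulmxA mulmxV// mul1mx mulmxK.
  by rewrite adFy (f_comm (commX d VY)) subrr mulmx0 mul0mx.
- move=> z; rewrite !u'E adFy f_comb.
  by have -> : z *m (A + 1%:M) ^+ d = z *m (A *m H) + z; rewrite ?combD ?addrK// AH mulmxDr mulmx1.
Qed.

Let Tr : 'End(resM E n) := linfun (fun X : resM E n => tr X : resM E n).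

Let iter_tmxD k (a : F) (X Y : 'M[E]_n) :
  iter k tmx (a%:A *: X + Y) = a%:A *: iter k tmx X + iter k tmx Y.
Proof. by elim: k => //= k ->; rewrite map_mxD map_mxZ th_alg. Qed.

Let TrE (X : resM E n) : Tr X = tr X.
Proof.
apply: linfun_linear => a Y Z; rewrite resM_scaleE scaler_sumr -big_split.
by apply: eq_bigr => i _; rewrite /= -iter_tmxD.
Qed.

(** A complement of M_n(F) in M_n(E), since d is invertible. It is stable under X |-> V th(X)
    V^-1. *)
Let W := lker Tr.
Let w' (i : 'I_(\dim W)) : resM E n := (vbasis W)`_i.
Let g1 : 'End(resM E n) := linfun (fun X : resM E n => (G 1 X - X : 'M[E]_n) : resM E n).

Let G1E Z : G 1 Z = emb V *m tmx Z *m emb (invmx V).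
Proof. by []. Qed.

Let g1E (X : resM E n) : g1 X = (G 1 X - X : 'M[E]_n).
Proof.
apply: linfun_linear => a Y Z; rewrite !resM_scaleE !G1E map_mxD map_mxZ th_alg.
by rewrite mulmxDr mulmxDl -scalemxAr -scalemxAl scalerBr opprD addrACA.
Qed.

Let tr_G1 Z : tr (G 1 Z) = G 1 (tr Z).
Proof.
have tM k (X Y : 'M[E]_n) : iter k tmx (X *m Y) = iter k tmx X *m iter k tmx Y.
  by elim: k => //= k' IH; rewrite IH map_mxM.
rewrite !G1E /tr raddf_sum mulmx_sumr mulmx_suml; apply: eq_bigr => i _.
have te (X : 'M[F]_n) : iter i tmx (emb X) = emb X by rewrite tmx_iter_fixed ?tmx_emb.
by rewrite !tM !te -iterSr.
Qed.

Let tmx_tr Z : tmx (tr Z) = tr Z.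
Proof.
rewrite /tr raddf_sum /=; case: (d) (th_d) => [|d'] td; first by rewrite !big_ord0.
rewrite big_ord_recr/= -iterS -iter_map_mx addrC [RHS]big_ord_recl; congr (_ + _).
by apply/matrixP => i j; rewrite mxE td.
Qed.

Let comb_W z : tr (comb w' z : 'M[E]_n) = 0.
Proof.
suff : comb w' z \in W by rewrite memv_ker => /eqP h; rewrite -[LHS]TrE h.
exact: (comb_mem z (vbasisP W)).
Qed.

Let W_comb (X : resM E n) : tr X = 0 -> exists z, X = comb w' z.
Proof. by move=> tX; eexists; apply: (comb_basis (vbasisP W)); rewrite memv_ker TrE tX. Qed.

Let w'_free z : comb w' z = 0 -> z = 0.
Proof. exact: (comb_free (vbasisP W)). Qed.

Let B : 'M[F]_(\dim W) := \matrix_(i, j) coord (vbasis W) j (g1 (w' i)).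

Let g1_comb z : g1 (comb w' z) = comb w' (z *m B).
Proof.
rewrite -(combM (u := fun i => g1 (w' i))) => [|i].
  by rewrite /comb linear_sum; apply: eq_bigr => i _; rewrite linearZ.
have wW : g1 (w' i) \in W.
  have w0 : tr (w' i) = 0 by rewrite -(comb_delta w' i) comb_W.
  rewrite memv_ker TrE g1E trB tr_G1 w0 subr0 G1E.
  by rewrite map_mx0 mulmx0 mul0mx.
by rewrite {1}(coord_vbasis wW); apply: eq_bigr => j _; rewrite mxE.
Qed.

Let absv_det_B : vF (\det B) = 1.
Proof.
apply: (isometry_det lfF vEP (w := w')) => [|z]; first exact: w'_free.
by rewrite -g1_comb g1E G1_isometry// comb_W.
Qed.

(** M_n(E) is the sum of the image of ad V, the commutant of V in M_n(F), and W. Moved by x, the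
    first and the last form a complement of the kernel on which the twisted map is block diagonal,
    with blocks A and the isometry B. *)
Lemma det_mod_ker_ad_twisted (x : 'M[E]_n) (delta : GL vE n) : x \in unitmx ->
  mxGL delta = x *m emb V *m invmx (tmx x) ->
  vF (det_mod_ker (ad_twisted th delta)) = vF (\det A).
Proof.
move=> ux dE; have utx : tmx x \in unitmx by rewrite map_unitmx.
have adTE (X : resM E n) : ad_twisted th delta X =
    (mxGL delta *m tmx (X : 'M[E]_n) *m invmx (mxGL delta) - X : 'M[E]_n).
  apply: linfun_linear => a Y Z; rewrite !resM_scaleE map_mxD map_mxZ th_alg.
  by rewrite mulmxDr mulmxDl -scalemxAr -scalemxAl scalerBr opprD addrACA.
have adTx (X : 'M[E]_n) : ad_twisted th delta (x *m X *m invmx x : 'M[E]_n) =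
    x *m (G 1 X - X) *m invmx x :> 'M[E]_n.
  rewrite adTE dE !map_mxM map_invmx G1E !invmx_mul ?unitmx_mul ?ux ?uVE ?unitmx_inv// invmxK.
  by rewrite !mulmxA !mulmxKV// mulmxBr mulmxBl !mulmxA map_invmx.
pose vm (i : 'I_(\dim U + \dim W)) : 'M[E]_n :=
  x *m match fintype.split i with inl j => emb (u j) | inr j => (w' j : 'M[E]_n) end *m invmx x.
pose v : 'I_(\dim U + \dim W) -> resM E n := vm.
have vE' z : comb v z = x *m (emb (comb u (lsubmx z)) + comb w' (rsubmx z)) *m invmx x :> 'M[E]_n.
  rewrite mulmxDr mulmxDl emb_comb /comb big_split_ord !mulmx_sumr !mulmx_suml.
  congr (_ + _); apply: eq_bigr => i _.
    by rewrite /v /vm (unsplitK (inl i)) !resM_scaleE mxE -scalemxAr -scalemxAl.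
  by rewrite /v /vm (unsplitK (inr i)) !resM_scaleE mxE -scalemxAr -scalemxAl.
have x_inj X : x *m X *m invmx x = 0 -> X = 0.
  move=> h; rewrite -[X](mulKmx ux) -[x *m X](mulmxK (_ : invmx x \in unitmx)) ?unitmx_inv// h.
  by rewrite mul0mx mulmx0.
rewrite (@det_mod_kerE _ _ _ _ v (block_mx A 0 0 B)).
- by rewrite det_ublock absvM absv_det_B mulr1.
- move=> z; rewrite vE' adTx => /x_inj /eqP; rewrite subr_eq0 G1E => /eqP.
  set Z := emb _ + _ => h.
  (* A kernel element intertwines V th with itself, so it lies in M_n(F) and commutes with V; taking
     traces then removes its component in W. *)
  have [tZ VZ] : tmx Z = Z /\ emb V *m Z = Z *m emb V.
    by apply: twisted_intertwine => //; rewrite -{2}h map_invmx mulmxKV.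
  have Zd : Z *+ d = emb (comb u (lsubmx z)) *+ d.
    by rewrite -tr_fixed// /Z trD comb_W addr0 tr_fixed ?tmx_emb.
  have ZE : Z = emb (comb u (lsubmx z)).
    exact: mulrn_d_inj.
  have r0 : rsubmx z = 0.
    by apply: w'_free; move/eqP: ZE; rewrite /Z eq_sym -subr_eq0 opprD addrA subrr sub0r oppr_eq0 => /eqP.
  have l0 : lsubmx z = 0.
    by apply/u_ker/emb_inj; rewrite !map_mxM -ZE.
  by rewrite -[z]hsubmxK r0 l0 row_mx0.
- move=> X; pose Y : 'M[E]_n := invmx x *m X *m x.
  have dE0 : d%:R != 0 :> E by rewrite -(absv_gt0 vE) vd.
  (* The average of the conjugates of Y is its component in M_n(F), and the remainder has trace
     0. *)
  have teY : tmx (d%:R^-1 *: tr Y) = d%:R^-1 *: tr Y.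
    by rewrite map_mxZ fmorphV rmorph_nat tmx_tr.
  have [Y0 Y0E] := tmx_fixed teY.
  have [Y1 [Z [Y0E' VY1]]] := ker_img Y0.
  have [z1 z1E] := U_comb Z.
  have [|z2 z2E] := @W_comb (Y - emb Y0).
    rewrite trB (tr_fixed (tmx_emb _)) -Y0E -[X in _ - X]scaler_nat scalerA mulfV// scale1r subrr//.
  exists (row_mx z1 z2).
  have -> : X - comb v (row_mx z1 z2) = x *m emb Y1 *m invmx x :> 'M[E]_n.
    rewrite vE' row_mxKl row_mxKr -z2E -z1E.
    have -> : X = x *m Y *m invmx x :> 'M[E]_n by rewrite /Y !mulmxA mulmxV// mul1mx mulmxK.
    rewrite -mulmxBl -mulmxBr; congr (_ *m _ *m _).
    rewrite Y0E' map_mxD; set a := emb Y1; set b := emb _.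
    by rewrite [b + _]addrCA opprD addrA subrr sub0r opprB addrK.
  rewrite adTx -emb_f.
  by have := f_comm (commX 1 VY1) => ->; rewrite subrr mulmx0 mul0mx.
- move=> z; rewrite vE' adTx vE'; congr (_ *m _ *m _).
  have GD (P Q : 'M[E]_n) : G 1 (P + Q) - (P + Q) = (G 1 P - P) + (G 1 Q - Q).
    by rewrite !G1E map_mxD mulmxDr mulmxDl opprD addrACA.
  rewrite GD -emb_f -map_mxB -adE ad_comb -g1E g1_comb -{3 4}[z]hsubmxK mul_row_block.
  by rewrite !mulmx0 addr0 add0r row_mxKl row_mxKr.
Qed.

Lemma discriminant_eq (y : 'M[F]_n) (gamma : GL vF n) (x : 'M[E]_n) (delta : GL vE n) :
  y \in unitmx -> mxGL gamma = y *m V ^+ d *m invmx y ->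
  x \in unitmx -> mxGL delta = x *m emb V *m invmx (tmx x) ->
  D_F gamma = D_twisted vF th delta.
Proof.
by move=> uy gE ux dE; rewrite /D_F /D_twisted (det_mod_ker_adF uy gE) (det_mod_ker_ad_twisted ux dE).
Qed.

End Comparison.
End TwistedDiscriminant.

(** * Twisted conjugacy *)

Section AutomorphismIsometry.
Variables (R : realType) (F : fieldType) (vF : absval R F) (lfF : local_field vF).
Variables (E : fieldExtType F) (vE : absval R E) (vEP : normalized_extension vF vE).
Variable th : {rmorphism E -> E}.
Hypothesis th_alg : forall a : F, th a%:A = a%:A.

(** th is F-linear, hence bounded. Applying the bound to all powers removes the constant, and the
    inverse of x gives the opposite inequality. *)
Lemma absv_aut x : vE (th x) = vE x.
Proof.
have [C C0 hC] := absv_coord_le lfF vEP.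
pose B := \sum_(i < \dim {:E}) vE (th (vbasis {:E})`_i).
have B0 : 0 <= B by apply: sumr_ge0 => i _; exact: absv_ge0.
have thB y : vE (th y) <= B * (C * vE y).
  rewrite {1}(coord_vbasis (memvf y)) rmorph_sum; apply: absv_sum => [|i _].
    by rewrite mulr_ge0// mulr_ge0 ?absv_ge0// ltW.
  rewrite -mulr_algl rmorphM/= th_alg absvM vEP mulrC ler_pM ?exprn_ge0 ?absv_ge0//.
  by rewrite /B (bigD1 i)//= lerDl sumr_ge0// => j _; exact: absv_ge0.
have th_le y : vE (th y) <= vE y.
  have [->|y0] := eqVneq y 0; first by rewrite rmorph0.
  have vy0 : 0 < vE y by rewrite absv_gt0.
  rewrite -[leRHS]mul1r -ler_pdivrMr//.
  apply: (@bounded_powers_le1 _ _ (B * C)) => [|k]; first by rewrite divr_ge0 ?absv_ge0.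
  by rewrite expr_div_n ler_pdivrMr ?exprn_gt0// -mulrA -!absvX -rmorphXn thB.
apply/le_anti; rewrite th_le/=; have [->|x0] := eqVneq x 0; first by rewrite rmorph0.
have := th_le x^-1; rewrite fmorphV !absvV lef_pV2// posrE absv_gt0//.
by rewrite fmorph_eq0.
Qed.
End AutomorphismIsometry.

Section CyclicGalois.
Variables (F : fieldType) (E : splittingFieldType F) (d : nat) (dP : \dim {:E} = d).
Hypothesis galEF : galois 1%VS {:E}.
Variable theta : gal_of {:E}.
Hypothesis thetaP : generator 'Gal({:E} / 1%VS)%g theta.

Lemma gal_alg a : theta a%:A = a%:A.
Proof.
have th1 : theta \in 'Gal({:E} / 1%VS)%g by rewrite (eqP thetaP) cycle_id.
by apply: (fixed_gal (sub1v _) th1); apply: rpredZ; rewrite mem1v.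
Qed.

Lemma gal_order : #[theta]%g = d.
Proof.
by rewrite orderE -(eqP thetaP) -(galois_dim galEF) dimv1 divn1.
Qed.

Lemma gal_iter k x : iter k theta x = (theta ^+ k)%g x.
Proof.
elim: k => [|k IH]; first by rewrite expg0 gal_id.
by rewrite iterS IH expgSr galM ?memvf.
Qed.

Lemma gal_iter_d x : iter d theta x = x.
Proof. by rewrite gal_iter -gal_order expg_order gal_id. Qed.

Lemma gal_fixed x : theta x = x -> exists a : F, x = a%:A.
Proof.
move=> tx; have : x \in fixedField 'Gal({:E} / 1%VS)%g.
  apply/fixedFieldP; first exact: memvf.
  move=> y; rewrite (eqP thetaP) => /cycleP[i ->].
  by rewrite -gal_iter; elim: i => //= i ->.
by rewrite (galois_fixedField galEF) => /vlineP.
Qed.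

(** Dedekind's independence of automorphisms. The powers theta^i with i < d are distinct, so after
    grouping the coefficients by automorphism the identity still carries c 0. *)
Lemma gal_indep (c : nat -> E) : c 0%N != 0 -> exists a, \sum_(i < d) c i * iter i theta a != 0.
Proof.
move=> c0; have d_gt0 : (0 < d)%N by rewrite -gal_order order_gt0.
pose c' (y : gal_of {:E}) := \sum_(i < d | (theta ^+ i)%g == y) c i.
have c1 : c' 1%g != 0.
  rewrite /c' (big_pred1 (Ordinal d_gt0))// => i /=.
  rewrite -(expg0 theta) eq_expg_mod_order gal_order mod0n modn_small//.
have [||a _ ha] := @gal_independent_contra _ _ {:E} predT c' 1%g => //.
exists a; apply: contra ha => /eqP h; apply/eqP; rewrite -[RHS]h.
rewrite (partition_big (fun i : 'I_d => (theta ^+ i)%g) predT)//=.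
apply: eq_bigr => y _; rewrite mulr_suml; apply: eq_bigr => i /eqP <-.
by rewrite gal_iter.
Qed.
End CyclicGalois.

Section TwistedConjugacy.
Variables (R : realType) (F : fieldType) (vF : absval R F).
Variables (E : splittingFieldType F) (vE : absval R E) (lfE : local_field vE).
Variables (th : {rmorphism E -> E}) (n p : nat).
Local Notation d := (\dim {:E}).
Local Notation emb := (map_mx (in_alg E)).
Local Notation tmx := (map_mx th).
Hypotheses (th_alg : forall a : F, th a%:A = a%:A) (th_d : forall x, iter d th x = x)
  (th_fix : forall x, th x = x -> exists a : F, x = a%:A)
  (v_th : forall x, vE (th x) = vE x)
  (th_indep : forall c : nat -> E, c 0%N != 0 -> exists a, \sum_(i < d) c i * iter i th a != 0).
Hypotheses (p_prime : prime p) (vp1 : vE p%:R < 1) (pd : ~~ (p %| d)%N).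
Variables (Fbar : closedFieldType) (iota : {rmorphism E -> Fbar}).
Hypothesis char0 : forall k, k.+1%:R != 0 :> Fbar.
Variable rho : R.
Hypotheses (rho_gt0 : 0 < rho) (rho1 : rho < 1).
Local Notation near1 := (close1 vE rho).
Local Notation near1F V := (close1 vE rho (emb V)).

Let char0E k : k.+1%:R != 0 :> E.
Proof. by rewrite -(fmorph_eq0 iota) rmorph_nat char0. Qed.

Let vd : vE d%:R = 1. Proof. exact: (absv_prime_to_p p_prime vp1 pd). Qed.

Let intertwine (M M' X : 'M[E]_n) : near1 M -> near1 M' ->
  X *m M ^+ d = M' ^+ d *m X -> X *m M = M' *m X.
Proof. exact: (near1_root_intertwine rho_gt0 rho1 p_prime vp1 pd). Qed.

Let twist (V V' : 'M[F]_n) (Z : 'M[E]_n) : near1F V -> near1F V' ->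
  emb V *m tmx Z = Z *m emb V' -> tmx Z = Z /\ emb V *m Z = Z *m emb V'.
Proof. exact: (twisted_intertwine th_alg th_d rho1 intertwine). Qed.

Let tmx_close (X : 'M[E]_n) : near1 X -> near1 (tmx X).
Proof. exact: close1_map. Qed.

(** The root is unique in the ball, hence fixed by th and defined over F. *)
Lemma near1_root_fixed (N : 'M[F]_n) : near1F N -> exists2 V : 'M[F]_n, near1F V & V ^+ d = N.
Proof.
move=> N1; have [M M1 MN] := near1_root lfE rho_gt0 rho1 p_prime vp1 pd N1.
have tM : tmx M = M.
  apply: (near1_root_inj rho_gt0 rho1 p_prime vp1 pd) => //; first exact: tmx_close.
  by rewrite -rmorphXn /= MN (tmx_emb th_alg).
have [V MV] := tmx_fixed th_fix tM; exists V; first by rewrite -MV.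
by apply: (@emb_inj F E); rewrite embX -MV.
Qed.

Let norm_root_commute (X M : 'M[E]_n) : near1 M -> norm_prod th d X = M ^+ d -> X *m tmx M = M *m X.
Proof.
move=> M1 XM; apply: intertwine => //; first exact: tmx_close.
by rewrite -rmorphXn -XM /= norm_prod_d_commute.
Qed.

(** With M the d-th root of the norm of X, the cocycle M^-1 X lies in the ball again, and so does
    its averaged trivialization: the twisted conjugation takes place inside K. *)
Lemma near1_twisted_conj (X : 'M[E]_n) : near1 X -> exists x (V : 'M[F]_n),
  [/\ near1 x, near1F V & X = x *m emb V *m invmx (tmx x)].
Proof.
move=> X1; have N1 := close1_norm_prod rho1 v_th d X1.
have [M M1 MN] := near1_root lfE rho_gt0 rho1 p_prime vp1 pd N1.
have uM := near1_unit rho1 M1.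
have [A1 AE] := twisted_jordan uM (norm_root_commute M1 (esym MN)) (esym MN).
have [|x x1 xA] := hilbert90_near1 rho1 v_th vd _ A1.
  by apply: (near1M rho1) => //; exact: (near1V rho1).
have ux := near1_unit rho1 x1; have [tV XE] := AE x ux xA.
have [V VE] := tmx_fixed th_fix tV; exists x, V; split=> //; last by rewrite -VE.
by rewrite -VE; apply: (near1M rho1) => //; apply: (near1M rho1) => //; exact: (near1V rho1).
Qed.

Let norm_conj (x X : 'M[E]_n) : x \in unitmx ->
  norm_prod th d (x *m X *m invmx (tmx x)) = x *m norm_prod th d X *m invmx x.
Proof.
move=> ux; have := norm_prod_conj_d th_d (x := invmx x) X; rewrite unitmx_inv invmxK map_invmx; exact.
Qed.

Let norm_embV (V : 'M[F]_n) : norm_prod th d (emb V) = emb (V ^+ d).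
Proof. by rewrite norm_prod_fixed ?tmx_emb// embX. Qed.

Let iotaF : {rmorphism F -> Fbar} := iota \o in_alg E.
Let map_iotaF (X : 'M[F]_n) : map_mx iotaF X = map_mx iota (emb X).
Proof. by rewrite -map_mx_comp. Qed.

(** A twisted conjugate of delta in K makes delta twisted conjugate to a V over F in the ball. Then
    gamma is similar over Fbar to V^d, hence similar over F. So a nonzero integrand on the twisted
    side forces one on the other side. *)
Lemma near1_twisted_norm (gamma : 'M[F]_n) (delta g : 'M[E]_n) (u : 'M[Fbar]_n) :
  delta \in unitmx -> g \in unitmx -> u \in unitmx ->
  map_mx iota (emb gamma) = invmx u *m map_mx iota (norm_prod th d delta) *m u ->
  near1 (invmx g *m delta *m tmx g) ->
  exists2 h, h \in unitmx & near1F (invmx h *m gamma *m h).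
Proof.
move=> ud ug uu gE /near1_twisted_conj[x [V [x1 V1 XE]]]; have ux := near1_unit rho1 x1.
have utg : tmx g \in unitmx by rewrite map_unitmx.
have dE : delta = g *m x *m emb V *m invmx (tmx (g *m x)).
  rewrite map_mxM invmx_mul ?map_unitmx//.
  have -> : g *m x *m emb V *m (invmx (tmx x) *m invmx (tmx g)) =
     g *m (x *m emb V *m invmx (tmx x)) *m invmx (tmx g) by rewrite !mulmxA.
  by rewrite -XE !mulmxA mulmxV// mul1mx mulmxK.
have ugx : g *m x \in unitmx by rewrite unitmx_mul ug.
have Nd : norm_prod th d delta = g *m x *m emb (V ^+ d) *m invmx (g *m x).
  by rewrite dE norm_conj// norm_embV.
pose z : 'M[Fbar]_n := invmx (map_mx iota (g *m x)) *m u.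
have ugx' : map_mx iota (g *m x) \in unitmx by rewrite map_unitmx.
have uz : z \in unitmx by rewrite unitmx_mul unitmx_inv ugx'.
have zE : z *m map_mx iotaF gamma = map_mx iotaF (V ^+ d) *m z.
  rewrite !map_iotaF gE Nd 2!map_mxM map_invmx /z.
  by rewrite !mulmxA mulmxK// mulVmx// mul1mx.
have [y uy yE] := similar_descent char0 uz zE.
exists (invmx y); rewrite ?unitmx_inv// invmxK yE mulmxK//.
by rewrite embX; exact: (near1X rho_gt0 rho1).
Qed.

(** Similarity of the norm of delta with V^d descends to E, so delta may be replaced by an X of norm
    exactly V^d. Hilbert 90 makes X twisted conjugate to a V' over F that is similar to V over E; a
    similarity s over F, fixed by th, replaces V' by V. *)
Lemma twisted_normal_form (gamma y V : 'M[F]_n) (delta : 'M[E]_n) (u : 'M[Fbar]_n) :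
  delta \in unitmx -> u \in unitmx -> y \in unitmx -> near1F V ->
  map_mx iota (emb gamma) = invmx u *m map_mx iota (norm_prod th d delta) *m u ->
  gamma = y *m V ^+ d *m invmx y ->
  exists2 x, x \in unitmx & delta = x *m emb V *m invmx (tmx x).
Proof.
move=> ud uu uy V1 gE gV; have uV := near1_unit rho1 V1.
pose z : 'M[Fbar]_n := map_mx iota (emb (invmx y)) *m invmx u.
have uz : z \in unitmx by rewrite unitmx_mul !map_unitmx !unitmx_inv uy.
have zE : z *m map_mx iota (norm_prod th d delta) = map_mx iota (emb (V ^+ d)) *m z.
  have -> : V ^+ d = invmx y *m gamma *m y by rewrite gV !mulmxA mulVmx// mul1mx mulmxKV.
  rewrite 4!map_mxM gE /z !map_invmx.
  by rewrite !mulmxA !mulmxK ?map_unitmx//.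
have [g' ug' g'E] := similar_descent char0 uz zE; pose g := invmx g'.
have ug : g \in unitmx by rewrite unitmx_inv.
have utg : tmx g \in unitmx by rewrite map_unitmx.
pose X := invmx g *m delta *m tmx g.
have NX : norm_prod th d X = (emb V) ^+ d.
  by rewrite norm_prod_conj_d// /g invmxK g'E -embX mulmxK.
have [A1 AE] := twisted_jordan uV (norm_root_commute V1 NX) NX.
have [x ux xA] := hilbert90 th_d th_indep A1.
have utx : tmx x \in unitmx by rewrite map_unitmx.
have [tV XE] := AE x ux xA; have [V' VE] := tmx_fixed th_fix tV.
have xV : map_mx (in_alg E) V' = invmx x *m emb V *m x by [].
have [||s us sE] := @similar_descent _ _ (in_alg E) n char0E V' V x => //.
  by rewrite xV !mulmxA mulmxV// mul1mx.
have use : emb s \in unitmx by rewrite map_unitmx.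
have V'E : emb V' = invmx (emb s) *m emb V *m emb s.
  by rewrite -mulmxA -map_mxM -sE map_mxM mulKmx.
exists (g *m x *m invmx (emb s)); first by rewrite !unitmx_mul ug ux unitmx_inv.
have -> : delta = g *m X *m invmx (tmx g) by rewrite /X !mulmxA mulmxV// mul1mx mulmxK.
rewrite XE VE V'E -map_invmx !map_mxM !invmx_mul ?unitmx_mul ?map_unitmx ?unitmx_inv ?ux ?ug'//.
by rewrite (tmx_emb th_alg) -[invmx (emb (invmx s))]map_invmx invmxK !mulmxA.
Qed.

Section NormalForm.
Variables (V : 'M[F]_n) (V1 : near1F V).

Lemma commute_root (X : 'M[F]_n) : V ^+ d *m X = X *m V ^+ d <-> V *m X = X *m V.
Proof.
split=> [VX|VX].
  apply: (@emb_inj F E); rewrite !map_mxM; apply/esym/intertwine => //.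
  by rewrite -embX -!map_mxM VX.
by apply/esym/commrX/esym.
Qed.

(** The root W of a^-1 V^d a exists in the ball, and a, which intertwines W^d with V^d, intertwines
    W with V. *)
Lemma near1F_conj_root (a : 'M[F]_n) : a \in unitmx ->
  near1F (invmx a *m V ^+ d *m a) <-> near1F (invmx a *m V *m a).
Proof.
move=> ua; have uae : emb a \in unitmx by rewrite map_unitmx.
have aX k : (invmx a *m V *m a) ^+ k = invmx a *m V ^+ k *m a.
  elim: k => [|k IH]; first by rewrite !expr0 mulmx1 mulVmx.
  by rewrite !exprS IH -[_ * _]/(_ *m _) !mulmxA mulmxK.
split=> [/near1_root_fixed[W W1 WE]|a1]; last by rewrite -aX embX; exact: (near1X rho_gt0 rho1).
have : emb a *m emb W = emb V *m emb a.
  by apply: intertwine => //; rewrite -!embX -!map_mxM WE !mulmxA mulmxV// mul1mx.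
by rewrite -!map_mxM => /emb_inj h; rewrite -mulmxA -h mulKmx.
Qed.

Lemma twisted_commute (Z : 'M[E]_n) :
  emb V *m tmx Z = Z *m emb V <-> exists2 X : 'M[F]_n, Z = emb X & V *m X = X *m V.
Proof.
split=> [/(twist V1 V1)[/(tmx_fixed th_fix)[X ->]] VX|[X -> VX]].
  by exists X => //; apply: (@emb_inj F E); rewrite !map_mxM.
by rewrite tmx_emb// -!map_mxM VX.
Qed.

(** b^-1 V th(b) is k W th(k)^-1 with k in K and W over F. Then b k intertwines V th with W th, so
    it is defined over F and serves as a. *)
Lemma near1_twisted_double_coset (b : 'M[E]_n) : b \in unitmx ->
  near1 (invmx b *m emb V *m tmx b) <->
  exists a k, [/\ a \in unitmx, near1F (invmx a *m V *m a), near1 k & b = emb a *m k].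
Proof.
move=> ub; have utb : tmx b \in unitmx by rewrite map_unitmx.
split=> [/near1_twisted_conj[k [W [k1 W1 XE]]]|[a [k [ua a1 k1 bE]]]]; last first.
  have uk := near1_unit rho1 k1; have uae : emb a \in unitmx by rewrite map_unitmx.
  have -> : invmx b *m emb V *m tmx b = invmx k *m emb (invmx a *m V *m a) *m tmx k.
    by rewrite bE invmx_mul// !map_mxM (tmx_emb th_alg) map_invmx !mulmxA.
  by apply: (near1M rho1); [apply: (near1M rho1) => //; exact: (near1V rho1)|exact: tmx_close].
have uk := near1_unit rho1 k1; have utk : tmx k \in unitmx by rewrite map_unitmx.
have : emb V *m tmx (b *m k) = (b *m k) *m emb W.
  have -> : (b *m k) *m emb W = b *m (k *m emb W *m invmx (tmx k)) *m tmx k.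
    by rewrite !mulmxA mulmxKV.
  by rewrite -XE map_mxM !mulmxA mulmxV// mul1mx.
move=> /(twist V1 W1)[/(tmx_fixed th_fix)[a aE] VW].
have ua : a \in unitmx by rewrite -(map_unitmx (in_alg E)) -aE unitmx_mul ub.
exists a, (invmx k); split=> //; last by rewrite -aE mulmxK.
  suff -> : invmx a *m V *m a = W by [].
  have : V *m a = a *m W by apply: (@emb_inj F E); rewrite !map_mxM -aE.
  by rewrite -mulmxA => ->; rewrite mulKmx.
exact: (near1V rho1).
Qed.

Lemma is_norm_root (gamma : GL vF n) (h : 'M[F]_n) (uV' : emb V \in unitmx) :
  semisimpleF vE iota gamma -> h \in unitmx -> mxGL gamma = h *m V ^+ d *m invmx h ->
  is_norm th iota gamma (mkGL vE uV').
Proof.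
move=> [P uP /(diagonalizable_forLR uP)[D gD]] uh gE.
have d_gt0 : (0 < d)%N by exact: adim_gt0.
pose v := map_mx iota (emb V); have uv : v \in unitmx by rewrite map_unitmx.
pose H := map_mx iota (emb h); have uH : H \in unitmx by rewrite !map_unitmx.
have uvk k : v ^+ k \in unitmx.
  by elim: k => [|k IH]; rewrite ?expr0 ?unitmx1// exprS unitmx_mul uv.
have gV : map_mx iota (mxGL (inclGL vE gamma)) = H *m v ^+ d *m invmx H.
  by rewrite /= gE !map_mxM !map_invmx embX rmorphXn.
pose Q := P *m H; have uQ : Q \in unitmx by rewrite unitmx_mul uP.
have QD : Q *m v ^+ d *m invmx Q = diag_mx D.
  rewrite /Q invmx_mul// !mulmxA -[P *m H *m _]mulmxA -[P *m (_ *m _) *m _]mulmxA -gV gD.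
  by rewrite mxpoly.conjumx ?unitmx_inv// invmxK !mulmxA mulmxV// mul1mx mulmxK.
(* All d components of V are the same v. Conjugating the i-th by v^-i moves the whole product into
   the last place, where Q diagonalizes v^d; the other places become 1. *)
pose g (i : 'I_d) := invmx (v ^+ i) *m invmx Q.
pose t (i : 'I_d) := if i.+1 == d then diag_mx D else 1%:M.
exists g, t; split.
- by move=> i; rewrite unitmx_mul !unitmx_inv uvk.
- move=> i; rewrite /split_comp.
  have -> : mxGL (iter i (@thetaGL _ _ _ vE th n) (mkGL vE uV')) = emb V.
    by elim: (i : nat) => //= k ->; rewrite tmx_emb.
  rewrite /g invmx_mul ?unitmx_inv// !invmxK -/v /t.
  have -> : Q *m v ^+ i *m v *m (invmx (v ^+ ordS i) *m invmx Q) =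
     Q *m (v ^+ i.+1 *m invmx (v ^+ ordS i)) *m invmx Q by rewrite exprSr !mulmxA.
  rewrite /=; case: eqP => [->|/eqP id]; first by rewrite modnn expr0 invmx1 mulmx1 QD.
  by rewrite modn_small ?mulmxV ?mulmx1 ?mulmxV// ltn_neqAle id ltn_ord.
- move=> i; rewrite /t; case: ifP => _; first exact: diag_mx_is_diag.
  exact: scalar_mx_is_diag.
- exists (invmx (invmx P)); first by rewrite !unitmx_inv.
  have -> : \prod_(i < d) t i = diag_mx D.
    case: (d) d_gt0 @t {g QD gV gE} => // k _ t.
    rewrite big_ord_recr/= {2}/t /= eqxx big1 ?mul1r// => i _.
    by rewrite /t /= eqSS ltn_eqF.
  by rewrite gD mxpoly.conjumx ?unitmx_inv// invmxK.
Qed.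

End NormalForm.

Lemma prod_split_comp (delta : GL vE n) :
  \prod_(i < d) split_comp th iota delta i = map_mx iota (norm_prod th d (mxGL delta)).
Proof.
rewrite norm_prodE rmorph_prod; apply: eq_bigr => i _; rewrite /split_comp; congr (map_mx _ _).
by elim: (i : nat) => //= k ->.
Qed.

End TwistedConjugacy.

(** * Volumes in centralizers *)

Section ConjugateBall.
Variables (R : realType) (p : nat) (p_prime : prime p).
Variables (Qp : fieldType) (vp : absval R Qp) (vpP : is_Qp p vp).
Variables (F : fieldExtType Qp) (vF : absval R F) (vFP : normalized_extension vp vF).
Variables (E : fieldExtType F) (vE : absval R E) (vEP : normalized_extension vF vE).
Variables (n r : nat) (lam : {measure set (borel 'rV[valued vF]_r) -> \bar R}).
Hypothesis lamP : additive_haar_measure lam.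
Variables (rho : R) (rho_gt0 : 0 < rho) (rho1 : rho < 1).
Local Notation D := (\dim {:E}).
Implicit Types (w : 'I_r -> resM E n) (g : 'M[E]_n).

Let lfF : local_field vF. Proof. exact: (lf_F p_prime vpP vFP). Qed.

(** Coordinates of the matrices of g rho M_n(O) g^-1 in the span of w, where rho stands for the ball
    of that radius. For w a basis of the Lie algebra of a centralizer S, 1 plus this lattice is S
    \cap g K g^-1. *)
Definition conj_ball w g : set 'rV[F]_r :=
  [set z | mxn vE (invmx g *m (comb w z : 'M[E]_n) *m g) <= rho].

Lemma conj_ball_lattice w g : (forall z, comb w z = 0 -> z = 0) -> g \in unitmx ->
  lattice vF (conj_ball w g).
Proof.
move=> w_free ug; have [C1 C10 hC1] := comb_le vEP w.
have [C2 C20 hC2] := comb_ge lfF vEP w_free.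
have D_gt0 : (0 < D)%N by exact: adim_gt0.
have c0 : comb w 0 = 0 by rewrite /comb big1// => j _; rewrite mxE scale0r.
split.
- by rewrite /conj_ball /= c0 mulmx0 mul0mx mxn0 ltW.
- by move=> x y xS yS; rewrite /conj_ball /= combB mulmxBr mulmxBl mxnB_le.
- pose B := 1 + mxn vE (invmx g) * C1 * mxn vE g.
  have B0 : 0 < B by rewrite ltr_wpDr// !mulr_ge0 ?mxn_ge0// ltW.
  exists (Num.min 1 (rho / B)) => [|z]; first by rewrite lt_min ltr01 divr_gt0.
  rewrite le_min => /andP[z1 zr]; rewrite /conj_ball /=.
  rewrite (le_trans (mxnM _ _ _))// (le_trans (ler_wpM2r (mxn_ge0 _ _) (mxnM _ _ _)))//.
  apply: (@le_trans _ _ (B * mxn vF z)); last by rewrite mulrC -ler_pdivlMr.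
  apply: (@le_trans _ _ (mxn vE (invmx g) * (C1 * mxn vF z) * mxn vE g)).
    rewrite ler_wpM2r ?mxn_ge0// ler_wpM2l ?mxn_ge0// (le_trans (hC1 _))//.
    by rewrite ler_wpM2l ?(ltW C10)// ler_iXnr ?mxn_ge0.
  have -> : mxn vE (invmx g) * (C1 * mxn vF z) * mxn vE g =
     (mxn vE (invmx g) * C1 * mxn vE g) * mxn vF z by ring.
  by rewrite ler_wpM2r ?mxn_ge0// lerDr.
- pose M := C2 * (mxn vE g * rho * mxn vE (invmx g)).
  exists (Num.max 1 M) => z zS; rewrite le_max; have [//|/ltW z1/=] := leP (mxn vF z) 1.
  apply: (@le_trans _ _ (mxn vF z ^+ D)); first by rewrite ler_eXnr.
  rewrite (le_trans (hC2 _))// ler_wpM2l ?(ltW C20)//.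
  have -> : (comb w z : 'M[E]_n) = g *m (invmx g *m (comb w z : 'M[E]_n) *m g) *m invmx g.
    by rewrite !mulmxA mulmxV// mul1mx mulmxK.
  rewrite (le_trans (mxnM _ _ _))// ler_wpM2r ?mxn_ge0// (le_trans (mxnM _ _ _))//.
  by rewrite ler_wpM2l ?mxn_ge0.
Qed.

Lemma lam_conj_ball w w' g (Q : 'M[F]_r) : (forall z, comb w z = 0 -> z = 0) ->
  g \in unitmx -> Q \in unitmx -> (forall i, w i = \sum_j Q i j *: w' j) ->
  lam (conj_ball w' g) = ((vF (\det Q))%:E * lam (conj_ball w g))%E.
Proof.
move=> w_free ug uQ wQ.
have -> : conj_ball w' g = mulmx_set Q (conj_ball w g).
  apply/seteqP; split=> z; rewrite /conj_ball /=.
    move=> zS; exists (z *m invmx Q); last by rewrite mulmxKV.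
    by rewrite /= (combM _ wQ) mulmxKV.
  by move=> [t tS <-]; rewrite -(combM _ wQ).
by rewrite (lattice_det p_prime vpP vFP lamP)//; exact: conj_ball_lattice.
Qed.

(* Left multiplication by an element of the ball around 1 preserves the lattice [conj_ball w g],
   so its determinant has absolute value 1. *)
Lemma absv_det_near1 w g (a : 'M[E]_n) (L : 'M[F]_r) : (forall z, comb w z = 0 -> z = 0) ->
  g \in unitmx -> close1 vE rho (invmx g *m a *m g) ->
  (forall t, (comb w (t *m L) : 'M[E]_n) = a *m (comb w t : 'M[E]_n)) -> vF (\det L) = 1.
Proof.
move=> w_free ug a1 aL; set A := invmx g *m a *m g in a1.
have uA := near1_unit rho1 a1.
have ua : a \in unitmx.
  by move: uA; rewrite !unitmx_mul unitmx_inv ug andbT.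
have aLg t : invmx g *m (comb w (t *m L) : 'M[E]_n) *m g =
    A *m (invmx g *m (comb w t : 'M[E]_n) *m g).
  by rewrite aL /A !mulmxA mulmxK.
have uL : L \in unitmx.
  rewrite -row_free_unit -kermx_eq0; apply/eqP/row_matrixP => i; rewrite row0.
  apply: w_free; apply: (can_inj (mulKmx ua)); rewrite -aL -row_mul mulmx_ker row0 mulmx0.
  by rewrite /comb big1// => j _; rewrite mxE scale0r.
have lS := conj_ball_lattice w_free ug.
have := lattice_det p_prime vpP vFP lamP lS uL.
have -> : mulmx_set L (conj_ball w g) = conj_ball w g.
  apply/seteqP; split=> [_ [t tS <-]|z zS].
    by rewrite /conj_ball /= aLg -[leRHS]mul1r mxn_mul_le// (near1_le1 rho1).
  exists (z *m invmx L); last by rewrite mulmxKV.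
  rewrite /conj_ball /=; set X := invmx g *m _ *m g.
  have -> : X = invmx A *m (invmx g *m (comb w z : 'M[E]_n) *m g).
    by rewrite -[in RHS](mulmxKV uL z) aLg mulKmx.
  by rewrite -[leRHS]mul1r mxn_mul_le// (near1_le1 rho1)//; exact: (near1V rho1).
rewrite -(lattice_fine lfF lamP lS) -EFinM => -[] h.
by apply: (mulIf (lt0r_neq0 (lattice_fine_gt0 lfF lamP lS))); rewrite -h mul1r.
Qed.

(** The coordinates of the group elements form the translate of a lattice by the coordinates z1 of
    1, and the invariant density is 1 there by [absv_det_near1]. Embedding and product are left
    abstract to serve both centralizers. *)
Lemma form_measure_ball (V : vectType F) (mulV : V -> V -> V) (K : fieldType) (v : absval R K)
    (l : nat) (emb : GL v l -> V) (b : r.-tuple V) (B : set (GL v l)) w g (z1 : 'rV[F]_r) :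
  (forall z, comb w z = 0 -> z = 0) -> g \in unitmx ->
  (forall x, (emb @` B) (comb (fun i : 'I_r => b`_i) x) <->
     close1 vE rho (invmx g *m (comb w x : 'M[E]_n) *m g)) ->
  (forall x t, (comb w (t *m \matrix_(i, j) coord b j (mulV (comb (fun i : 'I_r => b`_i) x) b`_i))
     : 'M[E]_n) = (comb w x : 'M[E]_n) *m (comb w t : 'M[E]_n)) ->
  (comb w z1 : 'M[E]_n) = 1%:M ->
  form_measure mulV emb b lam B = lam (conj_ball w g).
Proof.
move=> w_free ug hB hmul z1E; rewrite /form_measure.
have lS := conj_ball_lattice w_free ug.
have -> : [set x : 'rV[valued vF]_r | (emb @` B) (\sum_(i < r) (x 0 i : F) *: b`_i)] =
    [set z1 + z | z in conj_ball w g].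
  have hS z : close1 vE rho (invmx g *m (comb w z : 'M[E]_n) *m g) <-> conj_ball w g (z - z1).
    rewrite /close1 /conj_ball /= combB z1E mulmxBr mulmxBl mulmx1 mulVmx//.
  apply/seteqP; split=> [x /hB /hS xS|_ [z zS <-]].
    by exists (x - z1) => //; rewrite addrC subrK.
  by apply/hB/hS; rewrite addrC addKr.
rewrite (eq_integral (cst 1%E)) => [|x]; last first.
  rewrite inE => -[z zS <-]; rewrite /det_lmul.
  rewrite (@absv_det_near1 w g (comb w (z1 + z) : 'M[E]_n)) ?invr1//.
    by rewrite /close1 combD z1E mulmxDr mulmxDl mulmx1 mulVmx// addrC addKr.
  exact: (hmul (z1 + z)).
have oS := lattice_open lS.
rewrite integral_cst ?mul1e; last by apply: measurable_open; exact: translate_open.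
exact: lam_translate.
Qed.
End ConjugateBall.

(** * Double cosets *)

Lemma measurable_closed (T : ptopologicalType) (U : set T) :
  closed U -> measurable (U : set (borel T)).
Proof.
move=> cU; have oU : open (~` U) by rewrite openC.
by rewrite -[U]setCK; apply: measurableC; exact: measurable_open.
Qed.

Section GLTopology.
Variables (R : realType) (K : fieldType) (v : absval R K) (lf : local_field v) (n : nat).
Variables (rho : R) (rho_gt0 : 0 < rho) (rho1 : rho < 1).
Local Notation G := (GL v n).

Definition ball1 : set G := [set g | close1 v rho (mxGL g)].

Lemma ball1M g h : ball1 g -> ball1 h -> ball1 (g * h)%g.
Proof. exact: (near1M rho1). Qed.

Lemma ball1V g : ball1 g -> ball1 (g^-1)%g.
Proof. exact: (near1V rho1). Qed.

Let small (a b : 'M[K]_n) : exists2 e : R, 0 < e & forall X, mxn v X < e -> mxn v (a *m X *m b) <= rho.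
Proof.
pose B := 1 + mxn v a * mxn v b.
have B0 : 0 < B by rewrite ltr_wpDr// mulr_ge0 ?mxn_ge0.
exists (rho / B) => [|X]; first exact: divr_gt0.
rewrite ltr_pdivlMr// => /ltW; apply: le_trans.
rewrite (le_trans (mxnM _ _ _))// (le_trans (ler_wpM2r (mxn_ge0 _ _) (mxnM _ _ _)))//.
by rewrite mulrAC mulrC ler_wpM2l ?mxn_ge0// lerDr.
Qed.

(** A contains, with g, the neighbourhood g U of g. *)
Lemma open_right_invariant (A : set G) :
  (forall g u, A g -> ball1 u -> A (g * u)%g) -> open A.
Proof.
move=> Ainv; apply/open_GLP => g Ag.
have [e e0 he] := small (invmx (mxGL g)) 1%:M; exists e => // h hg.
rewrite -(mulKVg g h); apply: Ainv => //; rewrite /ball1 /close1 /=.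
have -> : invmx (mxGL g) *m mxGL h - 1%:M = invmx (mxGL g) *m (mxGL h - mxGL g) *m 1%:M.
  by rewrite mulmx1 mulmxBr mulVmx// mxGL_unit.
exact: he.
Qed.

Lemma open_mul_ball1 (a b : G) : open [set h | ball1 (a * h * b)%g].
Proof.
apply/open_GLP => g Ag; have [e e0 he] := small (mxGL a) (mxGL b).
exists e => // h hg; rewrite /= /ball1 /= /close1.
have -> : mxGL (a * h * b)%g - 1%:M =
    mxGL a *m (mxGL h - mxGL g) *m mxGL b + (mxGL (a * g * b)%g - 1%:M).
  by rewrite mulmxBr mulmxBl addrA subrK.
by apply: mxnD_le; [exact: he|exact: Ag].
Qed.

(** Meant for the centralizers, which are zero sets of commutators, twisted or not. *)
Lemma closed_Lipschitz (Phi : 'M[K]_n -> 'M[K]_n) (C : R) :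
  (forall X Y, mxn v (Phi X - Phi Y) <= C * mxn v (X - Y)) ->
  closed [set g : G | Phi (mxGL g) = 0].
Proof.
move=> hPhi; rewrite -openC; apply/open_GLP => g /= g0.
have g1 : 0 < mxn v (Phi (mxGL g)).
  by rewrite lt_def mxn_ge0 andbT; apply: contra_notN g0 => /eqP h; apply/(mxn_eq0 (v := v)); rewrite h.
have C0 : 0 < 1 + `|C| by rewrite ltr_wpDr.
exists (mxn v (Phi (mxGL g)) / (1 + `|C|)) => [|h]; first exact: divr_gt0.
rewrite ltr_pdivlMr// => hg h0; have := hPhi (mxGL h) (mxGL g).
rewrite h0 sub0r mxnN leNgt => /negP; apply; apply: le_lt_trans hg.
by rewrite mulrC ler_wpM2l ?mxn_ge0// (le_trans (ler_norm C))// lerDr.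
Qed.

Lemma compact_ball1 : compact ball1.
Proof.
apply: compact_GL; apply: (subclosed_compact _ (lf_compact_mx (m := n) (n := n) lf (e := 1))).
  have -> : [set mxGL g | g in ball1] = [set A : 'M[K]_n | mxn v (A - 1%:M) <= rho].
    apply/seteqP; split=> [_ [g g1 <-]//|A A1].
    by exists (mkGL v (near1_unit rho1 A1)).
  exact: (@closed_mx_ball R K v n n 1%:M rho (ltW rho_gt0)).
by move=> _ [g g1 <-]; exact: (near1_le1 rho1 g1).
Qed.

Lemma ball1_cover : exists u : nat -> G, forall g, exists j, ball1 (g^-1 * u j)%g.
Proof.
have [a ha] := lf_dense_mx lf n n.
(* Singular terms of the dense sequence are replaced by 1; a term close enough to g is invertible,
   so they are never selected. *)
have /choice[u uE] : forall j, exists u : G, a j \in unitmx -> mxGL u = a j.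
  move=> j; have [uj|_] := boolP (a j \in unitmx); last by exists 1%g.
  by exists (mkGL v uj).
exists u => g; have [e e0 he] := small (invmx (mxGL g)) 1%:M.
have [j] := ha (mxGL g) e e0; rewrite mxnC => /he; rewrite mulmx1 mulmxBr mulVmx ?mxGL_unit// => aj.
have uj : a j \in unitmx.
  by have := near1_unit rho1 aj; rewrite unitmx_mul unitmx_inv mxGL_unit.
by exists j; rewrite /ball1 /close1 /= uE.
Qed.

Let translE (g : G) (A : set G) : [set (g * x)%g | x in A] = [set h | A (g^-1 * h)%g].
Proof.
apply/seteqP; split=> [_ [x Ax <-] /=|h Ah]; first by rewrite mulKg.
by exists (g^-1 * h)%g; rewrite ?mulKVg.
Qed.

(** Countably many translates of the ball cover the group, so it is not null; it is compact, so its
    mass is finite. *)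
Lemma haar_ball1 (mu : {measure set (borel G) -> \bar R}) : haar_measure setT mu ->
  (0 < mu ball1)%E /\ (mu ball1 < +oo)%E.
Proof.
move=> [_ mu0 mufin mutr]; split; last by apply: mufin => //; exact: compact_ball1.
have oB : open ball1 by apply: open_right_invariant => g u; exact: ball1M.
rewrite lt0e measure_ge0 andbT; apply/eqP => B0.
have [u hu] := ball1_cover.
have mB j : measurable ([set (u j * x)%g | x in ball1] : set (borel G)).
  apply: measurable_open; rewrite translE; apply: open_right_invariant => g w /= gB Bw.
  by rewrite mulgA; exact: ball1M.
have : (mu setT <= \sum_(0 <= j <oo) mu [set (u j * x)%g | x in ball1])%E.
  apply: measure_sigma_subadditive => // g _; have [j jg] := hu g; exists j => //.
  by rewrite translE /= -[(_ * _)%g]invgK invMg invgK; exact: ball1V.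
rewrite eseries0 => [|j _ _]; last by rewrite mutr//; exact: measurable_open.
by rewrite leNgt mu0.
Qed.

End GLTopology.

(** * Double cosets in a quotient by a closed subgroup *)

Section QuotientDoubleCoset.
Variables (R : realType) (K : fieldType) (v : absval R K) (lf : local_field v) (n : nat).
Variables (rho : R) (rho_gt0 : 0 < rho) (rho1 : rho < 1).
Local Notation G := (GL v n).
Local Notation U := (@ball1 R K v n rho).
Variables (S : set G) (dg ds : {measure set (borel G) -> \bar R}).
Variable nu : {measure set (borel (coset_space S)) -> \bar R}.
Hypotheses (dgP : haar_measure setT dg) (dsP : haar_measure S ds).
Hypotheses (nuP : quotient_measure dg ds nu) (S_closed : closed S).
Hypotheses (S1 : S 1%g) (SM : forall s t, S s -> S t -> S (s * t)%g)
  (SV : forall s, S s -> S (s^-1)%g).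

Definition double_coset (a : G) : set G := [set g | exists s u, [/\ S s, U u & g = (s * a * u)%g]].

Let coset_rep_spec g : exists2 s, S s & coset_rep (coset_proj S g) = (s * g)%g.
Proof.
have : coset_proj S (coset_rep (coset_proj S g)) = coset_proj S g.
  exact: (svalP (cid (coset_rep_subproof (coset_proj S g)))).
move=> /(congr1 sval) /= h; have : rcosetGL S g (coset_rep (coset_proj S g)).
  by rewrite -h; exists 1%g; rewrite // mul1g.
by move=> [s Ss <-]; exists s.
Qed.

(** [coset_rep] is an arbitrary choice, but left invariance under S makes the condition independent
    of it; the preimage in the group is A itself, open by right invariance. *)
Lemma coset_rep_measurable (A : set G) :
  (forall s g, S s -> A g -> A (s * g)%g) -> (forall g u, A g -> U u -> A (g * u)%g) ->
  measurable ([set C | A (coset_rep C)] : set (borel (coset_space S))).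
Proof.
move=> SA AU; apply: measurable_open.
rewrite /open /= /coset_open; have -> : coset_proj S @^-1` [set C | A (coset_rep C)] = A.
  apply/seteqP; split=> g /=; have [s Ss ->] := coset_rep_spec g; last exact: SA.
  by move=> Asg; rewrite -(mulKg s g); apply: SA => //; exact: SV.
exact: (open_right_invariant rho_gt0 AU).
Qed.

Let double_cosetS a s g : S s -> double_coset a g -> double_coset a (s * g)%g.
Proof.
by move=> Ss [t [u [St Uu ->]]]; exists (s * t)%g, u; split=> //; [exact: SM|rewrite !mulgA].
Qed.

Let double_cosetU a g u : double_coset a g -> U u -> double_coset a (g * u)%g.
Proof.
move=> [t [u' [St Uu' ->]]] Uu; exists t, (u' * u)%g; split=> //; last by rewrite !mulgA.
exact: (ball1M rho1).
Qed.

Let translate_measure (g : G) (A : set G) : S g -> measurable (A : set (borel G)) ->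
  ds [set h | A (g^-1 * h)%g] = ds A.
Proof.
move=> Sg mA; have [_ _ _ dsT] := dsP; rewrite -(dsT g A Sg mA); congr (ds _).
apply/seteqP; split=> [h Ah|_ [x Ax <-] /=]; last by rewrite mulKg.
by exists (g^-1 * h)%g; rewrite ?mulKVg.
Qed.

(** The quotient formula is applied to the indicator of a U. At g = s a u the inner integral is the
    volume of the t in S with a^-1 t s a in U, which left translation by s turns into the volume m
    at s a; outside S a U it vanishes. *)
Lemma quotient_double_coset a (m : \bar R) :
  (forall s, S s -> ds (S `&` [set h | U ((s * a)^-1 * h * (s * a))%g]) = m) ->
  dg U = (m * nu [set C | double_coset a (coset_rep C)])%E.
Proof.
move=> am; have [_ _ _ dgT] := dgP.
have oU : open U by apply: (open_right_invariant rho_gt0) => g u; exact: (ball1M rho1).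
have oaU : open [set h : G | U (a^-1 * h)%g].
  apply: (open_right_invariant rho_gt0) => g u /= ag Uu; rewrite mulgA; exact: (ball1M rho1).
pose phi : borel G -> \bar R := fun g => (\1_[set h : G | U (a^-1 * h)%g] g)%:E.
have mS : measurable (S : set (borel G)) by exact: measurable_closed.
have := @nuP phi; rewrite /phi integral_indic; [|exact: measurableT|exact: measurable_open].
rewrite setIT.
have -> : dg [set h : G | U (a^-1 * h)%g] = dg U.
  rewrite -(dgT a U I (measurable_open oU)); congr (dg _).
  apply/seteqP; split=> [h Ah|_ [x Ax <-] /=]; last by rewrite mulKg.
  by exists (a^-1 * h)%g; rewrite ?mulKVg.
move=> ->; last by move=> g; rewrite lee_fin.
  have mD := coset_rep_measurable (double_cosetS (a := a)) (double_cosetU (a := a)).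
  pose psi (C : borel (coset_space S)) : \bar R :=
    (m * (\1_[set C | double_coset a (coset_rep C)] C)%:E)%E.
  rewrite (eq_integral psi) => [|C _].
    rewrite ge0_integralZl ?integral_indic ?setIT//.
    - by apply/measurable_EFinP; exact: measurable_indic.
    - by rewrite -(am _ S1) measure_ge0.
  rewrite (eq_integral (fun s : borel G => (\1_[set h : G | U (a^-1 * h * coset_rep C)%g] s)%:E)).
    rewrite integral_indic//; last by apply: measurable_open; exact: open_mul_ball1.
    rewrite /psi indicE; case: (boolP (C \in _)); rewrite ?inE ?notin_setE.
      move=> [s [u [Ss Uu CE]]]; rewrite mule1 -(am _ Ss).
      rewrite -(translate_measure (SV Ss)); last first.
        by apply: measurableI => //; apply: measurable_open; exact: open_mul_ball1.
      rewrite CE; congr (ds _); apply/seteqP; split=> [t [/= Ut St]|t /= [St Ut]].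
        split; first by rewrite invgK; exact: SM.
        have -> : ((s * a)^-1 * (s^-1^-1 * t) * (s * a) = (a^-1 * t * (s * a * u)) * u^-1)%g.
          by rewrite invMg invgK !mulgA mulgKV mulgK.
        by apply: (ball1M rho1) => //; exact: (ball1V rho1).
      split; last by rewrite -(mulKg s t); apply: (SM (SV Ss)); move: St; rewrite invgK.
      have -> : (a^-1 * t * (s * a * u) = (s * a)^-1 * (s^-1^-1 * t) * (s * a) * u)%g.
        by rewrite invMg invgK !mulgA mulgKV.
      exact: (ball1M rho1).
    move=> nC; rewrite mule0 [X in ds X](_ : _ = set0) ?measure0//.
    apply/seteqP; split=> // s [/= Us Ss]; apply: nC.
    exists (s^-1)%g, (a^-1 * s * coset_rep C)%g; split=> //; first exact: SV.
    by rewrite !mulgA mulgK mulVg mul1g.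
  by move=> s _; rewrite !indicE; congr (_%:R%:E); congr nat_of_bool; apply/idP/idP; rewrite !inE /= mulgA.
by apply/measurable_EFinP/measurable_indic; exact: measurable_open.
Qed.

(** A is the disjoint union of the double cosets S (a j) U, of quotient volume vol(U) / m j, and the
    normalization cancels vol(U). *)
Lemma orbital_sum (A : set G) (J : set nat) (a : nat -> G) (m : nat -> \bar R) :
  (forall g, A g <-> exists2 j, J j & double_coset (a j) g) ->
  (forall i j g, J i -> J j -> double_coset (a i) g -> double_coset (a j) g -> i = j) ->
  (forall j s, J j -> S s -> ds (S `&` [set h | U ((s * a j)^-1 * h * (s * a j))%g]) = m j) ->
  (\int[nu]_C ((fine (dg U))^-1 * \1_A (coset_rep C))%:E =
   \sum_(0 <= j <oo | j \in J) ((fine (m j))^-1)%:E)%E.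
Proof.
move=> AE a_disj am; have [U0 Uoo] := haar_ball1 lf rho_gt0 rho1 dgP.
have mA : measurable ([set C | A (coset_rep C)] : set (borel (coset_space S))).
  apply: coset_rep_measurable => [s g Ss /AE[j Jj jg]|g u /AE[j Jj jg] Uu]; apply/AE; exists j => //.
    exact: double_cosetS.
  exact: double_cosetU.
pose psi (C : borel (coset_space S)) : \bar R :=
  (((fine (dg U))^-1)%:E * (\1_[set C | A (coset_rep C)] C)%:E)%E.
rewrite (eq_integral psi) => [|C _]; last first.
  by rewrite EFinM /psi !indicE; congr (_ * (_ %:R)%:E)%E; congr nat_of_bool; apply/idP/idP; rewrite !inE.
rewrite ge0_integralZl//; last by apply/measurable_EFinP/measurable_indic.
rewrite integral_indic// setIT.
have -> : [set C : coset_space S | A (coset_rep C)] =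
    \bigcup_(j in J) [set C | double_coset (a j) (coset_rep C)].
  by apply/seteqP; split=> C => [/AE|]; [|move=> ?; apply/AE].
rewrite measure_bigcup; first last.
- by move=> i j Ji Jj [C [Ci Cj]]; exact: a_disj Ji Jj Ci Cj.
- by move=> j _; apply: coset_rep_measurable; [exact: double_cosetS|exact: double_cosetU].
rewrite -nneseriesZl//; apply: eq_eseriesr => j; rewrite inE => Jj.
have := @quotient_double_coset (a j) (m j) (fun s => am j s Jj).
have m0 : (0 <= m j)%E by rewrite -(am j _ Jj S1) measure_ge0.
have : (0 <= nu [set C | double_coset (a j) (coset_rep C)])%E by [].
(* The product of m j and the quotient volume is vol(U), finite and positive; hence neither factor
   is 0 or infinite and [fine] loses nothing. *)
move: (nu _) (m j) m0 (dg U) U0 Uoo => x y.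
case: y => [y| |] // y0 [u| |] // u0 _; case: x => [x| |] // x0.
- move=> [uE]; rewrite lte_fin uE in u0 *.
  have /andP[y1 x1] : (y != 0) && (x != 0) by rewrite -negb_or -mulf_eq0 gt_eqF.
  by rewrite -EFinM /= invfM mulfVK.
- by move: y0; rewrite lee_fin le_eqVlt => /orP[/eqP <-|y0];
    [rewrite mul0e => -[uE]; move: u0; rewrite uE ltxx|rewrite gt0_muley].
- by move: x0; rewrite lee_fin le_eqVlt => /orP[/eqP <-|x0];
    [rewrite mule0 => -[uE]; move: u0; rewrite uE ltxx|rewrite gt0_mulye].
Qed.

End QuotientDoubleCoset.

Lemma comb_coord_mx (K : fieldType) (V : vectType K) (U : {vspace V}) r (b : r.-tuple V)
    (f : V -> V) t : basis_of U b -> linear f -> (forall X, X \in U -> f X \in U) ->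
  comb (fun i : 'I_r => b`_i) (t *m \matrix_(i, j) coord b j (f b`_i)) =
  f (comb (fun i : 'I_r => b`_i) t).
Proof.
move=> bU f_lin fU; rewrite -(combM (u := fun i => f b`_i)) => [|i]; last first.
  rewrite {1}(comb_basis bU (fU b`_i _)) ?(basis_mem bU) ?mem_nth ?size_tuple//.
  by apply: eq_bigr => j _; rewrite !mxE.
rewrite -(linfun_linear f_lin) linear_sum; apply: eq_bigr => i _.
by rewrite linearZ /= linfun_linear.
Qed.

(** * Volumes of compact open subgroups of the two centralizers *)

Section Masses.
Variables (R : realType) (p : nat) (p_prime : prime p).
Variables (Qp : fieldType) (vp : absval R Qp) (vpP : is_Qp p vp).
Variables (F : fieldExtType Qp) (vF : absval R F) (vFP : normalized_extension vp vF).
Variables (E : splittingFieldType F) (vE : absval R E) (vEP : normalized_extension vF vE).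
Variables (th : {rmorphism E -> E}) (n : nat).
Local Notation d := (\dim {:E}).
Local Notation emb := (map_mx (in_alg E)).
Local Notation tmx := (map_mx th).
Hypotheses (th_alg : forall a : F, th a%:A = a%:A).
Variables (rho : R) (rho_gt0 : 0 < rho) (rho1 : rho < 1).
Local Notation near1F V := (close1 vE rho (emb V)).
Variables (r : nat) (lam : {measure set (borel 'rV[valued vF]_r) -> \bar R}).
Hypothesis lamP : additive_haar_measure lam.

Lemma lker_adF (gamma : GL vF n) X :
  (X \in lker (adF gamma)) = (mxGL gamma *m X == X *m mxGL gamma).
Proof.
rewrite memv_ker /adF linfun_linear => [|a Y Z]; last first.
  by rewrite mulmxDr mulmxDl -scalemxAr -scalemxAl scalerBr opprD addrACA.
rewrite subr_eq0; apply/eqP/eqP => h; first by rewrite -{2}h mulmxKV ?mxGL_unit.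
by rewrite h mulmxK ?mxGL_unit.
Qed.

Lemma lker_ad_twisted (delta : GL vE n) (X : resM E n) :
  (X \in lker (ad_twisted th delta)) =
  (mxGL delta *m tmx (X : 'M[E]_n) == (X : 'M[E]_n) *m mxGL delta).
Proof.
rewrite memv_ker /ad_twisted linfun_linear => [|a Y Z]; last first.
  rewrite !resM_scaleE map_mxD map_mxZ th_alg.
  by rewrite mulmxDr mulmxDl -scalemxAr -scalemxAl scalerBr opprD addrACA.
rewrite subr_eq0; apply/eqP/eqP => h; first by rewrite -{2}h mulmxKV ?mxGL_unit.
by rewrite h mulmxK ?mxGL_unit.
Qed.

(** The ball condition already forces invertibility, so the intersection with the centralizer is all
    of 1 plus the lattice in the Lie algebra. *)
Lemma form_measure_centralizerF (gamma g : GL vF n) (c : r.-tuple 'M[F]_n) :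
  basis_of (lker (adF gamma)) c ->
  form_measure (fun X Y : 'M[F]_n => X *m Y) (fun h : GL vF n => mxGL h) c lam
    (centralizerF gamma `&` [set h | near1F (mxGL (g^-1 * h * g)%g)]) =
  lam (conj_ball vE rho (fun i => emb c`_i : resM E n) (emb (mxGL g))).
Proof.
move=> cP; pose c' (i : 'I_r) := c`_i; pose w (i : 'I_r) : resM E n := emb (c' i).
have ug : emb (mxGL g) \in unitmx by rewrite map_unitmx mxGL_unit.
have wE z : (comb w z : 'M[E]_n) = emb (comb c' z).
  by rewrite /comb raddf_sum; apply: eq_bigr => i _; rewrite /= map_mxZ.
have cU z : mxGL gamma *m comb c' z = comb c' z *m mxGL gamma.
  by apply/eqP; rewrite -lker_adF; exact: comb_mem.
have [z1 z1E] : exists z1, 1%:M = comb c' z1.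
  eexists; apply: (comb_basis cP); rewrite lker_adF mulmx1 mul1mx//.
rewrite (form_measure_ball p_prime vpP vFP vEP lamP rho_gt0 rho1 (w := w) (g := emb (mxGL g)) (z1 := z1))//.
- move=> z wz; have : (comb w z : 'M[E]_n) = 0 := wz.
  by rewrite wE => h; apply/(comb_free cP)/(@emb_inj F E); rewrite h map_mx0.
- move=> x; rewrite wE -map_invmx -!map_mxM; split=> [[h [_ hg] hx]|xg].
    by move: hg; rewrite /= -[X in _ -> close1 _ _ (emb (_ *m X *m _))]hx.
  have := near1_unit rho1 xg; rewrite map_unitmx !unitmx_mul unitmx_inv mxGL_unit/= andbT => ux.
  exists (mkGL vF ux) => //; split=> //.
  by apply: mxGL_inj; rewrite /= -mulmxA cU mulmxA mulVmx// mul1mx.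
- move=> x t; rewrite !wE -map_mxM; congr (emb _).
  apply: (comb_coord_mx t cP (f := fun X => comb c' x *m X)) => [e Y Z|X].
    by rewrite mulmxDr -scalemxAr.
  by rewrite !lker_adF mulmxA cU -!mulmxA => /eqP ->.
- by rewrite wE -z1E map_mx1.
Qed.

Lemma form_measure_centralizer_twisted (delta g : GL vE n) (b : r.-tuple (resM E n)) :
  basis_of (lker (ad_twisted th delta)) b ->
  form_measure (fun X Y : resM E n => (X : 'M[E]_n) *m Y : resM E n)
    (fun g : GL vE n => mxGL g : resM E n) b lam
    (twisted_centralizer th delta `&` [set h | close1 vE rho (mxGL (g^-1 * h * g)%g)]) =
  lam (conj_ball vE rho (fun i => b`_i) (mxGL g)).
Proof.
move=> bP; pose b' (i : 'I_r) := b`_i.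
have bU z : mxGL delta *m tmx (comb b' z : 'M[E]_n) = (comb b' z : 'M[E]_n) *m mxGL delta.
  by apply/eqP; rewrite -lker_ad_twisted; exact: comb_mem.
have [z1 z1E] : exists z1, (1%:M : resM E n) = comb b' z1.
  by eexists; apply: (comb_basis bP); rewrite lker_ad_twisted map_mx1 mulmx1 mul1mx.
rewrite (form_measure_ball p_prime vpP vFP vEP lamP rho_gt0 rho1 (w := b') (g := mxGL g) (z1 := z1)) ?mxGL_unit//.
- by move=> z; exact: (comb_free bP).
- move=> x; split=> [[h [_ hg] hx]|xg]; first by rewrite -hx.
  have := near1_unit rho1 xg; rewrite !unitmx_mul unitmx_inv mxGL_unit/= andbT => ux.
  exists (mkGL vE ux) => //; split=> //.
  by apply: mxGL_inj; rewrite /= -mulmxA bU mulmxA mulVmx// mul1mx.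
- move=> x t.
  apply: (comb_coord_mx t bP (f := fun X : resM E n => (comb b' x : 'M[E]_n) *m X : resM E n)) => [e Y Z|X].
    by rewrite !resM_scaleE mulmxDr -scalemxAr.
  by rewrite !lker_ad_twisted map_mxM mulmxA bU -!mulmxA => /eqP ->.
Qed.

Section Comparison.
Variables (gamma : GL vF n) (c : r.-tuple 'M[F]_n) (cP : basis_of (lker (adF gamma)) c).
Hypothesis g_ss : forall X, mxGL gamma *m (mxGL gamma *m X - X *m mxGL gamma) =
  (mxGL gamma *m X - X *m mxGL gamma) *m mxGL gamma -> mxGL gamma *m X = X *m mxGL gamma.
Let c' (i : 'I_r) := c`_i.
Let w (i : 'I_r) : resM E n := emb (c' i).

Let c_free z : comb c' z = 0 -> z = 0. Proof. exact: (comb_free cP). Qed.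
Let c_comm i : mxGL gamma *m c' i = c' i *m mxGL gamma.
Proof. by apply/eqP; rewrite -lker_adF (basis_mem cP)// mem_nth// size_tuple. Qed.
Let c_span X : mxGL gamma *m X = X *m mxGL gamma -> exists z, X = comb c' z.
Proof. by move=> gX; eexists; apply: (comb_basis cP); rewrite lker_adF gX. Qed.

Let wE z : (comb w z : 'M[E]_n) = emb (comb c' z).
Proof. by rewrite /comb raddf_sum; apply: eq_bigr => i _; rewrite /= map_mxZ. Qed.

Let w_free z : comb w z = 0 -> z = 0.
Proof.
move=> wz; have : (comb w z : 'M[E]_n) = 0 := wz.
by rewrite wE => h; apply/c_free/(@emb_inj F E); rewrite h map_mx0.
Qed.

(** Conjugation by s acts on the Lie algebra with determinant of square 1. This is unimodularity of
    the centralizer; it makes the mass of a double coset independent of the representative. *)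
Lemma conj_ball_unimodular (s g : 'M[F]_n) : s \in unitmx -> g \in unitmx ->
  mxGL gamma *m s = s *m mxGL gamma ->
  lam (conj_ball vE rho w (emb (s *m g))) = lam (conj_ball vE rho w (emb g)).
Proof.
move=> us ug gs; have uge : emb g \in unitmx by rewrite map_unitmx.
have gs' : mxGL gamma *m invmx s = invmx s *m mxGL gamma.
  by apply: (can_inj (mulKmx us)); rewrite !mulmxA -gs mulmxK// mulmxV// mul1mx.
have /choice[z hz] : forall i, exists z, invmx s *m c' i *m s = comb c' z.
  by move=> i; apply: c_span; rewrite !mulmxA gs' -!mulmxA -gs !mulmxA -(mulmxA _ (mxGL gamma)) c_comm !mulmxA.
pose Q := \matrix_i z i; pose w' (i : 'I_r) : resM E n := emb (invmx s *m c' i *m s).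
have w'Q i : w' i = \sum_j Q i j *: w j.
  rewrite -[LHS]/(emb _ : resM E n) hz -[LHS]wE; apply: eq_bigr => j _; by rewrite mxE.
have w'E t : (comb w' t : 'M[E]_n) = emb (invmx s) *m comb w t *m emb s.
  rewrite /comb mulmx_sumr mulmx_suml; apply: eq_bigr => i _.
  by rewrite !resM_scaleE -scalemxAr -scalemxAl -!map_mxM.
have w'_free t : comb w' t = 0 -> t = 0.
  move=> h; apply: w_free; have : (comb w' t : 'M[E]_n) = 0 by [].
  rewrite w'E => /(congr1 (fun X => emb s *m X *m emb (invmx s))).
  rewrite mulmx0 mul0mx !mulmxA -map_mxM mulmxV// map_mx1 mul1mx -mulmxA -map_mxM mulmxV// map_mx1 mulmx1.
  by [].
have detQ : \det Q ^+ 2 = 1.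
  apply: (centralizer_conj_det (f := idfun) c_free c_comm c_span g_ss us) => i.
  rewrite map_mx_id// hz; apply: eq_bigr => j _; by rewrite map_mx_id// mxE.
have vQ : vF (\det Q) = 1.
  have : vF (\det Q) ^+ 2 = 1 by rewrite -absvX detQ absv1.
  by move/eqP; rewrite sqrp_eq1 ?absv_ge0// => /eqP.
have uQ : Q \in unitmx by rewrite unitmxE unitfE -(absv_gt0 vF) vQ.
rewrite (lam_conj_ball p_prime vpP vFP vEP lamP rho_gt0 w'_free uge uQ w'Q) vQ mul1e.
congr (lam _); apply/seteqP; split=> t; rewrite /conj_ball /= w'E map_mxM invmx_mul ?map_unitmx//;
  by rewrite map_invmx !mulmxA.
Qed.

Variables (Fbar : closedFieldType) (iota : {rmorphism E -> Fbar}).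
Variables (delta : GL vE n) (b : r.-tuple (resM E n)).
Hypothesis bP : basis_of (lker (ad_twisted th delta)) b.
Variables (x : 'M[E]_n) (y V : 'M[F]_n) (ux : x \in unitmx) (uy : y \in unitmx).
Hypotheses (gE : mxGL gamma = y *m V ^+ d *m invmx y)
  (dE : mxGL delta = x *m emb V *m invmx (tmx x)).
Hypothesis V_root : forall X : 'M[F]_n, V ^+ d *m X = X *m V ^+ d <-> V *m X = X *m V.
Hypothesis V_tw : forall Z : 'M[E]_n,
  emb V *m tmx Z = Z *m emb V <-> exists2 X : 'M[F]_n, Z = emb X & V *m X = X *m V.
Variables (u : 'M[Fbar]_n) (P : 'M[Fbar]_r) (a : F) (uu : u \in unitmx).
Hypotheses (buP : forall j : 'I_r, invmx u *m map_mx iota (b`_j : 'M[E]_n) *m u =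
        \sum_(i < r) P i j *: map_mx iota (map_mx (in_alg E) c`_i))
  (detP : \det P = iota a%:A).

Lemma centralizerF_conj (X : 'M[F]_n) :
  mxGL gamma *m (y *m X *m invmx y) = (y *m X *m invmx y) *m mxGL gamma <-> V *m X = X *m V.
Proof.
rewrite -V_root gE !mulmxA !mulmxKV//; split=> [|h]; last by rewrite -!(mulmxA y) h.
by move=> /(congr1 (fun X => invmx y *m X *m y)); rewrite !mulmxA !mulmxKV// mulVmx// !mul1mx.
Qed.

Lemma twisted_centralizer_conj (Z : 'M[E]_n) :
  mxGL delta *m tmx (x *m Z *m invmx x) = (x *m Z *m invmx x) *m mxGL delta <->
  exists2 X : 'M[F]_n, Z = emb X & V *m X = X *m V.
Proof.
have utx : tmx x \in unitmx by rewrite map_unitmx.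
rewrite -V_tw dE !map_mxM map_invmx !mulmxA !mulmxKV//; split=> [|h]; last by rewrite -!(mulmxA x) h.
move=> /(congr1 (fun X => invmx x *m X *m tmx x)).
by rewrite !mulmxA !mulmxKV// mulVmx// !mul1mx.
Qed.

(** Conjugation by x y^-1 carries the basis c to a basis q of the twisted Lie algebra, and b = Q q.
    The compatibility constant a and det Q agree up to sign, so |a| corrects exactly for the change
    of basis from q to b. *)
Lemma conj_ball_transfer (g : 'M[F]_n) : g \in unitmx ->
  ((vF a)%:E * lam (conj_ball vE rho (fun i : 'I_r => b`_i) (x *m emb g)))%E =
  lam (conj_ball vE rho w (emb (y *m g))).
Proof.
move=> ug; pose b' (i : 'I_r) := b`_i.
pose q (i : 'I_r) : resM E n := x *m emb (invmx y *m c' i *m y) *m invmx x : 'M[E]_n.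
have qE t : (comb q t : 'M[E]_n) = x *m emb (invmx y *m comb c' t *m y) *m invmx x.
  rewrite /comb mulmx_sumr mulmx_suml raddf_sum mulmx_sumr mulmx_suml; apply: eq_bigr => i _.
  by rewrite /= -!scalemxAr -!scalemxAl map_mxZ -!scalemxAr -!scalemxAl.
have /choice[z hz] : forall i, exists z, b' i = comb q z.
  move=> i; have : b' i \in lker (ad_twisted th delta).
    by rewrite (basis_mem bP)// mem_nth// size_tuple.
  rewrite lker_ad_twisted => /eqP.
  have biE : (b' i : 'M[E]_n) = x *m (invmx x *m (b' i : 'M[E]_n) *m x) *m invmx x.
    by rewrite !mulmxA mulmxV// mul1mx mulmxK.
  rewrite {1 2}biE => /twisted_centralizer_conj[X XE /centralizerF_conj/c_span[t tE]].
  exists t; suff : (b' i : 'M[E]_n) = comb q t by [].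
  rewrite biE XE qE -tE; congr (_ *m emb _ *m _).
  by rewrite !mulmxA mulVmx// mul1mx mulmxKV.
pose Q := \matrix_i z i.
have bQ i : b' i = \sum_j Q i j *: q j.
  by rewrite hz; apply: eq_bigr => j _; rewrite mxE.
have uQ : Q \in unitmx.
  rewrite -row_free_unit -kermx_eq0; apply/eqP/row_matrixP => i; rewrite row0.
  apply: (comb_free bP); rewrite (combM _ bQ) -row_mul mulmx_ker row0.
  by rewrite /comb big1// => j _; rewrite mxE scale0r.
pose iotaF : {rmorphism F -> Fbar} := iota \o in_alg E.
have iE (X : 'M[F]_n) : map_mx iotaF X = map_mx iota (emb X) by rewrite -map_mx_comp.
(* Z compares the identifications of the Lie algebras by u and by x y^-1: conjugation by it has
   matrix Q^-1 P^T in the basis c, whose determinant squares to 1. Hence a^2 = (det Q)^2. *)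
pose Z := map_mx iota (emb y *m invmx x) *m u.
have uZ : Z \in unitmx by rewrite !unitmx_mul uu map_unitmx !unitmx_mul unitmx_inv ux map_unitmx uy.
pose QF := map_mx iotaF Q.
have uQF : QF \in unitmx by rewrite map_unitmx.
have ZE i : invmx Z *m map_mx iotaF (c' i) *m Z = invmx u *m map_mx iota (q i : 'M[E]_n) *m u.
  rewrite /Z invmx_mul//; last by rewrite map_unitmx unitmx_mul map_unitmx uy unitmx_inv.
  rewrite -map_invmx invmx_mul ?map_unitmx ?unitmx_inv// invmxK iE /q -map_invmx !map_mxM.
  by rewrite !mulmxA.
pose X i := invmx Z *m map_mx iotaF (c' i) *m Z.
pose C i := map_mx iotaF (c' i).
pose Y k := \sum_j QF k j *: X j.
have YC k : Y k = \sum_j P^T k j *: C j.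
  transitivity (invmx u *m map_mx iota (b' k : 'M[E]_n) *m u); last first.
    by rewrite buP; apply: eq_bigr => j _; rewrite mxE /C iE.
  have -> : (b' k : 'M[E]_n) = \sum_j ((Q k j)%:A : E) *: (q j : 'M[E]_n) by rewrite bQ.
  rewrite raddf_sum mulmx_sumr mulmx_suml; apply: eq_bigr => j _.
  by rewrite /= map_mxZ -scalemxAr -scalemxAl -ZE /QF [in LHS]mxE.
have hZ i : X i = \sum_j (invmx QF *m P^T) i j *: C j.
  rewrite -(comb_delta X i) -[delta_mx 0 i](mulmxKV uQF).
  rewrite -(combM (u := Y))// (combM _ YC) -mulmxA -rowE /comb.
  by apply: eq_bigr => j _; rewrite [row _ _ _ _]mxE.
have := centralizer_conj_det c_free c_comm c_span g_ss uZ hZ.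
rewrite det_mulmx det_inv det_tr det_map_mx detP -[iota a%:A]/(iotaF a) -fmorphV -rmorphM -rmorphXn.
move=> /eqP; rewrite fmorph_eq1 exprMn exprVn => /eqP a2.
have dQ : \det Q != 0 by rewrite -unitfE -unitmxE.
have vaQ : vF a = vF (\det Q).
  apply/eqP; rewrite -(@eqrXn2 _ 2)// ?absv_ge0// -!absvX; apply/eqP; congr (vF _).
  by apply: (mulfI (invr_neq0 (expf_neq0 2 dQ))); rewrite a2 mulVf// expf_neq0.
rewrite vaQ -(lam_conj_ball p_prime vpP vFP vEP lamP rho_gt0 (fun z => @comb_free _ _ _ _ _ z bP) _ uQ bQ).
  congr (lam _); apply/seteqP; split=> t; rewrite /conj_ball /= qE !map_mxM wE !invmx_mul ?map_unitmx//;
  by rewrite map_invmx !mulmxA !mulmxKV.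
by rewrite unitmx_mul ux map_unitmx.
Qed.

End Comparison.
End Masses.

(** * Orbital integrals *)

Section OrbitalIntegrals.
Variables (R : realType) (p : nat) (p_prime : prime p).
Variables (Qp : fieldType) (vp : absval R Qp) (vpP : is_Qp p vp).
Variables (F : fieldExtType Qp) (vF : absval R F) (vFP : normalized_extension vp vF).
Variables (E : splittingFieldType F) (vE : absval R E) (vEP : normalized_extension vF vE).
Variables (th : {rmorphism E -> E}) (n : nat).
Local Notation d := (\dim {:E}).
Local Notation emb := (map_mx (in_alg E)).
Local Notation tmx := (map_mx th).
Hypotheses (pd : ~~ (p %| d)%N)
  (th_alg : forall a : F, th a%:A = a%:A) (th_d : forall x, iter d th x = x)
  (th_fix : forall x, th x = x -> exists a : F, x = a%:A)
  (th_indep : forall c : nat -> E, c 0%N != 0 -> exists a, \sum_(i < d) c i * iter i th a != 0).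
Variables (Fbar : closedFieldType) (iota : {rmorphism E -> Fbar}).
Variable rho : R.
Hypotheses (rho_gt0 : 0 < rho) (rho1 : rho < 1).
Local Notation near1F V := (close1 vE rho (emb V)).
Local Notation GE := (GL vE n).
Local Notation GF := (GL vF n).

Let lfF : local_field vF. Proof. exact: (lf_F p_prime vpP vFP). Qed.
Let lfE : local_field vE. Proof. exact: local_field_ext lfF vEP. Qed.
Let v_th x : vE (th x) = vE x. Proof. exact: (absv_aut lfF vEP th_alg). Qed.
Let d_gt0 : (0 < d)%N. Proof. exact: adim_gt0. Qed.

Let vp1 : vE p%:R < 1.
Proof.
have /andP[p0 p1] := absv_p_lt1 p_prime vpP vFP.
by rewrite -[p%:R](rmorph_nat (in_alg E)) /= vEP exprn_ilt1 ?absv_ge0// -lt0n.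
Qed.

Let char0 k : k.+1%:R != 0 :> Fbar.
Proof.
have : k.+1%:R != 0 :> Qp.
  rewrite -(absv_gt0 vp) (Qp_absv_nat vpP)// invr_gt0 exprn_gt0// ltr0n.
  exact: prime_gt0.
by rewrite -(fmorph_eq0 (in_alg F)) rmorph_nat -(fmorph_eq0 (in_alg E)) rmorph_nat -(fmorph_eq0 iota) rmorph_nat.
Qed.

Let vd : vE d%:R = 1. Proof. exact: (absv_prime_to_p p_prime vp1 pd). Qed.

Let intertwine (M M' X : 'M[E]_n) : close1 vE rho M -> close1 vE rho M' ->
  X *m M ^+ d = M' ^+ d *m X -> X *m M = M' *m X.
Proof. exact: (near1_root_intertwine rho_gt0 rho1 p_prime vp1 pd). Qed.

(** rho' is the real d-th root of rho, as |.|_E is the d-th power of |.|_F on F. *)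
Lemma radius_descent : exists2 rho' : R, 0 < rho' < 1 &
  forall X : 'M[F]_n, close1 vE rho (emb X) <-> close1 vF rho' X.
Proof.
have d0 : d%:R != 0 :> R by rewrite pnatr_eq0 -lt0n.
pose rho' := powR rho d%:R^-1; have r0 : 0 < rho' by exact: powR_gt0.
have rd : rho' ^+ d = rho.
  by rewrite -powR_mulrn ?powR_ge0// -powRrM mulVf// powRr1// ltW.
exists rho' => [|X]; first rewrite r0/=.
  by rewrite ltNge; apply/negP => /(exprn_ege1 d); rewrite rd leNgt rho1.
have entE i j : vE ((emb X - 1%:M) i j) = vF ((X - 1%:M) i j) ^+ d.
  by rewrite -(map_mx1 (in_alg E)) -map_mxB mxE -vEP.
rewrite /close1; split=> X1.
  apply: mxn_le => [|i j]; first exact: ltW.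
  rewrite -(ler_pXn2r d_gt0) ?nnegrE ?absv_ge0 ?(ltW r0)// rd -entE.
  exact: le_trans (mxn_ent _ _ _ _) X1.
apply: mxn_le => [|i j]; first exact: ltW.
rewrite entE -rd lerXn2r ?nnegrE ?absv_ge0 ?(ltW r0)//.
exact: le_trans (mxn_ent _ _ _ _) X1.
Qed.

(** The implication is checked for gamma over Fbar, where it is diagonalizable, and carried back
    along conjugation by y. It serves gamma itself and V^d. *)
Lemma semisimple_commutator (gamma : GF) (A y X : 'M[F]_n) : semisimpleF vE iota gamma ->
  y \in unitmx -> mxGL gamma = y *m A *m invmx y ->
  A *m (A *m X - X *m A) = (A *m X - X *m A) *m A -> A *m X = X *m A.
Proof.
move=> g_ss uy gE AX; pose j := map_mx iota \o map_mx (in_alg E) : 'M[F]_n -> 'M[Fbar]_n.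
pose g := mxGL gamma; pose Y := y *m X *m invmx y.
have conjM B C : (y *m B *m invmx y) *m (y *m C *m invmx y) = y *m (B *m C) *m invmx y.
  by rewrite !mulmxA mulmxKV.
have conjB B C : y *m B *m invmx y - y *m C *m invmx y = y *m (B - C) *m invmx y.
  by rewrite mulmxBr mulmxBl.
have gY : g *m (g *m Y - Y *m g) = (g *m Y - Y *m g) *m g.
  by rewrite /g /Y gE !(conjM, conjB) AX.
have /(diagonalizable_commutator2 g_ss) : map_mx iota (mxGL (inclGL vE gamma)) *m
    (map_mx iota (mxGL (inclGL vE gamma)) *m map_mx iota (emb Y) - map_mx iota (emb Y) *m map_mx iota (mxGL (inclGL vE gamma)))
   = (map_mx iota (mxGL (inclGL vE gamma)) *m map_mx iota (emb Y) - map_mx iota (emb Y) *m map_mx iota (mxGL (inclGL vE gamma)))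
    *m map_mx iota (mxGL (inclGL vE gamma)).
  by rewrite -!map_mxM -!map_mxB -!map_mxM gY.
rewrite -!map_mxM => /map_mx_inj /(@emb_inj F E); rewrite /Y gE !conjM.
move=> /(congr1 (fun B => invmx y *m B *m y)).
by rewrite !mulmxA !mulmxKV// mulVmx// !mul1mx.
Qed.

Section Centralizers.
Variables (gamma : GF) (delta : GE).

Lemma centralizerF_commute h :
  centralizerF gamma h <-> mxGL gamma *m mxGL h = mxGL h *m mxGL gamma.
Proof.
split=> [/(congr1 (fun g : GF => mxGL (h * g)%g)) /=|gh]; first by rewrite -mulmxA mulKVmx ?mxGL_unit.
by apply: mxGL_inj; rewrite /= -mulmxA gh mulKmx ?mxGL_unit.
Qed.

Lemma twisted_centralizer_commute (g : GE) :
  twisted_centralizer th delta g <-> mxGL delta *m tmx (mxGL g) = mxGL g *m mxGL delta.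
Proof.
split=> [/(congr1 (fun h : GE => mxGL (g * h)%g)) /=|gh]; first by rewrite -mulmxA mulKVmx ?mxGL_unit.
by apply: mxGL_inj; rewrite /= -mulmxA gh mulKmx ?mxGL_unit.
Qed.

Lemma centralizerF_closed : closed (centralizerF gamma).
Proof.
have -> : centralizerF gamma =
    [set g : GF | (fun X => mxGL gamma *m X - X *m mxGL gamma) (mxGL g) = 0].
  apply/seteqP; split=> h; first by move=> /centralizerF_commute /= ->; rewrite subrr.
  by move=> /= /eqP; rewrite subr_eq0 => /eqP /centralizerF_commute.
apply: (@closed_Lipschitz _ _ vF _ (fun X => mxGL gamma *m X - X *m mxGL gamma) (mxn vF (mxGL gamma))) => X Y.
have -> : mxGL gamma *m X - X *m mxGL gamma - (mxGL gamma *m Y - Y *m mxGL gamma) =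
    mxGL gamma *m (X - Y) - (X - Y) *m mxGL gamma.
  by rewrite mulmxBr mulmxBl !(opprD, opprK) addrACA.
by apply: mxnB_le; [exact: mxnM|rewrite mulrC; exact: mxnM].
Qed.

Lemma twisted_centralizer_closed : closed (twisted_centralizer th delta).
Proof.
have -> : twisted_centralizer th delta =
    [set g : GE | (fun X => mxGL delta *m tmx X - X *m mxGL delta) (mxGL g) = 0].
  apply/seteqP; split=> h; first by move=> /twisted_centralizer_commute /= ->; rewrite subrr.
  by move=> /= /eqP; rewrite subr_eq0 => /eqP /twisted_centralizer_commute.
apply: (@closed_Lipschitz _ _ vE _ (fun X => mxGL delta *m tmx X - X *m mxGL delta) (mxn vE (mxGL delta))) => X Y.
have -> : mxGL delta *m tmx X - X *m mxGL delta - (mxGL delta *m tmx Y - Y *m mxGL delta) =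
    mxGL delta *m tmx (X - Y) - (X - Y) *m mxGL delta.
  by rewrite map_mxB mulmxBr mulmxBl !(opprD, opprK) addrACA.
apply: mxnB_le; last by rewrite mulrC; exact: mxnM.
by rewrite -[X in _ * X](mxn_map v_th); exact: mxnM.
Qed.

Lemma centralizerF1 : centralizerF gamma 1%g.
Proof. by apply/centralizerF_commute; rewrite mulmx1 mul1mx. Qed.

Lemma centralizerFM s t : centralizerF gamma s -> centralizerF gamma t -> centralizerF gamma (s * t)%g.
Proof.
move=> /centralizerF_commute gs /centralizerF_commute gt; apply/centralizerF_commute.
by rewrite /= mulmxA gs -!mulmxA gt.
Qed.

Lemma centralizerFV s : centralizerF gamma s -> centralizerF gamma (s^-1)%g.
Proof.
move=> /centralizerF_commute gs; apply/centralizerF_commute => /=.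
apply: (can_inj (mulKmx (mxGL_unit s))).
by rewrite mulmxA -gs mulmxK ?mulKVmx ?mxGL_unit.
Qed.

Lemma twisted_centralizer1 : twisted_centralizer th delta 1%g.
Proof. by apply/twisted_centralizer_commute; rewrite /= map_mx1 mulmx1 mul1mx. Qed.

Lemma twisted_centralizerM s t : twisted_centralizer th delta s ->
  twisted_centralizer th delta t -> twisted_centralizer th delta (s * t)%g.
Proof.
move=> /twisted_centralizer_commute gs /twisted_centralizer_commute gt.
by apply/twisted_centralizer_commute; rewrite /= map_mxM mulmxA gs -!mulmxA gt.
Qed.

Lemma twisted_centralizerV s : twisted_centralizer th delta s ->
  twisted_centralizer th delta (s^-1)%g.
Proof.
move=> /twisted_centralizer_commute gs; apply/twisted_centralizer_commute => /=.
apply: (can_inj (mulKmx (mxGL_unit s))).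
by rewrite mulmxA -gs map_invmx mulmxK ?mulKVmx ?map_unitmx ?mxGL_unit.
Qed.
End Centralizers.

Let near1FM (X Y : 'M[F]_n) : near1F X -> near1F Y -> near1F (X *m Y).
Proof. by rewrite map_mxM; exact: (near1M rho1). Qed.

Let near1FV (X : 'M[F]_n) : near1F X -> near1F (invmx X).
Proof. by rewrite map_invmx; exact: (near1V rho1). Qed.

Section DoubleCosets.
Variables (V : 'M[F]_n) (V1 : near1F V).

Definition root_conj : set GF := [set a | near1F (invmx (mxGL a) *m V *m mxGL a)].

(** Equality in S\GL_n(F)/K_theta, with S the centralizer of V in GL_n(F). *)
Definition root_equiv (a b : GF) := exists s k : GF,
  [/\ V *m mxGL s = mxGL s *m V, near1F (mxGL k) & b = (s * a * k)%g].

Let equiv_sym a b : root_equiv a b -> root_equiv b a.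
Proof.
move=> [s [k [Vs k1 ->]]]; exists (s^-1)%g, (k^-1)%g; split.
- apply: (can_inj (mulKmx (mxGL_unit s))).
  by rewrite mulmxA -Vs /= mulmxK ?mulKVmx ?mxGL_unit.
- exact: near1FV.
- by rewrite !mulgA mulVg mul1g mulgK.
Qed.

Let equiv_trans a b c : root_equiv a b -> root_equiv b c -> root_equiv a c.
Proof.
move=> [s [k [Vs k1 ->]]] [t [l [Vt l1 ->]]]; exists (t * s)%g, (k * l)%g; split.
- by rewrite /= mulmxA Vt -!mulmxA Vs.
- exact: near1FM.
- by rewrite !mulgA.
Qed.

Let root_conj_equiv a b : root_equiv a b -> root_conj a -> root_conj b.
Proof.
move=> [s [k [Vs k1 ->]]] a1; rewrite /root_conj /=.
have us := mxGL_unit s; have ua := mxGL_unit a; have uk := mxGL_unit k.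
have -> : invmx (mxGL s *m mxGL a *m mxGL k) *m V *m (mxGL s *m mxGL a *m mxGL k) =
    invmx (mxGL k) *m (invmx (mxGL a) *m V *m mxGL a) *m mxGL k.
  rewrite !invmx_mul ?unitmx_mul ?us// !mulmxA; congr (_ *m _ *m _).
  by rewrite -!(mulmxA _ V) Vs !mulmxA mulmxKV.
by apply: near1FM => //; apply: near1FM => //; exact: near1FV.
Qed.

(** Countably many balls cover GL_n(F), so their centers meet every double coset; the first center
    in each class is its representative. *)
Lemma root_equiv_reps : exists (u : nat -> GF) (J : set nat),
  (forall a, root_conj a <-> exists2 j, J j & root_equiv (u j) a) /\
  (forall i j, J i -> J j -> root_equiv (u i) (u j) -> i = j).
Proof.
have [rho' /andP[r0 r1] rP] := radius_descent.
have [u hu] := @ball1_cover _ _ _ lfF n _ r0 r1.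
have refl a : root_equiv a a.
  exists 1%g, 1%g; rewrite mulg1 mul1g; split=> //; first by rewrite mulmx1 mul1mx.
  by rewrite /close1 map_mx1 subrr mxn0 ltW.
exists u, (first_reps root_conj root_equiv u); split=> [a|i j [Ai mi] [Aj mj] ij].
  split=> [Aa|[j [Aj _] ja]]; last exact: root_conj_equiv ja Aj.
  have [j /rP aj] := hu a; have {}aj : root_equiv a (u j).
    exists 1%g, (a^-1 * u j)%g; rewrite mul1g mulKVg; split=> //.
    by rewrite mulmx1 mul1mx.
  have Aj := root_conj_equiv aj Aa.
  have [i Ji ij] := first_repsP equiv_trans Aj (refl _).
  by exists i => //; apply: equiv_trans ij (equiv_sym aj).
case: (ltngtP i j) => // [lt_ij|lt_ji]; first by case: (mj _ lt_ij Ai).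
by case: (mi _ lt_ji Aj); exact: equiv_sym.
Qed.

Variables (u : nat -> GF) (J : set nat).
Hypothesis uJ : forall a, root_conj a <-> exists2 j, J j & root_equiv (u j) a.
Hypothesis u_inj : forall i j, J i -> J j -> root_equiv (u i) (u j) -> i = j.
Variables (gamma : GF) (y : 'M[F]_n) (uy : y \in unitmx).
Hypothesis gE : mxGL gamma = y *m V ^+ d *m invmx y.
Hypothesis g_semi : semisimpleF vE iota gamma.
Variables (r : nat) (c : r.-tuple 'M[F]_n) (lam : {measure set (borel 'rV[valued vF]_r) -> \bar R}).
Hypotheses (cP : basis_of (lker (adF gamma)) c) (lamP : additive_haar_measure lam).
Local Notation mass g := (lam (conj_ball vE rho (fun i : 'I_r => emb c`_i : resM E n) (emb g))).

Let yG : GF := mkGL vF uy.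

Let g_comm X : mxGL gamma *m (mxGL gamma *m X - X *m mxGL gamma) =
  (mxGL gamma *m X - X *m mxGL gamma) *m mxGL gamma -> mxGL gamma *m X = X *m mxGL gamma.
Proof.
apply: (semisimple_commutator g_semi (unitmx1 F n)).
by rewrite mul1mx invmx1 mulmx1.
Qed.

Let V_root (X : 'M[F]_n) : V ^+ d *m X = X *m V ^+ d <-> V *m X = X *m V.
Proof. exact: (commute_root p_prime vp1 pd rho_gt0 rho1 V1). Qed.

Let S_conj s : centralizerF gamma s <->
  V *m (invmx y *m mxGL s *m y) = (invmx y *m mxGL s *m y) *m V.
Proof.
rewrite centralizerF_commute -(centralizerF_conj uy gE V_root).
by have -> : y *m (invmx y *m mxGL s *m y) *m invmx y = mxGL s by rewrite !mulmxA mulmxV// mul1mx mulmxK.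
Qed.

Let mass_invariant (s : GF) (g : 'M[F]_n) : g \in unitmx -> centralizerF gamma s ->
  mass (mxGL s *m g) = mass g.
Proof.
move=> ug /centralizerF_commute gs.
by rewrite (conj_ball_unimodular p_prime vpP vFP vEP rho_gt0 lamP cP g_comm (mxGL_unit s) ug gs).
Qed.

Lemma orbital_sum_F (dh dh_gamma : {measure set (borel GF) -> \bar R})
    (nuH : {measure set (borel (coset_space (centralizerF gamma))) -> \bar R}) :
  haar_measure setT dh -> haar_measure (centralizerF gamma) dh_gamma ->
  quotient_measure dh dh_gamma nuH ->
  (forall B : set (borel GF), measurable B ->
     dh_gamma B = form_measure (fun X Y : 'M[F]_n => X *m Y) (fun h : GF => mxGL h) c lam B) ->
  (\int[nuH]_C ((fine (dh [set h : GF | near1F (mxGL h)]))^-1 *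
     \1_[set h : GF | near1F (mxGL (h^-1 * gamma * h)%g)] (coset_rep C))%:E =
   \sum_(0 <= j <oo | j \in J) ((fine (mass (y *m mxGL (u j))))^-1)%:E)%E.
Proof.
move=> dhP dhgP nuHP formE; have [rho' /andP[r0 r1] rP] := radius_descent.
have -> : [set h : GF | near1F (mxGL h)] = ball1 rho' by apply/seteqP; split=> h /rP.
have SV s := @centralizerFV gamma s.
apply: (orbital_sum lfF r0 r1 dhP dhgP nuHP (@centralizerF_closed gamma) (centralizerF1 gamma)
  (@centralizerFM gamma) SV
  (a := fun j => (yG * u j)%g) (m := fun j => mass (y *m mxGL (u j))) (J := J)).
- move=> g; have h := near1F_conj_root lfE th_alg th_fix v_th p_prime vp1 pd rho_gt0 rho1 V1
    (mxGL_unit (yG^-1 * g)%g).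
  have e : mxGL (g^-1 * gamma * g)%g = invmx (mxGL (yG^-1 * g)%g) *m V ^+ d *m mxGL (yG^-1 * g)%g.
    by rewrite /= gE invmx_mul ?unitmx_inv ?mxGL_unit// invmxK !mulmxA.
  rewrite -e in h; apply: (iff_trans h).
  apply: (iff_trans (uJ _)); split=> -[j Jj].
    move=> [s [k [Vs k1 gk]]]; exists j => //; exists (yG * s * yG^-1)%g, k; split.
    - apply/S_conj => /=; have -> : invmx y *m (y *m mxGL s *m invmx y) *m y = mxGL s.
        by rewrite !mulmxA mulVmx// mul1mx mulmxKV.
      by [].
    - exact/rP.
    - by rewrite -[LHS](mulKVg yG) gk !mulgA mulgKV.
  move=> [s [k [/S_conj Ss /rP k1 ->]]]; exists j => //; exists (yG^-1 * s * yG)%g, k; split=> //.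
  by rewrite !mulgA.
- move=> i j g Ji Jj [s [k [/S_conj Ss /rP k1 ->]]] [t [l [/S_conj St /rP l1 sE]]].
  apply: u_inj => //; apply: (@equiv_trans _ (yG^-1 * (s * (yG * u i) * k))%g).
    by exists (yG^-1 * s * yG)%g, k; split=> //; rewrite !mulgA.
  by apply: equiv_sym; exists (yG^-1 * t * yG)%g, l; split=> //; rewrite sE !mulgA.
- move=> j s Jj Ss; rewrite -(mass_invariant _ Ss); last by rewrite unitmx_mul uy mxGL_unit.
  have -> : [set h | ball1 rho' ((s * (yG * u j))^-1 * h * (s * (yG * u j)))%g] =
      [set h : GF | near1F (mxGL ((s * (yG * u j))^-1 * h * (s * (yG * u j)))%g)].
    by apply/seteqP; split=> h /rP.
  rewrite formE ?(form_measure_centralizerF p_prime vpP vFP vEP rho_gt0 rho1 lamP)//.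
  apply: measurableI; first exact: measurable_closed (@centralizerF_closed gamma).
  apply: measurable_open; have := open_mul_ball1 r0 (s * (yG * u j))^-1%g (s * (yG * u j))%g.
  by congr open; apply/seteqP; split=> h /rP.
Qed.

Variables (delta : GE) (x : 'M[E]_n) (ux : x \in unitmx).
Hypothesis dE : mxGL delta = x *m emb V *m invmx (tmx x).
Variables (b : r.-tuple (resM E n)) (w : 'M[Fbar]_n) (P : 'M[Fbar]_r) (a : F).
Hypotheses (bP : basis_of (lker (ad_twisted th delta)) b) (uw : w \in unitmx).
Hypotheses (bwP : forall j : 'I_r, invmx w *m map_mx iota (b`_j : 'M[E]_n) *m w =
        \sum_(i < r) P i j *: map_mx iota (map_mx (in_alg E) c`_i))
  (detP : \det P = iota a%:A).

Let xG : GE := mkGL vE ux.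

Let V_tw (Z : 'M[E]_n) :
  emb V *m tmx Z = Z *m emb V <-> exists2 X : 'M[F]_n, Z = emb X & V *m X = X *m V.
Proof. exact: (twisted_commute th_alg th_d th_fix p_prime vp1 pd rho_gt0 rho1 V1). Qed.

Let T_conj s : twisted_centralizer th delta s <->
  exists2 t : GF, s = (xG * inclGL vE t * xG^-1)%g & V *m mxGL t = mxGL t *m V.
Proof.
rewrite twisted_centralizer_commute.
have sE : mxGL s = x *m (invmx x *m mxGL s *m x) *m invmx x.
  by rewrite !mulmxA mulmxV// mul1mx mulmxK.
rewrite {1 2}sE (twisted_centralizer_conj ux dE V_tw); split=> [[X XE VX]|[t -> Vt]].
  have uX : X \in unitmx.
    by rewrite -(map_unitmx (in_alg E)) -XE !unitmx_mul unitmx_inv ux mxGL_unit.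
  by exists (mkGL vF uX) => //; apply: mxGL_inj; rewrite /= sE XE.
by exists (mxGL t) => //=; rewrite !mulmxA mulVmx// mul1mx mulmxKV.
Qed.

(** The representatives u j over F, moved by x, serve again, and [conj_ball_transfer] identifies
    their masses with those on the side of gamma. *)
Lemma orbital_sum_twisted (dg dg_delta : {measure set (borel GE) -> \bar R})
    (nuG : {measure set (borel (coset_space (twisted_centralizer th delta))) -> \bar R}) :
  haar_measure setT dg -> haar_measure (twisted_centralizer th delta) dg_delta ->
  quotient_measure dg dg_delta nuG ->
  (forall B : set (borel GE), measurable B ->
     dg_delta B = (vF a)%:E *
       form_measure (fun X Y : resM E n => (X : 'M[E]_n) *m Y : resM E n)
         (fun g : GE => mxGL g : resM E n) b lam B)%E ->
  (\int[nuG]_C ((fine (dg (ball1 rho)))^-1 *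
     \1_[set h : GE | ball1 rho (h^-1 * delta * thetaGL th h)%g] (coset_rep C))%:E =
   \sum_(0 <= j <oo | j \in J) ((fine (mass (y *m mxGL (u j))))^-1)%:E)%E.
Proof.
move=> dgP dgdP nuGP formE.
apply: (orbital_sum lfE rho_gt0 rho1 dgP dgdP nuGP (@twisted_centralizer_closed delta)
  (twisted_centralizer1 delta) (@twisted_centralizerM delta) (@twisted_centralizerV delta)
  (a := fun j => (xG * inclGL vE (u j))%g) (m := fun j => mass (y *m mxGL (u j)))).
- move=> g; have utx : tmx x \in unitmx by rewrite map_unitmx.
  have ub : mxGL (xG^-1 * g)%g \in unitmx by exact: mxGL_unit.
  have h := near1_twisted_double_coset lfE th_alg th_d th_fix v_th p_prime vp1 pd rho_gt0 rho1 V1 ub.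
  have e : mxGL (g^-1 * delta * thetaGL th g)%g =
      invmx (mxGL (xG^-1 * g)%g) *m emb V *m tmx (mxGL (xG^-1 * g)%g).
    rewrite /= dE map_mxM map_invmx invmx_mul ?unitmx_inv ?mxGL_unit// invmxK.
    by rewrite !mulmxA.
  rewrite -e in h; apply: (iff_trans h) => {e h}.
  split=> [[e [k [ue e1 k1 gE']]]|[j Jj]].
    have [j Jj [s [l [Vs l1 le]]]] := (uJ (mkGL vF ue)).1 e1.
    have uk := near1_unit rho1 k1; exists j => //.
    exists (xG * inclGL vE s * xG^-1)%g, (inclGL vE l * mkGL vE uk)%g; split.
    - by apply/T_conj; exists s.
    - exact: (near1M rho1).
    - rewrite -[LHS](mulKVg xG); have -> : (xG^-1 * g)%g = (inclGL vE s * inclGL vE (u j) * inclGL vE l * mkGL vE uk)%g.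
        apply: mxGL_inj; rewrite /= in gE' *; rewrite gE'; congr (_ *m _).
        by have /(congr1 (fun h : GF => emb (mxGL h))) := le; rewrite /= !map_mxM.
      by rewrite !mulgA mulgKV.
  move=> [s [k [/T_conj[t -> Vt] k1 ->]]].
  exists (mxGL (t * u j)%g), (mxGL k); split=> //.
  - exact: mxGL_unit.
  - apply/uJ; exists j => //; exists t, 1%g; split=> //; last by rewrite mulg1.
    by rewrite /close1 map_mx1 subrr mxn0 ltW.
  - rewrite /= map_mxM !mulmxA mulVmx// mul1mx.
    by rewrite -(mulmxA _ (invmx x) x) mulVmx// mulmx1.
- move=> i j g Ji Jj [_ [k [/T_conj[s -> Vs] k1 gk]]] [_ [l [/T_conj[t -> Vt] l1]]].
  rewrite gk => kl; apply: u_inj => //.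
  (* This element over F equals l k^-1, so it lies in K \cap GL_n(F): double cosets that are
     distinct over F stay distinct over E. *)
  pose m := ((t * u j)^-1 * (s * u i))%g.
  have inclM (e f : GF) : inclGL vE (e * f)%g = (inclGL vE e * inclGL vE f)%g.
    by apply: mxGL_inj; rewrite /= map_mxM.
  have mE : inclGL vE m = (l * k^-1)%g.
    apply: (mulgI (inclGL vE (t * u j)%g)); rewrite -inclM /m mulKVg !inclM mulgA.
    by apply: (mulgI xG); move: kl; rewrite !mulgA !mulgKV => <-; rewrite mulgK.
  have m1 : near1F (mxGL m).
    rewrite -[emb (mxGL m)]/(mxGL (inclGL vE m)) mE.
    by apply: (near1M rho1) => //; exact: (near1V rho1).
  exists (t^-1 * s)%g, (m^-1)%g; split; last by rewrite /m invMg invgK -(mulgA t^-1%g) -mulgA mulKVg mulKg.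
    rewrite /= mulmxA; apply: (can_inj (mulKmx (mxGL_unit t))).
    by rewrite !mulmxA -Vt mulmxK ?mxGL_unit// mulmxV ?mxGL_unit// mul1mx.
  exact: near1FV.
- move=> j s Jj /T_conj[t -> Vt].
  have -> : (xG * inclGL vE t * xG^-1 * (xG * inclGL vE (u j)))%g = (xG * inclGL vE (t * u j))%g.
    by rewrite -!mulgA mulKg; congr (_ * _)%g; apply: mxGL_inj; rewrite /= map_mxM.
  rewrite formE; last first.
    apply: measurableI; first exact: measurable_closed (@twisted_centralizer_closed delta).
    apply: measurable_open; exact: open_mul_ball1.
  rewrite (form_measure_centralizer_twisted p_prime vpP vFP vEP th_alg rho_gt0 rho1 lamP)//.
  rewrite (conj_ball_transfer p_prime vpP vFP vEP th_alg rho_gt0 lamP cP g_comm bP ux uy gE dE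
    V_root V_tw uw bwP detP (mxGL_unit (t * u j)%g)).
  pose s0 := (yG * t * yG^-1)%g.
  have -> : y *m mxGL (t * u j)%g = mxGL s0 *m (y *m mxGL (u j)).
    by rewrite /= !mulmxA mulmxKV.
  rewrite mass_invariant//; first by rewrite unitmx_mul uy mxGL_unit.
  apply/S_conj => /=; have -> : invmx y *m (y *m mxGL t *m invmx y) *m y = mxGL t.
    by rewrite !mulmxA mulVmx// mul1mx mulmxKV.
  by [].
Qed.

End DoubleCosets.

Lemma near1_conj_is_norm (gamma h : GF) : semisimpleF vE iota gamma ->
  near1F (mxGL (h^-1 * gamma * h)%g) -> exists delta' : GE, is_norm th iota gamma delta'.
Proof.
move=> g_semi h1.
have [V V1 VE] := near1_root_fixed lfE th_alg th_fix v_th p_prime vp1 pd rho_gt0 rho1 h1.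
have gE : mxGL gamma = mxGL h *m V ^+ d *m invmx (mxGL h).
  by rewrite VE /= !mulmxA mulmxV ?mxGL_unit// mul1mx mulmxK ?mxGL_unit.
exists (mkGL vE (near1_unit rho1 V1)).
exact: (is_norm_root th_alg _ g_semi (mxGL_unit h) gE).
Qed.

Lemma orbital_transfer (dg dg_delta : {measure set (borel GE) -> \bar R})
    (dh dh_gamma : {measure set (borel GF) -> \bar R}) (gamma : GF) (delta : GE)
    (nuH : {measure set (borel (coset_space (centralizerF gamma))) -> \bar R})
    (nuG : {measure set (borel (coset_space (twisted_centralizer th delta))) -> \bar R}) :
  semisimpleF vE iota gamma ->
  haar_measure setT dg -> haar_measure setT dh ->
  haar_measure (centralizerF gamma) dh_gamma ->
  haar_measure (twisted_centralizer th delta) dg_delta ->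
  compatible_measures th iota gamma delta dh_gamma dg_delta ->
  quotient_measure dh dh_gamma nuH -> quotient_measure dg dg_delta nuG ->
  ((Num.sqrt (D_F gamma))%:E *
     \int[nuH]_C ((fine (dh [set h : GF | near1F (mxGL h)]))^-1 *
       \1_[set h : GF | near1F (mxGL (h^-1 * gamma * h)%g)] (coset_rep C))%:E =
   (Num.sqrt (D_twisted vF th delta))%:E *
     \int[nuG]_C ((fine (dg (ball1 rho)))^-1 *
       \1_[set h : GE | ball1 rho (h^-1 * delta * thetaGL th h)%g] (coset_rep C))%:E)%E.
Proof.
move=> g_semi dgP dhP dhgP dgdP.
move=> [r [b [c [lam [w [P [a [[bP cP lamP] [uw gN] bwP detP [formH formG]]]]]]]]] nuHP nuGP.
rewrite prod_split_comp in gN.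
have [[h h1]|no_h] := pselect (exists h : GF, near1F (mxGL (h^-1 * gamma * h)%g)); last first.
  have -> : [set h : GF | near1F (mxGL (h^-1 * gamma * h)%g)] = set0.
    by apply/seteqP; split=> // h h1; apply: no_h; exists h.
  have -> : [set h : GE | ball1 rho (h^-1 * delta * thetaGL th h)%g] = set0.
    apply/seteqP; split=> // g g1; apply: no_h.
    have [h uh h1] := near1_twisted_norm lfE th_alg th_d th_fix v_th p_prime vp1 pd char0
      rho_gt0 rho1 (mxGL_unit delta) (mxGL_unit g) uw gN g1.
    by exists (mkGL vF uh).
  by rewrite !integral0_eq ?mule0// => C _; rewrite indic0 mulr0.
have [V V1 VE] := near1_root_fixed lfE th_alg th_fix v_th p_prime vp1 pd rho_gt0 rho1 h1.
have uy := mxGL_unit h; set y := mxGL h in uy.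
have gE : mxGL gamma = y *m V ^+ d *m invmx y.
  by rewrite VE /= !mulmxA mulmxV// mul1mx mulmxK.
have [x ux dE] := twisted_normal_form th_alg th_d th_fix v_th th_indep p_prime vp1 pd char0
  rho_gt0 rho1 (mxGL_unit delta) uw uy V1 gN gE.
have [u [J [uJ u_inj]]] := root_equiv_reps V.
rewrite (orbital_sum_F V1 uJ u_inj uy gE g_semi cP lamP dhP dhgP nuHP formH).
rewrite (orbital_sum_twisted V1 uJ u_inj uy gE g_semi cP lamP ux dE bP uw bwP detP dgP dgdP nuGP formG).
congr ((Num.sqrt _)%:E * _)%E.
apply: (discriminant_eq lfF vEP th_alg th_d th_fix v_th vd rho_gt0 rho1 intertwine V1 _ uy gE ux dE) => X.
have VdE : mxGL gamma = y *m V ^+ d *m invmx y := gE.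
exact: (semisimple_commutator g_semi uy VdE).
Qed.

End OrbitalIntegrals.

(** * Congruence subgroups as balls, and the comparison of the orbital integrals *)

Lemma KE_ball1 (R : realType) (F : fieldType) (E : splittingFieldType F) (vE : absval R E)
    (n m : nat) (w : E) : w != 0 ->
  KE vE w m = ball1 (vE w ^+ m) :> set (GL vE n).
Proof.
move=> w0; have wm0 : w ^+ m != 0 by exact: expf_neq0.
have vw0 : 0 < vE w ^+ m by rewrite exprn_gt0// absv_gt0.
apply/seteqP; split=> [g [X X1 gE]|g g1].
  rewrite /ball1 /= /close1 gE addrC addKr mxnZ absvX -[leRHS]mulr1.
  by rewrite ler_wpM2l ?(ltW vw0)//; apply: mxn_le.
exists ((w ^+ m)^-1 *: (mxGL g - 1%:M)) => [i j|].
  rewrite mxE absvM absvV absvX mulrC ler_pdivrMr// mul1r.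
  exact: le_trans (mxn_ent _ _ _ _) g1.
by rewrite scalerA mulfV// scale1r addrC subrK.
Qed.

Theorem theorem1p2
  (R : realType)
  (p : nat) (p_prime : prime p) (p_odd : odd p)
  (Qp : fieldType) (vp : absval R Qp) (vpP : is_Qp p vp)
  (F : fieldExtType Qp) (vF : absval R F) (vFP : normalized_extension vp vF)
  (E : splittingFieldType F) (vE : absval R E) (vEP : normalized_extension vF vE)
  (d : nat) (dP : \dim {:E} = d) (p_ndvd_d : ~~ (p %| d)%N)
  (galEF : galois 1%VS {:E})
  (theta : gal_of {:E}) (thetaP : generator 'Gal({:E} / 1%VS)%g theta)
  (Fbar : closedFieldType) (iota : {rmorphism E -> Fbar})
  (Fbar_alg : forall x : Fbar, algebraicOver iota x)
  (n : nat) (n_gt0 : (0 < n)%N)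
  (m : nat) (m_gt0 : (0 < m)%N)
  (w : E) (wP : uniformizer vE w)
  (dg : {measure set (borel (GL vE n)) -> \bar R})
  (dgP : haar_measure setT dg)
  (dh : {measure set (borel (GL vF n)) -> \bar R})
  (dhP : haar_measure setT dh) :
  let fH : GL vF n -> R := unit_mass dh (KE_theta vE w m) in
  let fG : GL vE n -> R := unit_mass dg (KE vE w m) in
  forall (gamma : GL vF n) (delta : GL vE n),
    semisimpleF vE iota gamma -> semisimpleE iota delta ->
  forall dh_gamma : {measure set (borel (GL vF n)) -> \bar R},
    haar_measure (centralizerF gamma) dh_gamma ->
  forall nuH : {measure set (borel (coset_space (centralizerF gamma))) -> \bar R},
    quotient_measure dh dh_gamma nuH ->
  (is_norm theta iota gamma delta ->
     forall dg_delta : {measure set (borel (GL vE n)) -> \bar R},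
       haar_measure (twisted_centralizer theta delta) dg_delta ->
       compatible_measures theta iota gamma delta dh_gamma dg_delta ->
     forall nuG :
         {measure set (borel (coset_space (twisted_centralizer theta delta)))
            -> \bar R},
       quotient_measure dg dg_delta nuG ->
     orbital_F fH gamma nuH = orbital_twisted vF theta fG delta nuG)
  /\
  ((forall delta' : GL vE n, ~ is_norm theta iota gamma delta') ->
     orbital_F fH gamma nuH = 0%E).
Proof.
move=> fH fG gamma delta g_semi _ dh_gamma dhgP nuH nuHP.
rewrite -dP in p_ndvd_d.
have th_alg := gal_alg thetaP; have th_d := gal_iter_d dP galEF thetaP; rewrite -dP in th_d.
have th_fix := gal_fixed galEF thetaP.
have th_indep := gal_indep dP galEF thetaP; rewrite -dP in th_indep.
have w1 : vE w < 1 by apply/wP; exists 1; rewrite ?mulr1 ?absv1.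
(* p is nonzero of absolute value below 1, hence a multiple of w. *)
have w0 : w != 0.
  have /andP[p0 p1] := absv_p_lt1 p_prime vpP vFP.
  have [|y _ pE] := (wP p%:R).1.
    by rewrite -[p%:R](rmorph_nat (in_alg E)) /= vEP exprn_ilt1 ?absv_ge0// -lt0n adim_gt0.
  apply: contraTneq p0 => w0; rewrite -leNgt.
  have : (p%:R : F) == 0 by rewrite -(fmorph_eq0 (in_alg E)) rmorph_nat pE w0 mul0r.
  by move=> /eqP ->; rewrite absv0.
(* The radius of K_E(m), below 1 because m is positive. *)
pose rho := vE w ^+ m.
have r0 : 0 < rho by rewrite exprn_gt0// absv_gt0.
have r1 : rho < 1 by rewrite exprn_ilt1 ?absv_ge0// -lt0n.
have KthE : KE_theta vE w m = [set h : GL vF n | close1 vE rho (map_mx (in_alg E) (mxGL h))].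
  by rewrite /KE_theta KE_ball1.
have fHE (C : coset_space (centralizerF gamma)) : fH (conjF (coset_rep C)^-1%g gamma) =
    (fine (dh [set h : GL vF n | close1 vE rho (map_mx (in_alg E) (mxGL h))]))^-1 *
    \1_[set h : GL vF n | close1 vE rho (map_mx (in_alg E) (mxGL (h^-1 * gamma * h)%g))] (coset_rep C).
  rewrite /fH /unit_mass KthE /conjF invgK; congr (_ * _); rewrite !indicE; congr (_ %:R).
split=> [_ dg_delta dgdP comp nuG nuGP|no_norm].
  have fGE (C : coset_space (twisted_centralizer theta delta)) :
      fG (twisted_conj theta (coset_rep C)^-1%g delta) =
      (fine (dg (ball1 rho)))^-1 *
      \1_[set h : GL vE n | ball1 rho (h^-1 * delta * thetaGL theta h)%g] (coset_rep C).
    rewrite /fG /unit_mass KE_ball1//.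
    have -> : twisted_conj theta (coset_rep C)^-1%g delta =
        ((coset_rep C)^-1 * delta * thetaGL theta (coset_rep C))%g.
      by apply: mxGL_inj; rewrite /= map_invmx invmxK.
    by congr (_ * _); rewrite !indicE; congr (_ %:R).
  rewrite /orbital_F /orbital_twisted.
  under eq_integral do rewrite fHE.
  under [in RHS]eq_integral do rewrite fGE.
  exact: (orbital_transfer p_prime vpP vFP vEP p_ndvd_d th_alg th_d th_fix th_indep r0 r1
    g_semi dgP dhP dhgP dgdP comp nuHP nuGP).
rewrite /orbital_F integral0_eq ?mule0// => C _; rewrite fHE indicE.
case: (boolP (_ \in _)) => [|_]; last by rewrite mulr0.
rewrite inE => h1; have [delta' hd] := near1_conj_is_norm p_prime vpP vFP vEP p_ndvd_d th_alg
  th_fix r0 r1 g_semi h1.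
by case: (no_norm delta').
Qed.
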